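(* Let $n\geq2$ and $\gamma\in(0,1)$. There is a constant $C_{n,\gamma}$ depending only on $n$ and $\gamma$ such that for every Schwartz function $f:\mathbb{R}^n\to\mathbb{R}$, $$\Big|\int_{\mathbb{R}^n}\frac{\Lambda^\gamma f(0)-\Lambda^\gamma f(x)}{|x|^n}e^{-|x|}\,dx\Big|\leq C_{n,\gamma}\int_{\mathbb{R}^n}\frac{|f(0)-f(x)|}{|x|^{n+\gamma}}\ln\Big(e+\frac1{|x|}\Big)\,dx.$$
   Context: $\Lambda^\gamma=(-\Delta)^{\gamma/2}$ is defined on $\mathbb{R}^n$ by $\widehat{\Lambda^\gamma f}(\xi)=(2\pi|\xi|)^\gamma\widehat f(\xi)$. *)

(* Defs.v *)
From HB Require Import structures.
From mathcomp Require Import all_boot all_order all_algebra.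
From mathcomp Require Import all_classical all_reals all_analysis.
From mathcomp Require Import complex.

Set Implicit Arguments.
Unset Strict Implicit.
Unset Printing Implicit Defensive.

Import Order.TTheory GRing.Theory Num.Theory.
Import numFieldNormedType.Exports.

Local Open Scope classical_set_scope.
Local Open Scope ring_scope.
Local Open Scope complex_scope.

(* The sigma-algebra on R^n is generated by the coordinate maps; as n is
   finite it is the Borel sigma-algebra of R^n. *)
Definition rV_display : measure_display. Proof. exact: default_measure_display. Qed.

Section measurable_rV.
Context {R : realType} (n : nat).

Let coords : 'I_n -> 'rV[R]_n -> measurableTypeR R := fun i x => x ord0 i.

Let rV_set0 : g_sigma_preimage coords set0.
Proof. exact: sigma_algebra0. Qed.

Let rV_setC A : g_sigma_preimage coords A -> g_sigma_preimage coords (~` A).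
Proof. exact: sigma_algebraC. Qed.

Let rV_bigcup (F : (set 'rV[R]_n)^nat) :
  (forall i, g_sigma_preimage coords (F i)) ->
  g_sigma_preimage coords (\bigcup_i (F i)).
Proof. exact: sigma_algebra_bigcup. Qed.

HB.instance Definition _ := @isMeasurable.Build rV_display
  'rV[R]_n (g_sigma_preimage coords) rV_set0 rV_setC rV_bigcup.

End measurable_rV.

Lemma measurable_coord (R : realType) n (i : 'I_n) :
  measurable_fun [set: 'rV[R]_n]
    ((fun x : 'rV[R]_n => x ord0 i) : 'rV[R]_n -> measurableTypeR R).
Proof.
move=> _ A mA; rewrite setTI; apply: sub_sigma_algebra => /=.
rewrite -bigcup_seq/=; exists i => /=; first by rewrite mem_index_enum.
by exists A => //; rewrite setTI.
Qed.

Lemma measurable_fun_rV d (T : measurableType d) (R : realType) n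
    (f : T -> 'rV[R]_n) :
  (forall i, measurable_fun [set: T]
    ((fun t => f t ord0 i) : T -> measurableTypeR R)) ->
  measurable_fun [set: T] f.
Proof.
move=> mf; apply: (measurability (\big[setU/set0]_(i < n)
  preimage_set_system setT
    ((fun x : 'rV[R]_n => x ord0 i) : 'rV[R]_n -> measurableTypeR R)
    measurable)) => //.
move=> _ [B + <-]; rewrite -bigcup_seq => -[i _ [A mA <-]].
by rewrite setTI setTI -comp_preimage -[X in measurable X]setTI; exact: mf.
Qed.

Definition rV_cons {R : realType} n (p : R * 'rV[R]_n) : 'rV[R]_n.+1 :=
  \row_(i < n.+1) oapp (p.2 ord0) p.1 (unlift ord0 i).

Definition rV_uncons {R : realType} n (x : 'rV[R]_n.+1) : R * 'rV[R]_n :=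
  (x ord0 ord0, \row_(i < n) x ord0 (lift ord0 i)).

Lemma rV_cons0 (R : realType) n (p : R * 'rV[R]_n) : rV_cons p ord0 ord0 = p.1.
Proof. by rewrite mxE unlift_none. Qed.

Lemma rV_consS (R : realType) n (p : R * 'rV[R]_n) i :
  rV_cons p ord0 (lift ord0 i) = p.2 ord0 i.
Proof. by rewrite mxE liftK. Qed.

Lemma rV_consK (R : realType) n : cancel (@rV_cons R n) (@rV_uncons R n).
Proof.
case=> a v; rewrite /rV_uncons rV_cons0; congr pair.
by apply/rowP => i; rewrite mxE rV_consS.
Qed.

Lemma measurable_rV_cons (R : realType) n :
  measurable_fun [set: measurableTypeR R * 'rV[R]_n] (@rV_cons R n).
Proof.
apply: measurable_fun_rV => i; have [->|i0] := eqVneq i ord0.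
- by under eq_fun do rewrite rV_cons0; exact: measurable_fst.
- have [j ->] : exists j, i = lift ord0 j.
    by case: (unliftP ord0 i) i0 => [j ->|->]; [exists j|rewrite eqxx].
  under eq_fun do rewrite rV_consS.
  exact: (measurableT_comp (@measurable_coord R n j) measurable_snd).
Qed.

Lemma measurable_rV_uncons (R : realType) n :
  measurable_fun [set: 'rV[R]_n.+1]
    (@rV_uncons R n : 'rV[R]_n.+1 -> measurableTypeR R * 'rV[R]_n).
Proof.
apply: measurable_fun_pair; first exact: measurable_coord.
apply: measurable_fun_rV => i.
by under eq_fun do rewrite mxE; exact: measurable_coord.
Qed.

Section cons_measure.
Context {R : realType} (n : nat).
Local Open Scope ereal_scope.

Definition cons_measure (mu : set 'rV[R]_n -> \bar R) :
    set 'rV[R]_n.+1 -> \bar R :=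
  pushforward (@lebesgue_measure R \x mu) (@rV_cons R n).

Variable mu : {sigma_finite_measure set 'rV[R]_n -> \bar R}.

Let mcons := @measurable_rV_cons R n.

Let cons_measure0 : cons_measure mu set0 = 0.
Proof. exact: measure0. Qed.

Let cons_measure_ge0 A : 0 <= cons_measure mu A.
Proof. exact: measure_ge0. Qed.

Let cons_measure_sigma_additive : semi_sigma_additive (cons_measure mu).
Proof. exact: measure_semi_sigma_additive. Qed.

HB.instance Definition _ := isMeasure.Build _ _ _ (cons_measure mu)
  cons_measure0 cons_measure_ge0 cons_measure_sigma_additive.

Let cons_measure_sigma_finite : sigma_finite setT (cons_measure mu).
Proof.
have /sigma_finiteP[F [TF ndF Foo]] := sigma_finiteT (@lebesgue_measure R).
have /sigma_finiteP[G [TG ndG Goo]] := sigma_finiteT mu.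
exists (fun k => @rV_uncons R n @^-1` (F k `*` G k)).
  rewrite predeqE => x; split=> // _.
  have [i _ Fi] : (\bigcup_i F i) (rV_uncons x).1 by rewrite -TF.
  have [j _ Gj] : (\bigcup_i G i) (rV_uncons x).2 by rewrite -TG.
  exists (maxn i j) => //; split.
  - by move: Fi; exact/subsetPset/ndF/leq_maxl.
  - by move: Gj; exact/subsetPset/ndG/leq_maxr.
move=> k; have [mF Fk] := Foo k; have [mG Gk] := Goo k; split.
  rewrite -[X in measurable X]setTI; apply: measurable_rV_uncons => //.
  exact: measurableX.
rewrite /cons_measure /pushforward (_ : _ @^-1` _ = F k `*` G k).
  by rewrite product_measure1E// lte_mul_pinfty// ge0_fin_numE.
by apply/seteqP; split => p; rewrite /preimage /mkset rV_consK.
Qed.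

HB.instance Definition _ := Measure_isSigmaFinite.Build _ _ _ (cons_measure mu)
  cons_measure_sigma_finite.

End cons_measure.

(* Lebesgue measure on R^n, as the n-fold product of lebesgue_measure. *)
Fixpoint lebesgue_rV {R : realType} (n : nat) :
    {sigma_finite_measure set 'rV[R]_n -> \bar R} :=
  match n with
  | 0%N => dirac (0 : 'rV[R]_0)
  | m.+1 => cons_measure (lebesgue_rV m)
  end.

Section fourier.
Context {R : realType} {n : nat}.
Implicit Types (x y xi : 'rV[R]_n) (F : 'rV[R]_n -> R[i]) (f : 'rV[R]_n -> R).

Definition dotp x y : R := \sum_(i < n) x ord0 i * y ord0 i.

(* The library norm on 'rV[R]_n is the sup norm. *)
Definition enorm x : R := Num.sqrt (dotp x x).

Definition cintegral F : R[i] :=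
  (\int[lebesgue_rV n]_x complex.Re (F x)) +i*
  (\int[lebesgue_rV n]_x complex.Im (F x)).

Definition expi (t : R) : R[i] := cos t +i* sin t.

Definition fourier F xi : R[i] :=
  cintegral (fun x => F x * expi (- (2 * pi * dotp x xi))).

Definition inv_fourier F x : R[i] :=
  cintegral (fun xi => F xi * expi (2 * pi * dotp x xi)).

(* The multiplier is real and even, so for real-valued f the inverse
   transform is real-valued and Re only changes its type. *)
Definition frac_laplacian (gamma : R) f x : R :=
  complex.Re (inv_fourier
    (fun xi => ((2 * pi * enorm xi) `^ gamma)%:C *
               fourier (fun y => (f y)%:C) xi) x).

End fourier.

Section schwartz.
Context {R : realType} {n : nat}.
Implicit Types (f : 'rV[R]_n -> R) (s : seq 'I_n) (a : 'I_n -> nat).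

Definition partial (i : 'I_n) f : 'rV[R]_n -> R :=
  fun x => 'D_(delta_mx ord0 i) f x.

(* Multi-indices of derivatives are given as lists of directions. *)
Definition partials s f : 'rV[R]_n -> R := foldr partial f s.

(* All iterated partial derivatives being differentiable everywhere amounts
   to f being C^oo. *)
Definition smooth f : Prop :=
  forall s (x : 'rV[R]_n), differentiable (partials s f) x.

Definition schwartz f : Prop :=
  smooth f /\
  forall a s, exists M : R, forall x : 'rV[R]_n,
    `|(\prod_(i < n) x ord0 i ^+ a i) * partials s f x| <= M.

End schwartz.

(* Main.v *)
Require Import Defs.
From HB Require Import structures.
From mathcomp Require Import all_boot all_order all_algebra.
From mathcomp Require Import all_classical all_reals all_analysis.
From mathcomp Require Import complex ring lra measurable_realfun lebesgue_integral_under.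

(** Put h(x) = Lambda^gamma f(0) - Lambda^gamma f(x), delta = gamma / 2, and let
    p_u be the heat kernel of R^n at time u, so that the Fourier transform of
    p_u is exp(- u L) with L(xi) = (2 pi |xi|)^2, the symbol of minus the
    laplacian.  Two subordination formulas write the multiplier of Lambda^gamma and the
    weight e^-|x| / |x|^n as superpositions of exponentials of L and of heat
    kernels:
    - [bernstein_power]: L^delta = A^-1 int exp(- delta s) (1 - exp(- e^s L)) ds;
    - [mix_heat]: e^-r / r^n = c^-1 int mix(t) p_(e^t)(r) dt, where mix >= 0 is
      bounded and decays like exp(- e^t / 2) at +oo.
    All times are written as exponentials, so that dilations become translations
    of the line.

    By the second formula the integral on the left is an average, over t, of
    the numbers int p_(e^t) h.  On the Fourier side int p_b h is the integral of
    L^delta (1 - exp(- b L)) against the (real part of the) transform of f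
    ([integral_heat_lap_diff]); inserting the first formula produces
      (1 - exp(- a L)) (1 - exp(- b L)) =
        (1 - exp(- a L)) + (1 - exp(- b L)) - (1 - exp(- (a + b) L)),
    with a = e^s and b = e^t, and Fourier inversion gives
      int p_b h = A^-1 int exp(- delta s)
                    int (p_a + p_b - p_(a + b))(y) (f(0) - f(y)) dy ds
    ([heat_lap_diff_second_diff]).  The fractional laplacian has disappeared, and
    by Tonelli's theorem it remains to bound, for fixed r = |y|,
      int int mix(t) exp(- delta s) |p_a + p_b - p_(a + b)|(r) ds dt
        <= K ln(e + 1/r) / r^(n + gamma),
    which is [kernel_le].  If a <= b then p_b - p_(a + b) is smaller than p_b by
    a factor a / b, so up to terms that decay exponentially in |t - s| only p_a
    with a <= b survives.  The measure of the set of those t, weighted by mix,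
    is at most a multiple of 1 + max(0, - s); since p_(e^s)(r) is concentrated
    where e^s is of order r^2, this is the logarithm of the statement.

    The analytic input is elementary.  Gaussian Fourier transforms come from a
    differential equation in the frequency.  The transform of a Schwartz
    function decays because a translation by half a period changes the sign of
    the phase, which replaces integration by parts ([osc_shift]).  Inversion at
    the origin is obtained by letting the time of the heat kernel go to 0. *)

Set Implicit Arguments.
Unset Strict Implicit.
Unset Printing Implicit Defensive.

Import Order.TTheory GRing.Theory Num.Theory.
Import numFieldNormedType.Exports.

Local Open Scope classical_set_scope.
Local Open Scope ring_scope.

(** * Dominated integrability and Fubini *)

Section generic.
Context d (T : measurableType d) (R : realType) (m : {measure set T -> \bar R}).
Implicit Types F G : T -> R.

Lemma integrable_dom F G : measurable_fun setT F -> (forall x, `|F x| <= G x) ->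
  m.-integrable setT (EFin \o G) -> m.-integrable setT (EFin \o F).
Proof.
move=> mF FG iG; apply: le_integrable iG => //.
- by apply/measurable_EFinP.
- by move=> x _ /=; rewrite lee_fin (le_trans (FG x))// ler_norm.
Qed.

Lemma integrable_ltyP F : measurable_fun setT F ->
  (\int[m]_x `|F x|%:E < +oo)%E -> m.-integrable setT (EFin \o F).
Proof.
by move=> mF Foo; apply/integrableP; split => //; exact/measurable_EFinP.
Qed.

Lemma integrable_lty F : m.-integrable setT (EFin \o F) ->
  (\int[m]_x `|F x|%:E < +oo)%E.
Proof. by move/integrableP => []. Qed.

Lemma integralE_Rintegral F : m.-integrable setT (EFin \o F) ->
  (\int[m]_x (F x)%:E = (\int[m]_x F x)%:E)%E.
Proof. by move=> iF; rewrite fineK//; exact: integrable_fin_num. Qed.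

Lemma integralZl_EFin F (k : R) : m.-integrable setT (EFin \o F) ->
  (\int[m]_x (k * F x)%:E = k%:E * \int[m]_x (F x)%:E)%E.
Proof.
by move=> iF; under eq_integral do rewrite EFinM; rewrite integralZl.
Qed.

Lemma integrable_scale F (k : R) : m.-integrable setT (EFin \o F) ->
  m.-integrable setT (EFin \o (fun x => k * F x)).
Proof. by move=> /(integrableZl measurableT k). Qed.

Lemma integrable_add F G : m.-integrable setT (EFin \o F) ->
  m.-integrable setT (EFin \o G) ->
  m.-integrable setT (EFin \o (fun x => F x + G x)).
Proof. by move=> iF iG; exact: (integrableD measurableT iF iG). Qed.

Lemma integrable_sub F G : m.-integrable setT (EFin \o F) ->
  m.-integrable setT (EFin \o G) ->
  m.-integrable setT (EFin \o (fun x => F x - G x)).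
Proof. by move=> iF iG; exact: (integrableB measurableT iF iG). Qed.

End generic.

Section fubini_dominated.
Context d1 d2 (T1 : measurableType d1) (T2 : measurableType d2) (R : realType).
Variables (m1 : {sigma_finite_measure set T1 -> \bar R})
  (m2 : {sigma_finite_measure set T2 -> \bar R}).
Variable F : T1 -> T2 -> R.
Hypothesis mF : measurable_fun setT (fun p : T1 * T2 => F p.1 p.2).

Lemma measurable_section1 : forall x, measurable_fun setT (F x).
Proof.
by move=> x; exact: (measurableT_comp mF (pair1_measurable x)).
Qed.

(** Measurability of a parametric integral needs no integrability: the integrals
    of the positive and of the negative part are measurable separately. *)
Lemma measurable_Rintegral2 : measurable_fun setT (fun x => \int[m2]_y F x y).
Proof.
rewrite /Rintegral; apply: measurableT_comp => //.
have mF' : measurable_fun setT (EFin \o (fun p : T1 * T2 => F p.1 p.2)).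
  exact/measurable_EFinP.
under eq_fun do rewrite integralE.
apply: emeasurable_funB.
- rewrite (_ : (fun x => _) = fubini_F m2 (EFin \o (fun p : T1 * T2 => F p.1 p.2))^\+%E).
    by apply: measurable_fun_fubini_tonelli_F => //; exact: measurable_funepos.
  by apply/funext => x; apply: eq_integral => y _; rewrite !funeposE.
- rewrite (_ : (fun x => _) = fubini_F m2 (EFin \o (fun p : T1 * T2 => F p.1 p.2))^\-%E).
    by apply: measurable_fun_fubini_tonelli_F => //; exact: measurable_funeneg.
  by apply/funext => x; apply: eq_integral => y _; rewrite !funenegE.
Qed.

Variables (A : T1 -> R) (B : T2 -> R).
Hypotheses (iA : m1.-integrable setT (EFin \o A))
  (iB : m2.-integrable setT (EFin \o B)).
Hypothesis FAB : forall x y, `|F x y| <= A x * B y.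

(** The form in which most applications of Fubini's theorem below are justified:
    a bound by a product of integrable functions of one variable each. *)
Lemma integrable_prod_dom :
  (m1 \x m2)%E.-integrable setT (fun p : T1 * T2 => (F p.1 p.2)%:E).
Proof.
have mB : measurable_fun setT (fun y => `|B y|).
  by apply: measurableT_comp => //; have /integrableP[/measurable_EFinP] := iB.
have mA : measurable_fun setT (fun y => `|A y|).
  by apply: measurableT_comp => //; have /integrableP[/measurable_EFinP] := iA.
apply/integrable12ltyP; first exact/measurable_EFinP.
apply: (@le_lt_trans _ _
  (\int[m1]_x (`|A x|%:E * \int[m2]_y `|B y|%:E))%E).
  apply: ge0_le_integral => //.
  - by move=> x _; apply: integral_ge0.
  - apply: (@measurable_fun_fubini_tonelli_F _ _ _ _ _ m2
      (abse \o (EFin \o (fun p : T1 * T2 => F p.1 p.2)))) => //.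
      by apply: measurableT_comp => //; exact/measurable_EFinP.
    by move=> p; exact: abse_ge0.
  - under eq_fun do rewrite muleC; apply: measurable_funeM.
    exact/measurable_EFinP.
  move=> x _; rewrite -ge0_integralZl//; last exact/measurable_EFinP.
  apply: ge0_le_integral => //=.
  - by apply/measurable_EFinP; apply: measurableT_comp => //; exact: measurable_section1.
  - by apply/measurable_EFinP; apply: measurable_funM.
  move=> y _; rewrite lee_fin -normrM (le_trans (FAB x y))// ler_norm//.
rewrite ge0_integralZr//; [|exact/measurable_EFinP|exact: integral_ge0].
by rewrite lte_mul_pinfty ?integrable_lty ?integral_ge0// ge0_fin_numE ?integrable_lty// integral_ge0.
Qed.

Lemma fubini_dom : (\int[m1]_x \int[m2]_y (F x y)%:E =
  \int[m2]_y \int[m1]_x (F x y)%:E)%E.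
Proof. exact: (Fubini integrable_prod_dom). Qed.

End fubini_dominated.

(** * Integrals on the line *)

Section line.
Context {R : realType}.
Notation mu := (@lebesgue_measure R).
Implicit Types (f : R -> \bar R).

(** Lebesgue measure is determined by its values on half-open intervals, which a
    translation permutes. *)
Lemma pushforward_shift (a : R) (A : set R) : measurable A ->
  mu A = pushforward mu (fun x : R => x + a) A.
Proof.
have ms : measurable_fun [set: measurableTypeR R]
    ((fun x : R => x + a) : measurableTypeR R -> measurableTypeR R).
  exact: measurable_funD.
pose mx := isMeasurableFun.Build _ _ _ _ _ ms.
pose F : {mfun measurableTypeR R >-> measurableTypeR R} :=
  HB.pack (fun x : R => x + a : R) mx.
move=> mA.
apply: (@lebesgue_measure_unique R (pushforward mu F)) => //.
move=> _ [[b c] _ <-] /=.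
rewrite /pushforward (_ : _ @^-1` _ = `]b - a, c - a]%classic).
  rewrite !lebesgue_measure_itv/= !lte_fin ltrD2r; case: ifP => // _.
  by rewrite -!EFinD; congr EFin; ring.
by apply/seteqP; split => x /=; rewrite !in_itv/= -lerBrDr ltrBlDr.
Qed.

Lemma pushforward_opp (A : set R) : measurable A ->
  mu A = pushforward mu (fun x : R => - x) A.
Proof.
have ms : measurable_fun [set: measurableTypeR R]
    ((fun x : R => - x) : measurableTypeR R -> measurableTypeR R).
  exact: measurableT_comp.
pose mx := isMeasurableFun.Build _ _ _ _ _ ms.
pose F : {mfun measurableTypeR R >-> measurableTypeR R} :=
  HB.pack (fun x : R => - x : R) mx.
move=> mA.
apply: (@lebesgue_measure_unique R (pushforward mu F)) => //.
move=> _ [[b c] _ <-] /=.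
rewrite /pushforward (_ : _ @^-1` _ = `[- c, - b[%classic).
  rewrite !lebesgue_measure_itv/= !lte_fin ltrN2; case: ifP => // _.
  by rewrite -!EFinD; congr EFin; ring.
by apply/seteqP; split => x /=; rewrite !in_itv/= lerNl ltrNr andbC.
Qed.

(** Holds without integrability, since positive and negative parts are both
    invariant; as times are written e^s, it is the scaling rule used below. *)
Lemma integral_shift f (a : R) : measurable_fun setT f ->
  (\int[mu]_x f (x + a)%R = \int[mu]_x f x)%E.
Proof.
move=> mf.
have ms : measurable_fun [set: measurableTypeR R]
    ((fun x : R => x + a) : measurableTypeR R -> measurableTypeR R).
  exact: measurable_funD.
have H g : measurable_fun setT g -> (forall x, 0 <= g x)%E ->
    (\int[mu]_x g (x + a)%R = \int[mu]_x g x)%E.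
  move=> mg g0.
  rewrite -(@ge0_integral_pushforward _ _ _ _ _ _ ms mu setT g)//.
  by apply: eq_measure_integral => A mA _; exact/esym/pushforward_shift.
rewrite integralE [RHS]integralE.
rewrite -(H _ (measurable_funepos mf))// -(H _ (measurable_funeneg mf))//.
by congr (_ - _)%E; apply: eq_integral => x _; rewrite ?funeposE ?funenegE.
Qed.

Lemma ge0_integral_opp f : measurable_fun setT f -> (forall x, 0 <= f x)%E ->
  (\int[mu]_x f (- x)%R = \int[mu]_x f x)%E.
Proof.
move=> mf f0.
have ms : measurable_fun [set: measurableTypeR R]
    ((fun x : R => - x) : measurableTypeR R -> measurableTypeR R).
  exact: measurableT_comp.
rewrite -(@ge0_integral_pushforward _ _ _ _ _ _ ms mu setT f)//.
by apply: eq_measure_integral => A mA _; exact/esym/pushforward_opp.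
Qed.

Lemma integrable_shift (F : R -> R) (a : R) :
  mu.-integrable setT (EFin \o F) ->
  mu.-integrable setT (EFin \o (fun x => F (x + a))).
Proof.
move=> iF; have /integrableP[mF' Foo] := iF.
have mF : measurable_fun setT F by apply/measurable_EFinP.
have ms : measurable_fun [set: measurableTypeR R]
    ((fun x : R => x + a) : measurableTypeR R -> measurableTypeR R).
  exact: measurable_funD.
apply: integrable_ltyP; first exact: (measurableT_comp mF ms).
rewrite (@integral_shift (fun x => `|F x|%:E) a)//.
by apply/measurable_EFinP; exact: measurableT_comp.
Qed.

Lemma continuous_onePsqrV : continuous (fun x : R => (1 + x ^+ 2)^-1).
Proof.
move=> x; apply: cvgV; first by rewrite gt_eqF// ltr_pwDl// sqr_ge0.
apply: cvgD; first exact: cvg_cst.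
exact: exprn_continuous.
Qed.

(** The antiderivative atan is bounded. *)
Lemma integrable_onePsqrV :
  mu.-integrable setT (EFin \o (fun x : R => (1 + x ^+ 2)^-1)).
Proof.
have J0 (x : R) : 0 <= (1 + x ^+ 2)^-1 by rewrite invr_ge0 addr_ge0// sqr_ge0.
apply: integrable_ltyP.
  by apply: continuous_measurable_fun; exact: continuous_onePsqrV.
under eq_integral do rewrite ger0_norm//.
rewrite ge0_symfun_integralT//; last 2 first.
- exact: continuous_onePsqrV.
- by move=> x; rewrite /= sqrrN.
rewrite (_ : [set x | _] = `[0, +oo[%classic); last first.
  by apply/seteqP; split => x/=; rewrite in_itv/= andbT.
rewrite (@ge0_continuous_FTC2y _ _ atan 0 (pi / 2)) //.
- by rewrite -EFinB -EFinM ltry.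
- by apply: continuous_subspaceT; exact: continuous_onePsqrV.
- exact: cvgy_atan.
- by apply: cvg_at_right_filter; exact: continuous_atan.
- by move=> x _; rewrite derive1_atan.
Qed.

Lemma integrable_expR_absr (al : R) : 0 < al ->
  mu.-integrable setT (EFin \o (fun x : R => expR (- (al * `|x|)))).
Proof.
move=> al0.
apply: (@integrable_dom _ _ _ mu _ (fun x : R => (1 + 2 / al ^+ 2) * (1 + x ^+ 2)^-1)).
- apply: continuous_measurable_fun => x; apply: continuous_comp => /=; last exact: continuous_expR.
  by apply: cvgN; apply: cvgMr; exact: norm_continuous.
- move=> x; rewrite ger0_norm ?expR_ge0// expRN.
  have x0 : 0 < 1 + x ^+ 2 by rewrite ltr_pwDl// sqr_ge0.
  rewrite ler_pdivlMr// mulrC ler_pdivrMr ?expR_gt0//.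
  have /(_ 1%N) := @expR_ge1Dxn R (al * `|x|) ^~ (mulr_ge0 (ltW al0) (normr_ge0 x)).
  rewrite exprMn real_normK ?num_real// factE/= => H.
  apply: le_trans (ler_wpM2l _ H); last by rewrite addr_ge0// divr_ge0// sqr_ge0.
  rewrite [leRHS](_ : _ = 1 + x ^+ 2 + (2 / al ^+ 2 + al ^+2 * x ^+ 2 / 2)).
    rewrite lerDl addr_ge0//.
      by rewrite divr_ge0// sqr_ge0.
    by rewrite divr_ge0// mulr_ge0// sqr_ge0.
  by rewrite muln1; field; rewrite gt_eqF.
- exact/integrable_scale/integrable_onePsqrV.
Qed.

End line.

(** * Gaussian integrals and the subordination integral *)

Section gauss1.
Context {R : realType}.
Notation mu := (@lebesgue_measure R).

(** The function is the density of the centred normal law of variance 1 / (2 a),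
    up to its normalization. *)
Lemma integral_gauss1 (a : R) : 0 < a ->
  (\int[mu]_x (expR (- (a * x ^+ 2)))%:E = (Num.sqrt (pi / a))%:E)%E.
Proof.
move=> a0.
pose s := Num.sqrt (1 / (2 * a)).
have s2 : s ^+ 2 = 1 / (2 * a) by rewrite sqr_sqrtr// divr_ge0// mulr_ge0// ltW.
have s0 : s != 0.
  by rewrite gt_eqF// sqrtr_gt0 divr_gt0// mulr_gt0.
have := integral_normal_pdf 0 s.
have peak : normal_peak s = (Num.sqrt (pi / a))^-1.
  congr (Num.sqrt _)^-1; rewrite s2 -mulr_natr; field.
  by rewrite gt_eqF.
under eq_integral => x _.
  rewrite normal_pdfE//= peak /normal_fun subr0 s2.
  rewrite (_ : - x ^+ 2 / _ = - (a * x ^+ 2)); last first.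
    by rewrite -mulr_natr; field; rewrite gt_eqF.
  over.
have pi0 : 0 < Num.sqrt (pi / a) by rewrite sqrtr_gt0 divr_gt0// pi_gt0.
have mg : measurable_fun setT (fun x : R => expR (- (a * x ^+ 2))).
  apply: measurableT_comp => //; apply: measurableT_comp => //.
  by apply: measurable_funM => //; exact: measurable_funX.
under eq_integral do rewrite EFinM.
rewrite ge0_integralZl//; last exact/measurable_EFinP.
move=> /(congr1 (fun z => (Num.sqrt (pi / a))%:E * z)%E).
by rewrite muleA -EFinM mulfV ?gt_eqF// mul1e mule1.
Qed.

Lemma measurable_gauss1 (a : R) :
  measurable_fun setT (fun x : R => expR (- (a * x ^+ 2))).
Proof.
apply: measurableT_comp => //; apply: measurableT_comp => //.
by apply: measurable_funM => //; exact: measurable_funX.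
Qed.

Lemma integrable_gauss1 (a : R) : 0 < a ->
  mu.-integrable setT (EFin \o (fun x : R => expR (- (a * x ^+ 2)))).
Proof.
move=> a0; apply: integrable_ltyP; first exact: measurable_gauss1.
under eq_integral do rewrite ger0_norm ?expR_ge0//.
by rewrite integral_gauss1// ltry.
Qed.

End gauss1.

Section subordination.
Context {R : realType}.
Notation mu := (@lebesgue_measure R).

(** The substitution of this section is y = 2 sinh (z / 2).  Its inverse is
   z = as_ y, and w y = e^(z / 2) is the positive root of w - 1 / w = y. *)
Let w (y : R) := (y + Num.sqrt (y ^+ 2 + 4)) / 2.

Let sq_gt0 (y : R) : 0 < y ^+ 2 + 4.
Proof. by rewrite ltr_wpDl// sqr_ge0. Qed.

Let w2 y : (w y * 2 - y) ^+ 2 = y ^+ 2 + 4.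
Proof.
rewrite [X in X ^+ 2](_ : _ = Num.sqrt (y ^+ 2 + 4)); last by rewrite /w; field.
by rewrite sqr_sqrtr// ltW.
Qed.

Let w_gt0 y : 0 < w y.
Proof.
rewrite divr_gt0//.
have : `|y| < Num.sqrt (y ^+ 2 + 4).
  by rewrite -sqrtr_sqr ltr_sqrt// ltrDl.
by have := ler_norm (- y); rewrite normrN => *; lra.
Qed.

Let wV y : (w y)^-1 = w y - y.
Proof.
have w0 : w y != 0 by rewrite gt_eqF.
apply: (mulfI w0); rewrite mulfV//.
by have := w2 y; nra.
Qed.

Let as_ (y : R) := ln (w y) * 2.

Let expR_as y : expR (as_ y / 2) = w y.
Proof. by rewrite /as_ mulfK// lnK// posrE. Qed.

Let is_derive_w (y : R) : is_derive y (1 : R) w (w y / Num.sqrt (y ^+ 2 + 4)).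
Proof.
have := sq_gt0 y => y0.
have -> : w = (fun y : R => 2^-1 *: (y + Num.sqrt (y ^+ 2 + 4))).
  by apply/funext => z; rewrite /w /GRing.scale/= mulrC.
have H : is_derive (y ^+ 2 + 4) 1 (@Num.sqrt R) (2 * Num.sqrt (y ^+ 2 + 4))^-1.
  exact: is_derive1_sqrt.
have H2 : is_derive y 1 (fun z : R => z ^+ 2 + 4) (2 * y).
  by apply: is_derive_eq; rewrite addr0 /GRing.scale/=; ring.
have H3 := @is_derive1_comp R (@Num.sqrt R) (fun z : R => z ^+ 2 + 4) y _ _ H H2.
apply: (is_derive_eq (is_deriveZ 2^-1 (is_deriveD (is_derive_id y (1:R)) H3))).
rewrite /GRing.scale /=.
by field; rewrite gt_eqF ?sqrtr_gt0.
Qed.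

Let is_derive_as (y : R) : is_derive y (1 : R) as_ (2 / Num.sqrt (y ^+ 2 + 4)).
Proof.
have -> : as_ = (fun y : R => 2 *: (ln (w y))).
  by apply/funext => z; rewrite /as_ /GRing.scale/= mulrC.
have H := @is_derive1_comp R (@ln R) w y _ _ (is_derive1_ln (w_gt0 y)) (is_derive_w y).
apply: is_derive_eq; rewrite /GRing.scale/=.
by field; rewrite !gt_eqF ?sqrtr_gt0.
Qed.

Let sqrt_ge (y : R) : `|y| <= Num.sqrt (y ^+ 2 + 4).
Proof. by rewrite -sqrtr_sqr ler_sqrt// ?lerDl// ltW. Qed.

Let w_mono : {homo as_ : x y / (x < y)}.
Proof.
move=> x y xy; rewrite /as_ ltr_pM2r// ltr_ln ?posrE//.
have [//|yx] := ltP (w x) (w y).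
have : (w x)^-1 <= (w y)^-1 by rewrite lef_pV2 ?posrE.
by rewrite !wV => ?; lra.
Qed.

Let cvg_as_y : as_ y @[y --> +oo] --> +oo.
Proof.
apply/cvgryPge => A.
near=> y.
rewrite /as_ -ler_pdivrMr// -[leLHS]expRK ler_ln ?posrE ?expR_gt0//.
have yA : expR (A / 2) <= y by near: y; apply: nbhs_pinfty_ge; rewrite num_real.
rewrite (le_trans yA)//.
have := sqrt_ge y; have := ler_norm y; rewrite /w; lra.
Unshelve. all: end_near. Qed.

Let as_N y : as_ (- y) = - as_ y.
Proof.
rewrite /as_ -mulNr; congr (_ * _); rewrite -lnV ?posrE//; congr ln.
by rewrite wV /w sqrrN; field.
Qed.

Let cvg_as_Ny : as_ y @[y --> -oo] --> -oo.
Proof.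
apply/cvgNry.
rewrite (_ : - as_ = as_ \o -%R); last by apply/funext => y; rewrite /= as_N.
apply: cvg_comp cvg_as_y; exact/cvgNry.
Qed.

Let deriv_as : as_^`()%classic = (fun y : R => 2 / Num.sqrt (y ^+ 2 + 4)).
Proof.
apply/funext => y; rewrite derive1E.
by have := is_derive_as y => H; rewrite derive_val.
Qed.

Let cvg_deriv_as_y : (2 / Num.sqrt ((y : R) ^+ 2 + 4)) @[y --> +oo] --> (0 : R).
Proof.
apply/cvgrPdist_le => e e0; near=> y.
rewrite sub0r normrN ger0_norm ?divr_ge0// ler_pdivrMr ?sqrtr_gt0//.
rewrite mulrC -ler_pdivrMr//.
have ye : 2 / e <= y by near: y; apply: nbhs_pinfty_ge; rewrite num_real.
by rewrite (le_trans ye)// (le_trans (ler_norm _)).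
Unshelve. all: end_near. Qed.

Let cvg_deriv_as_Ny : (2 / Num.sqrt ((y : R) ^+ 2 + 4)) @[y --> -oo] --> (0 : R).
Proof.
apply/cvgrPdist_le => e e0; near=> y.
rewrite sub0r normrN ger0_norm ?divr_ge0// ler_pdivrMr ?sqrtr_gt0//.
rewrite mulrC -ler_pdivrMr//.
have ye : y <= - (2 / e) by near: y; apply: nbhs_ninfty_le; rewrite num_real.
apply: le_trans (sqrt_ge y); rewrite -normrN.
by apply: le_trans (ler_norm _); lra.
Unshelve. all: end_near. Qed.

Let continuous_das : continuous (fun y : R => 2 / Num.sqrt (y ^+ 2 + 4)).
Proof.
move=> y; apply: cvgM; first exact: cvg_cst.
apply: cvgV; first by rewrite gt_eqF// sqrtr_gt0.
apply: (@continuous_comp _ _ _ (fun y : R => y ^+ 2 + 4)); last exact: sqrt_continuous.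
by apply: cvgD; [exact: exprn_continuous|exact: cvg_cst].
Qed.

Let k (r z : R) := expR (- (r * ((expR z + expR (- z)) / 2))).

Let continuous_k r : continuous (k r).
Proof.
move=> z; apply: continuous_comp; last exact: continuous_expR.
apply: cvgN; apply: cvgMr; apply: cvgMl; apply: cvgD.
  exact: continuous_expR.
apply: continuous_comp; last exact: continuous_expR.
exact: opp_continuous.
Qed.

(** The reflection z -> - z replaces e^(z / 2) by cosh (z / 2).  With
    y = 2 sinh (z / 2) one has cosh z = 1 + y^2 / 2 and dy = cosh (z / 2) dz, so
    the integral is Gaussian.  This is the subordination of e^-r to Gaussians. *)
Lemma integral_expR_cosh (r : R) : 0 < r ->
  (\int[mu]_z (expR (z / 2) * expR (- (r * ((expR z + expR (- z)) / 2))))%:E =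
   (Num.sqrt (2 * pi / r) * expR (- r))%:E)%E.
Proof.
move=> r0; rewrite -/(k r _).
under eq_integral do rewrite -/(k r _).
have ce (c : R) : continuous (fun z : R => expR (c * z)).
  move=> z; apply: continuous_comp; last exact: continuous_expR.
  by apply: cvgMr; exact: cvg_id.
have ckM c : continuous (fun z : R => expR (c * z) * k r z).
  by move=> z; apply: cvgM; [exact: ce|exact: continuous_k].
set I := LHS.
have mI c : measurable_fun setT (fun z : R => (expR (c * z) * k r z)%:E).
  by apply/measurable_EFinP; apply: continuous_measurable_fun.
have I1 : I = (\int[mu]_z (expR (2^-1 * z) * k r z)%:E)%E.
  by apply: eq_integral => z _; rewrite mulrC [2^-1 * z]mulrC mulrC.
have I2 : I = (\int[mu]_z (expR (- 2^-1 * z) * k r z)%:E)%E.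
  rewrite I1 -(ge0_integral_opp (mI _)); last first.
    by move=> z; rewrite lee_fin mulr_ge0// expR_ge0.
  apply: eq_integral => z _; congr ((expR _ * expR _)%:E); first by ring.
  by rewrite opprK [expR (- z) + _]addrC.
have kp c z : (0 <= (expR (c * z) * k r z)%:E)%E.
  by rewrite lee_fin mulr_ge0// expR_ge0.
pose G z := (expR (2^-1 * z) + expR (- 2^-1 * z)) / 2 * k r z.
have cG : continuous G.
  move=> z; apply: cvgM; last exact: continuous_k.
  by apply: cvgM; last exact: cvg_cst; apply: cvgD; exact: ce.
have G0 z : 0 <= G z.
  by rewrite mulr_ge0 ?expR_ge0// divr_ge0// addr_ge0// expR_ge0.
have key : (\int[mu]_z (G z)%:E =
   \int[mu]_y (expR (- r) * expR (- (r / 2 * y ^+ 2)))%:E)%E.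
  have das z : derivable as_ z 1 by apply: ex_derive; exact: is_derive_as.
  have cdas : continuous as_^`()%classic by rewrite deriv_as; exact: continuous_das.
  have cy : cvg (as_^`()%classic x @[x --> +oo]).
    by rewrite deriv_as; apply/cvg_ex; exists 0.
  have cNy : cvg (as_^`()%classic x @[x --> -oo]).
    by rewrite deriv_as; apply/cvg_ex; exists 0.
  rewrite (increasing_ge0_integration_by_substitutionT w_mono cdas cNy cy das
    cvg_as_Ny cvg_as_y cG G0).
  apply: eq_integral => y _; congr EFin.
  rewrite deriv_as.
  have e1 : expR (2^-1 * as_ y) = w y by rewrite mulrC expR_as.
  have e2 : expR (- 2^-1 * as_ y) = w y - y by rewrite mulNr expRN e1 wV.
  have e3 : expR (as_ y) = w y ^+ 2.
    by rewrite -expR_as -expRM_natl; congr expR; field.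
  have e4 : expR (- as_ y) = (w y - y) ^+ 2 by rewrite expRN e3 -exprVn wV.
  have s : Num.sqrt (y ^+ 2 + 4) = w y * 2 - y by rewrite /w; field.
  have s0 : w y * 2 - y != 0 by rewrite -s gt_eqF// sqrtr_gt0.
  rewrite !fctE/= /G /k e1 e2 e3 e4 s -expRD.
  have ww : w y * (w y - y) = 1 by rewrite -wV mulfV// gt_eqF.
  rewrite [X in _ / 2 * expR X * _](_ : _ = - r + - (r / 2 * y ^+ 2)).
    by field.
  by nra.
(* Both forms of I are added, so that only the even function G occurs. *)
have II : (I + I = 2%:E * (Num.sqrt (2 * pi / r) * expR (- r))%:E)%E.
  rewrite {1}I1 I2.
  have := @ge0_integralD _ _ _ mu setT measurableT _ _ (fun z _ => kp 2^-1 z)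
    (mI 2^-1) (fun z _ => kp (- 2^-1) z) (mI (- 2^-1)).
  move=> <-.
  have r20 : 0 < r / 2 by rewrite divr_gt0.
  rewrite [_ * expR (- r)]mulrC EFinM.
  rewrite (_ : 2 * pi / r = pi / (r / 2)); last by field; rewrite gt_eqF.
  rewrite -(integral_gauss1 r20) -(integralZl_EFin _ (integrable_gauss1 r20)).
  have mG : measurable_fun setT (fun z => (G z)%:E).
    by apply/measurable_EFinP; exact: continuous_measurable_fun cG.
  have := @ge0_integralZl _ _ _ mu _ measurableT _ mG 2%:E (fun z _ => G0 z).
  rewrite -key => <-//.
  by apply: eq_integral => z _; rewrite -EFinD -EFinM; congr EFin; rewrite /G; field.
have I2I : (I + I = 2%:E * I)%E by rewrite -[2%:E]/(2%:R%:E) mule_natl mule2n.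
move: II; rewrite I2I => /(congr1 (fun z => (2^-1)%:E * z)%E).
by rewrite !muleA -!EFinM mulVf// !mul1e mul1r.
Qed.

End subordination.

(** * The Fourier transform of a Gaussian on the line *)

Section gauss_fourier1.
Context {R : realType}.
Notation mu := (@lebesgue_measure R).
Variable a : R.
Hypothesis a0 : 0 < a.

Let g (x : R) := expR (- (a * x ^+ 2)).

Let g_gt0 x : 0 < g x. Proof. exact: expR_gt0. Qed.

Let age0 : 0 <= a. Proof. exact: ltW. Qed.
Let a2ge0 : 0 <= a / 2. Proof. by rewrite divr_ge0. Qed.
Let C := 1 + 2 / a.
Let C0 : 0 <= C. Proof. by rewrite addr_ge0// divr_ge0. Qed.

Let mg : measurable_fun setT g. Proof. exact: measurable_gauss1. Qed.

(** Half of the exponent pays for the factor |x|. *)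
Lemma normr_gauss1_le (x : R) :
  `|x| * expR (- (a * x ^+ 2)) <= (1 + 2 / a) * expR (- (a / 2 * x ^+ 2)).
Proof.
have -> : - (a * x ^+ 2) = - (a / 2 * x ^+ 2) - a / 2 * x ^+ 2 by field.
rewrite expRD mulrCA [leRHS]mulrC ler_pM2l ?expR_gt0//.
rewrite expRN ler_pdivrMr ?expR_gt0//.
have x2 : 0 <= x ^+ 2 by exact: sqr_ge0.
apply: (@le_trans _ _ ((1 + 2 / a) * (1 + a / 2 * x ^+ 2))); last first.
  by rewrite ler_wpM2l ?expR_ge1Dx.
rewrite [leRHS](_ : _ = 1 + x ^+ 2 + (2 / a + a / 2 * x ^+ 2)); last first.
  by field; rewrite gt_eqF.
have : 0 <= 2 / a + a / 2 * x ^+ 2.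
  by apply: addr_ge0; [exact: divr_ge0|exact: mulr_ge0].
have : `|x| <= 1 + x ^+ 2.
  by rewrite -(real_normK (num_real x)); have := normr_ge0 x; nra.
lra.
Qed.

Let is_derive_g (x : R) : is_derive x (1 : R) g (- (2 * a * x) * g x).
Proof.
have H2 : is_derive x (1:R) (fun z : R => - (a * z ^+ 2)) (- (2 * a * x)).
  rewrite (_ : (fun z : R => - (a * z ^+ 2)) = (fun z : R => - a *: z ^+ 2)); last first.
    by apply/funext => z; rewrite /GRing.scale/= mulNr.
  by apply: is_derive_eq; rewrite /GRing.scale/=; ring.
have H3 := @is_derive1_comp R expR (fun z : R => - (a * z ^+ 2)) x _ _ (is_derive_expR _) H2.
by apply: is_derive_eq; rewrite mulrC.
Qed.

Let is_derive_lin (k t x : R) : is_derive x (1 : R) (fun z => k * z + t) k.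
Proof.
apply: (is_derive_eq (is_deriveD (is_deriveZ k (is_derive_id x (1:R)))
   (is_derive_cst t x (1:R)))).
by rewrite addr0 /GRing.scale/= mulr1.
Qed.

Let is_derive_linl (k t x : R) : is_derive k (1 : R) (fun z => z * x + t) x.
Proof.
rewrite (_ : (fun z => _) = (fun z => x * z + t)); first exact: is_derive_lin.
by apply/funext => z; rewrite mulrC.
Qed.

Let F (k t x : R) := g x * sin (k * x + t).
Let dF (k t x : R) := - (2 * a * x) * g x * sin (k * x + t) + k * (g x * cos (k * x + t)).

Let is_derive_F (k t x : R) : is_derive x (1 : R) (F k t) (dF k t x).
Proof.
have H := @is_derive1_comp R (@sin R) (fun z : R => k * z + t) x _ _ (is_derive_sin _) (is_derive_lin k t x).
have H1 := is_deriveM (is_derive_g x) H.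
by apply: (is_derive_eq H1); rewrite /dF /GRing.scale/=; ring.
Qed.

Let mcos (k t : R) : measurable_fun setT (fun x : R => cos (k * x + t)).
Proof.
apply: continuous_measurable_fun => x; apply: continuous_comp; last exact: continuous_cos.
by apply: cvgD; [apply: cvgMr; exact: cvg_id|exact: cvg_cst].
Qed.

Let msin (k t : R) : measurable_fun setT (fun x : R => sin (k * x + t)).
Proof.
apply: continuous_measurable_fun => x; apply: continuous_comp; last exact: continuous_sin.
by apply: cvgD; [apply: cvgMr; exact: cvg_id|exact: cvg_cst].
Qed.

Let sin1 (x : R) : `|sin x| <= 1. Proof. by rewrite ler_norml sin_geN1 sin_le1. Qed.
Let cos1 (x : R) : `|cos x| <= 1. Proof. by rewrite ler_norml cos_geN1 cos_le1. Qed.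

Let int_cos (k t : R) : mu.-integrable setT (EFin \o (fun x : R => g x * cos (k * x + t))).
Proof.
apply: (@integrable_dom _ _ _ mu _ g).
- exact: (measurable_funM mg (mcos k t)).
- by move=> x; rewrite normrM (gtr0_norm (g_gt0 x)) ler_piMr// ltW.
- exact: integrable_gauss1.
Qed.

Let int_sin (k t : R) : mu.-integrable setT (EFin \o F k t).
Proof.
apply: (@integrable_dom _ _ _ mu _ g).
- exact: (measurable_funM mg (msin k t)).
- by move=> x; rewrite normrM (gtr0_norm (g_gt0 x)) ler_piMr// ltW.
- exact: integrable_gauss1.
Qed.

Let a20 : 0 < a / 2. Proof. by rewrite divr_gt0. Qed.

Let int_xsin (k t : R) : mu.-integrable setT (EFin \o (fun x : R => x * g x * sin (k * x + t))).
Proof.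
apply: (@integrable_dom _ _ _ mu _ (fun x => C * expR (- (a / 2 * x ^+ 2)))).
- by apply: measurable_funM (msin k t); exact: measurable_funM.
- move=> x; rewrite !normrM (gtr0_norm (g_gt0 x)).
  by rewrite (le_trans _ (normr_gauss1_le x))// ler_piMr// mulr_ge0// ltW.
- exact/integrable_scale/integrable_gauss1.
Qed.

(** The integral of F k t (x + h) over x does not depend on h; differentiating it
   under the integral sign at h = 0 shows that the derivative of F k t has
   integral 0, in place of an integration by parts. *)
Let intdF k t : (\int[mu]_x dF k t x = 0)%R.
Proof.
pose f (h x : R) := F k t (x + h).
have df h x : is_derive h (1 : R) (f ^~ x) (dF k t (x + h)).
  have H : is_derive h (1:R) (fun z : R => x + z) 1.
    by apply: (is_derive_eq (is_deriveD (is_derive_cst x h (1:R)) (is_derive_id h (1:R)))); rewrite add0r.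
  have := @is_derive1_comp R (F k t) (fun z : R => x + z) h _ _ (is_derive_F k t _) H.
  by rewrite mulr1.
have pf h x : partial1of2 f h x = dF k t (x + h).
  by rewrite partial1of2E; have := df h x => H; rewrite derive_val.
have D0 : 0 <= 2 * a * C + `|k|.
  by apply: addr_ge0 => //; rewrite mulr_ge0// mulr_ge0.
pose G (x : R) := (2 * a * C + `|k|) * expR (a / 2) * expR (- (a / 4 * x ^+ 2)).
have := @differentiation_under_integral R _ _ mu f setT measurableT 0 (-1) 1.
have I0 : `](-1), 1[%classic (0 : R) by rewrite /= in_itv/= ltrN10 ltr01.
move=> /(_ I0) H.
have {}H := H _ _ G.
rewrite (_ : (fun x' => _) = cst (\int[mu]_y F k t y)%R) in H; last first.
  apply/funext => h; rewrite /Rintegral.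
  rewrite (@integral_shift _ (fun x => (F k t x)%:E) h)//.
  by have /integrableP[] := int_sin k t.
rewrite derive1_cst in H.
rewrite H.
- by apply: eq_Rintegral => x _; rewrite pf addr0.
- move=> h _; exact: (integrable_shift h (int_sin k t)).
- by move=> h x _ _; apply: ex_derive; exact: df.
- by move=> x; rewrite !mulr_ge0 ?expR_ge0.
- by apply/integrable_scale/integrable_gauss1; rewrite divr_gt0.
- move=> h x /= /[!in_itv]/= /andP[h1 h2] _; rewrite pf.
  set y := x + h.
  have b1 : `|dF k t y| <= (2 * a * C + `|k|) * expR (- (a / 2 * y ^+ 2)).
    rewrite /dF (le_trans (ler_normD _ _))// [leRHS]mulrDl lerD//.
      rewrite mulNr mulNr normrN !normrM (gtr0_norm (g_gt0 y)) normr_nat (ger0_norm age0).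
      rewrite [leLHS](_ : _ = 2 * a * (`|y| * g y * `|sin (k * y + t)|)); last by ring.
      rewrite -[leRHS]mulrA ler_pM2l ?mulr_gt0//.
      apply: (le_trans _ (normr_gauss1_le y)).
      by rewrite ler_piMr// mulr_ge0// ltW.
    rewrite normrM ler_wpM2l// normrM (gtr0_norm (g_gt0 y)).
    apply: (@le_trans _ _ (g y)); first by rewrite ler_piMr// ltW.
    by rewrite ler_expR lerN2 ler_wpM2r ?sqr_ge0//; have := a0; lra.
  apply: (le_trans b1); rewrite /G -[leRHS]mulrA (ler_wpM2l D0)//.
  rewrite -expRD ler_expR.
  have : (x + 2 * h) ^+ 2 >= 0 by exact: sqr_ge0.
  have : h ^+ 2 <= 1 by rewrite -(@expr1n R 2) -(real_normK (num_real h)) lerXn2r ?nnegrE// ler_norml; lra.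
  rewrite /y => h3 h4.
  have : x ^+ 2 / 2 <= (x + h) ^+ 2 + 1 by nra.
  by have := a0; nra.
Qed.

Let U (t k : R) := (\int[mu]_x (g x * cos (k * x + t)))%R.

(** The differential equation U' = - k / (2 a) U; by intdF its right-hand side is
   the integral of the derivative of the integrand with respect to k. *)
Let is_derive_U t k : is_derive k (1:R) (U t) (- (k / (2 * a)) * U t k).
Proof.
pose f (h x : R) := g x * cos (h * x + t).
have df h x : is_derive h (1 : R) (f ^~ x) (- (x * g x * sin (h * x + t))).
  have H := @is_derive1_comp R (@cos R) (fun z : R => z * x + t) h _ _ (is_derive_cos _) (is_derive_linl h t x).
  apply: (is_derive_eq (is_deriveZ (g x) H)).
  by rewrite /GRing.scale/=; ring.
have pf h x : partial1of2 f h x = - (x * g x * sin (h * x + t)).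
  by rewrite partial1of2E; have := df h x => H; rewrite derive_val.
pose G (x : R) := C * expR (- (a / 2 * x ^+ 2)).
have Ik : `](k - 1), (k + 1)[%classic (k : R).
  by rewrite /= in_itv/= ltrBlDr !ltrDl ltr01.
have intf x : `](k - 1), (k + 1)[%classic x -> mu.-integrable setT (EFin \o f x).
  by move=> _; exact: int_cos.
have der x y : `](k - 1), (k + 1)[%classic x -> setT y -> derivable (f ^~ y) x 1.
  by move=> _ _; apply: ex_derive; exact: df.
have G0 x : 0 <= G x.
  by rewrite mulr_ge0 ?expR_ge0// addr_ge0// divr_ge0// ltW.
have iG : mu.-integrable setT (EFin \o G).
  exact/integrable_scale/integrable_gauss1.
have Gub x y : `](k - 1), (k + 1)[%classic x -> setT y -> `|partial1of2 f x y| <= G y.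
  move=> _ _; rewrite pf normrN !normrM (gtr0_norm (g_gt0 y)).
  by apply: (le_trans _ (normr_gauss1_le y)); rewrite ler_piMr// mulr_ge0// ltW.
have D1 := @derivable_under_integral R _ _ mu f setT measurableT k (k - 1) (k + 1) Ik intf der G G0 iG Gub.
have D2 := @differentiation_under_integral R _ _ mu f setT measurableT k (k - 1) (k + 1) Ik intf der G G0 iG Gub.
rewrite -/(U t) derive1E in D1 D2.
suff <- : 'D_1 (U t) k = - (k / (2 * a)) * U t k by exact/derivableP.
rewrite D2.
have := intdF k t; rewrite /dF.
under eq_Rintegral => x _.
  rewrite (_ : _ + _ = (- (2 * a)) * (x * g x * sin (k * x + t)) + k * (g x * cos (k * x + t))); last by ring.
  over.
rewrite RintegralD//; last 2 first.
- exact: integrable_scale.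
- exact: integrable_scale.
rewrite RintegralZl// RintegralZl// -/(U t k) => e.
under eq_Rintegral => x _.
  rewrite pf -mulN1r.
  over.
rewrite RintegralZl// mulN1r.
apply: (mulfI (x := 2 * a)); first by rewrite mulf_neq0// gt_eqF.
rewrite mulrN -mulNr.
move/eqP: e; rewrite addr_eq0 => /eqP ->; field.
by rewrite gt_eqF.
Qed.

Lemma integrable_gauss1_cos (t k : R) : mu.-integrable setT
  (EFin \o (fun x : R => expR (- (a * x ^+ 2)) * cos (k * x + t))).
Proof. exact: int_cos. Qed.

(** U solves U' = - k / (2 a) U, so U times exp(k^2 / (4 a)) is constant.  An
    arbitrary phase t is allowed because in several variables the remaining
    coordinates contribute one. *)
Lemma fourier_gauss1 (t k : R) :
  (\int[mu]_x (expR (- (a * x ^+ 2)) * cos (k * x + t))%:E =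
   (Num.sqrt (pi / a) * expR (- (k ^+ 2 / (4 * a))) * cos t)%:E)%E.
Proof.
rewrite (integralE_Rintegral (int_cos k t)) -/(U t k); congr EFin.
pose W (k : R) := U t k * expR (k ^+ 2 / (4 * a)).
have dW (z : R) : is_derive z (1:R) W 0.
  have H2 : is_derive z (1:R) (fun z : R => z ^+ 2 / (4 * a)) (z / (2 * a)).
    rewrite (_ : (fun z : R => z ^+ 2 / _) = (fun z : R => (4 * a)^-1 *: z ^+ 2)); last first.
      by apply/funext => y; rewrite /GRing.scale/= mulrC.
    by apply: is_derive_eq; rewrite /GRing.scale/=; field; rewrite gt_eqF.
  have H3 := @is_derive1_comp R expR (fun z : R => z ^+ 2 / (4 * a)) z _ _ (is_derive_expR _) H2.
  apply: (is_derive_eq (is_deriveM (is_derive_U t z) H3)).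
  by rewrite /GRing.scale/=; ring.
have : W k = W 0 by exact: is_derive_0_is_cst.
rewrite /W expr0n/= mul0r expR0 mulr1.
have -> : U t 0 = Num.sqrt (pi / a) * cos t.
  rewrite /U /Rintegral.
  under eq_integral do rewrite mul0r add0r mulrC.
  by rewrite (integralZl_EFin _ (integrable_gauss1 a0)) integral_gauss1//= mulrC.
move=> /(congr1 (fun z => z * expR (- (k ^+ 2 / (4 * a))))).
by rewrite -[LHS]mulrA -expRD subrr expR0 mulr1 => ->; rewrite mulrAC.
Qed.

End gauss_fourier1.

(** * Integrals on euclidean space *)

Section rV_measurability.
Context {R : realType}.

(** An open set is the countable union of the cubes with rational centre and
    radius 1 / (m + 1) that it contains. *)
Lemma open_measurable_rV n (A : set 'rV[R]_n) : open A -> measurable A.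
Proof.
move=> oA.
pose cube (p : 'rV[rat]_n * nat) : set 'rV[R]_n :=
  [set y | forall i, `|ratr (p.1 ord0 i) - y ord0 i| < p.2.+1%:R^-1].
have mcube p : measurable (cube p).
  rewrite (_ : cube p = \bigcap_(i in [set: 'I_n])
     ((fun x : 'rV[R]_n => x ord0 i) @^-1` ball (ratr (p.1 ord0 i) : R) p.2.+1%:R^-1)).
    apply: fin_bigcap_measurable => // i _.
    by rewrite -[X in measurable X]setTI; apply: measurable_coord => //; exact: measurable_ball.
  by apply/seteqP; split=> y /= H i; [move=> _|]; exact: H.
pose F p : set 'rV[R]_n := if `[< cube p `<=` A >] then cube p else set0.
have -> : A = \bigcup_p F p.
  apply/seteqP; split=> [x Ax|x [p _]]; last first.
    by rewrite /F; case: asboolP => // sA; exact: sA.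
  have /nbhs_ballP[e /= e0 eA] : nbhs x A by exact: open_nbhs_nbhs.
  have [m me] : exists m : nat, m.+1%:R^-1 < e / 2.
    have /ltr_add_invr [m] : 0 < e / 2 by rewrite divr_gt0.
    by rewrite add0r; exists m.
  have m0 : 0 < m.+1%:R^-1 :> R by rewrite invr_gt0.
  have /choice[q qP] : forall i, exists q : rat, `|ratr q - x ord0 i| < m.+1%:R^-1.
    move=> i; have /rat_in_itvoo[q] : x ord0 i - m.+1%:R^-1 < x ord0 i + m.+1%:R^-1.
      by rewrite ltrBlDr -addrA ltrDl addr_gt0.
    by rewrite in_itv/= => qx; exists q; rewrite ltr_distl.
  pose p := (\row_i q i, m).
  exists p => //; rewrite /F; case: asboolP => [_ i|/(_ _)[]] /=; first by rewrite mxE.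
  move=> y py; apply: eA; split => // i j; rewrite ord1.
  have := py j; rewrite mxE /= => h1; have h2 := qP j.
  rewrite /ball/= (_ : _ - _ = - (ratr (q j) - x ord0 j) + (ratr (q j) - y ord0 j)); last by ring.
  apply: (le_lt_trans (ler_normD _ _)); rewrite normrN.
  by apply: (lt_trans (ltrD h2 h1)); rewrite [ltRHS](splitr e) ltrD.
apply: countable_bigcupT_measurable => // p.
by rewrite /F; case: asboolP.
Qed.

Lemma continuous_measurable_rV n (f : 'rV[R]_n -> R) : continuous f ->
  measurable_fun setT f.
Proof.
move=> cf; apply: (measurability _ (RGenOpens.measurableE R)).
move=> _ [_ [a [b ->]] <-]; rewrite setTI.
by apply: open_measurable_rV; apply: open_comp => // x _; exact: cf.
Qed.

Lemma measurable_coord_comp d (T : measurableType d) n (f : T -> 'rV[R]_n) i :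
  measurable_fun setT f -> measurable_fun setT (fun x => f x ord0 i).
Proof. by move=> mf; exact: (measurableT_comp (@measurable_coord R n i) mf). Qed.

Lemma measurable_dotp d (T : measurableType d) n (f g : T -> 'rV[R]_n) :
  measurable_fun setT f -> measurable_fun setT g ->
  measurable_fun setT (fun x => dotp (f x) (g x)).
Proof.
move=> mf mg; apply: measurable_sum => i.
by apply: measurable_funM; exact: measurable_coord_comp.
Qed.

Lemma measurable_enorm d (T : measurableType d) n (f : T -> 'rV[R]_n) :
  measurable_fun setT f -> measurable_fun setT (fun x => enorm (f x)).
Proof.
move=> mf; apply: (measurableT_comp _ (measurable_dotp mf mf)).
exact: continuous_measurable_fun (@sqrt_continuous R).
Qed.

End rV_measurability.

Section rV_integral.
Context {R : realType}.
Notation mu := (@lebesgue_measure R).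

Lemma ge0_integral_rVS n (f : 'rV[R]_n.+1 -> \bar R) :
  measurable_fun setT f -> (forall x, 0 <= f x)%E ->
  (\int[lebesgue_rV n.+1]_x f x =
   \int[mu]_a \int[lebesgue_rV n]_v f (rV_cons (a, v)))%E.
Proof.
move=> mf f0.
have -> : (\int[lebesgue_rV n.+1]_x f x =
    \int[pushforward (mu \x lebesgue_rV n)%E (@rV_cons R n)]_x f x)%E by [].
rewrite (ge0_integral_pushforward (@measurable_rV_cons R n) _ measurableT mf (fun x _ => f0 x)).
rewrite preimage_setT fubini_tonelli1//; last by move=> x; exact: f0.
exact: (measurableT_comp mf (@measurable_rV_cons R n)).
Qed.

Lemma integral_rVS n (f : 'rV[R]_n.+1 -> \bar R) :
  (lebesgue_rV n.+1).-integrable setT f ->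
  (\int[lebesgue_rV n.+1]_x f x =
   \int[mu]_a \int[lebesgue_rV n]_v f (rV_cons (a, v)))%E.
Proof.
move=> /integrableP[mf foo].
have mc := @measurable_rV_cons R n.
have ifc : (mu \x lebesgue_rV n)%E.-integrable setT (f \o @rV_cons R n).
  apply/integrable12ltyP; first exact: measurableT_comp.
  by rewrite -(ge0_integral_rVS (f := fun x => `|f x|%E))//; exact: measurableT_comp.
have -> : (\int[lebesgue_rV n.+1]_x f x =
    \int[pushforward (mu \x lebesgue_rV n)%E (@rV_cons R n)]_x f x)%E by [].
by rewrite (integral_pushforward mc mf)// preimage_setT -integral12_prod_meas1.
Qed.

Lemma integral_rV0 (f : 'rV[R]_0 -> \bar R) :
  (\int[lebesgue_rV 0]_x f x = f 0%R)%E.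
Proof.
have mf : measurable_fun setT f.
  move=> _ A mA; rewrite setTI.
  have [f0|f0] := pselect (A (f 0)).
    rewrite (_ : _ @^-1` _ = setT)//.
    by apply/seteqP; split=> // x _; rewrite /= (_ : x = 0)//; apply/rowP; case.
  rewrite (_ : _ @^-1` _ = set0)//.
  by apply/seteqP; split=> // x /=; rewrite (_ : x = 0)//; apply/rowP; case.
by rewrite integral_dirac//= diracT mul1e.
Qed.

Lemma measurable_addr n (h : 'rV[R]_n) :
  measurable_fun setT (fun x : 'rV[R]_n => x + h).
Proof.
apply: measurable_fun_rV => i.
rewrite (_ : (fun t : 'rV[R]_n => _) = (fun t : 'rV[R]_n => t ord0 i + h ord0 i)); last first.
  by apply/funext => t; rewrite mxE.
by apply: measurable_funD => //; exact: measurable_coord.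
Qed.

(** Invariance under translations is inherited, coordinate by coordinate, from
    the line. *)
Lemma ge0_integral_rV_shift n (h : 'rV[R]_n) (f : 'rV[R]_n -> \bar R) :
  measurable_fun setT f -> (forall x, 0 <= f x)%E ->
  (\int[lebesgue_rV n]_x f (x + h)%R = \int[lebesgue_rV n]_x f x)%E.
Proof.
elim: n h f => [|n IH] h f mf f0.
  by rewrite !integral_rV0; congr f; apply/rowP; case.
have mc := @measurable_rV_cons R n.
have mfh : measurable_fun setT (fun x : 'rV[R]_n.+1 => f (x + h)).
  exact: (measurableT_comp mf (measurable_addr h)).
rewrite !ge0_integral_rVS//.
pose h' := (rV_uncons h).2.
have E a v : rV_cons (a, v) + h = rV_cons (a + h ord0 ord0, v + h').
  apply/rowP => i; rewrite mxE; have [->|i0] := eqVneq i ord0.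
    by rewrite !rV_cons0.
  have [j ->] : exists j, i = lift ord0 j.
    by case: (unliftP ord0 i) i0 => [j ->|->]; [exists j|rewrite eqxx].
  by rewrite !rV_consS /h' /= !mxE.
have mfc : measurable_fun setT (fun p => f (rV_cons p)).
  exact: (measurableT_comp mf mc).
transitivity (\int[mu]_a \int[lebesgue_rV n]_v f (rV_cons ((a + h ord0 ord0)%R, v)))%E.
  apply: eq_integral => a _; under eq_integral do rewrite E.
  rewrite (IH h' (fun v => f (rV_cons (a + h ord0 ord0, v))))//.
  exact: (measurableT_comp mfc (pair1_measurable _)).
rewrite (@integral_shift _ (fun a => \int[lebesgue_rV n]_v f (rV_cons (a, v)))%E)//.
exact: (@measurable_fun_fubini_tonelli_F _ _ _ _ _ (lebesgue_rV n) (fun p => f (rV_cons p))).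
Qed.

Lemma integral_rV_shift n (h : 'rV[R]_n) (f : 'rV[R]_n -> \bar R) :
  measurable_fun setT f ->
  (\int[lebesgue_rV n]_x f (x + h)%R = \int[lebesgue_rV n]_x f x)%E.
Proof.
move=> mf; rewrite integralE [RHS]integralE.
rewrite -(ge0_integral_rV_shift h (measurable_funepos mf))//.
rewrite -(ge0_integral_rV_shift h (measurable_funeneg mf))//.
by congr (_ - _)%E; apply: eq_integral => x _; rewrite ?funeposE ?funenegE.
Qed.

(** The weight that dominates Schwartz functions.  It is a product over the
    coordinates, rather than a power of 1 + |x|^2, so that its integrability
    reduces to the line. *)
Definition japan n (x : 'rV[R]_n) : R := \prod_(i < n) (1 + x ord0 i ^+ 2)^-1.

Lemma japan_gt0 n (x : 'rV[R]_n) : 0 < japan x.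
Proof. by apply: prodr_gt0 => i _; rewrite invr_gt0 ltr_pwDl// sqr_ge0. Qed.

Lemma measurable_prod_rV n (g : R -> R) : measurable_fun setT g ->
  measurable_fun setT (fun x : 'rV[R]_n => \prod_(i < n) g (x ord0 i)).
Proof.
move=> mg; apply: measurable_prod => i _.
by apply: measurableT_comp => //; exact: measurable_coord.
Qed.

Lemma prod_rV_cons n (g : R -> R) a (v : 'rV[R]_n) :
  \prod_(i < n.+1) g (rV_cons (a, v) ord0 i) = g a * \prod_(i < n) g (v ord0 i).
Proof.
by rewrite big_ord_recl rV_cons0; under eq_bigr do rewrite rV_consS.
Qed.

Lemma integrable_prod_rV n (g : R -> R) : (forall x, 0 <= g x) ->
  mu.-integrable setT (EFin \o g) ->
  (lebesgue_rV n).-integrable setT (EFin \o (fun x : 'rV[R]_n => \prod_(i < n) g (x ord0 i))).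
Proof.
move=> g0 ig.
have mg : measurable_fun setT g by have /integrableP[/measurable_EFinP] := ig.
apply: integrable_ltyP; first exact: measurable_prod_rV.
have p0 m (x : 'rV[R]_m) : 0 <= \prod_(i < m) g (x ord0 i) by exact: prodr_ge0.
under eq_integral do rewrite ger0_norm//.
elim: n => [|n IH]; first by rewrite integral_rV0 ltry.
rewrite ge0_integral_rVS; [|by apply/measurable_EFinP; exact: measurable_prod_rV|by move=> x; rewrite lee_fin].
under eq_integral => a _.
  under eq_integral do rewrite prod_rV_cons EFinM.
  rewrite ge0_integralZl; [|exact: measurableT|by apply/measurable_EFinP; exact: measurable_prod_rV|by move=> x _; rewrite lee_fin|by rewrite lee_fin].
  over.
rewrite ge0_integralZr; [|exact: measurableT|exact/measurable_EFinP
  |by move=> x _; rewrite lee_fin|by apply: integral_ge0 => x _; rewrite lee_fin].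
have ig0 : (0 <= \int[mu]_x (g x)%:E)%E.
  by apply: integral_ge0 => x _; rewrite lee_fin.
apply: lte_mul_pinfty => //; rewrite ge0_fin_numE//.
have := integrable_lty ig; under eq_integral do rewrite ger0_norm//.
by [].
Qed.

Lemma integrable_japan n : (lebesgue_rV n).-integrable setT (EFin \o @japan n).
Proof.
apply: integrable_prod_rV (integrable_onePsqrV) => x.
by rewrite invr_ge0 addr_ge0// sqr_ge0.
Qed.

Lemma dotp_cons n a b (v w : 'rV[R]_n) :
  dotp (rV_cons (a, v)) (rV_cons (b, w)) = a * b + dotp v w.
Proof.
by rewrite /dotp big_ord_recl !rV_cons0; under eq_bigr do rewrite !rV_consS.
Qed.

Lemma rV_unconsK n : cancel (@rV_uncons R n) (@rV_cons R n).
Proof.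
move=> x; apply/rowP => i; have [->|i0] := eqVneq i ord0; first by rewrite rV_cons0.
have [j ->] : exists j, i = lift ord0 j.
  by case: (unliftP ord0 i) i0 => [j ->|->]; [exists j|rewrite eqxx].
by rewrite rV_consS mxE.
Qed.

Lemma dotp_ge0 n (x : 'rV[R]_n) : 0 <= dotp x x.
Proof. by apply: sumr_ge0 => i _; rewrite -expr2 sqr_ge0. Qed.

Lemma expR_dotp n a (x : 'rV[R]_n) :
  expR (- (a * dotp x x)) = \prod_(i < n) expR (- (a * x ord0 i ^+ 2)).
Proof.
rewrite -expR_sum; congr expR; rewrite sumrN; congr (- _).
by rewrite /dotp mulr_sumr; apply: eq_bigr => i _; rewrite expr2.
Qed.

Lemma measurable_gauss n (a : R) :
  measurable_fun setT (fun x : 'rV[R]_n => expR (- (a * dotp x x))).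
Proof.
under eq_fun do rewrite expR_dotp.
exact: measurable_prod_rV (measurable_gauss1 a).
Qed.

Lemma integrable_gauss n (a : R) : 0 < a ->
  (lebesgue_rV n).-integrable setT (EFin \o (fun x : 'rV[R]_n => expR (- (a * dotp x x)))).
Proof.
move=> a0; under eq_fun do rewrite expR_dotp.
by apply: integrable_prod_rV (integrable_gauss1 a0) => x; exact: expR_ge0.
Qed.

Lemma normr_cos_le1 (x : R) : `|cos x| <= 1.
Proof. by rewrite ler_norml cos_geN1 cos_le1. Qed.

Lemma integrable_gauss_cos n (a : R) (k : 'rV[R]_n) t : 0 < a ->
  (lebesgue_rV n).-integrable setT
    (EFin \o (fun x : 'rV[R]_n => expR (- (a * dotp x x)) * cos (dotp x k + t))).
Proof.
move=> a0.
apply: (@integrable_dom _ _ _ _ _ (fun x : 'rV[R]_n => expR (- (a * dotp x x)))).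
- apply: measurable_funM; first exact: measurable_gauss.
  apply: measurableT_comp; first exact: continuous_measurable_fun (@continuous_cos R).
  apply: measurable_funD => //.
  by apply: (@measurable_dotp R _ _ n id (fun=> k)).
- by move=> x; rewrite normrM (ger0_norm (expR_ge0 _)) ler_piMr ?expR_ge0 ?normr_cos_le1.
- exact: integrable_gauss.
Qed.

(** Induction on the dimension: the phase of the first n variables is absorbed
    in the phase of the last one-dimensional integral. *)
Lemma fourier_gauss n (a : R) (k : 'rV[R]_n) (t : R) : 0 < a ->
  (\int[lebesgue_rV n]_x (expR (- (a * dotp x x)) * cos (dotp x k + t))%:E =
   (Num.sqrt (pi / a) ^+ n * expR (- (dotp k k / (4 * a))) * cos t)%:E)%E.
Proof.
move=> a0; elim: n k t => [|n IH] k t.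
  by rewrite integral_rV0 /dotp !big_ord0 mul0r mulr0 oppr0 expR0 add0r expr0 !mul1r.
rewrite integral_rVS; last exact: integrable_gauss_cos.
rewrite -(rV_unconsK k); case: (rV_uncons k) => b w.
under eq_integral => c _.
  under eq_integral => v _.
    rewrite !dotp_cons mulrDr opprD expRD -addrA [_ + (_ + t)]addrCA -mulrA.
    over.
  rewrite integralZl_EFin; last exact: integrable_gauss_cos.
  rewrite IH -EFinM.
  rewrite (_ : expR _ * _ = Num.sqrt (pi / a) ^+ n * expR (- (dotp w w / (4 * a))) *
     (expR (- (a * c ^+ 2)) * cos (b * c + t))); last first.
    by rewrite expr2 [b * c]mulrC; ring.
  over.
rewrite integralZl_EFin; last first.
  exact: integrable_gauss1_cos.
rewrite fourier_gauss1// -EFinM; congr EFin.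
by rewrite dotp_cons [(b * b + _) / _]mulrDl opprD expRD expr2 exprS; ring.
Qed.

End rV_integral.

(** * Powers as superpositions of exponentials *)

Section log_scale.
Context {R : realType}.
Notation mu := (@lebesgue_measure R).

(** With x = e^z this reads x^al exp(- be x) <= C min(x, 1 / x)^al: for x > 1 the
    exponential beats the power x^(2 al). *)
Lemma expR_exp_bound (al be : R) : 0 < al -> 0 < be ->
  exists C : R, 0 < C /\
    forall z, expR (al * z) * expR (- (be * expR z)) <= C * expR (- (al * `|z|)).
Proof.
move=> al0 be0.
pose N := (Num.bound (2 * al)).+1.
have HN : 2 * al <= N%:R.
  have := @archi_boundP R (2 * al) (mulr_ge0 (ler0n _ 2) (ltW al0)).
  by move=> /ltW /le_trans; apply; rewrite ler_nat /N.
have fp : 0 < N`!%:R / be ^+ N :> R by rewrite divr_gt0 ?exprn_gt0 ?ltr0n ?fact_gt0.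
exists (1 + N`!%:R / be ^+ N); split; first by rewrite ltr_wpDl.
move=> z; have [z0|z0] := leP z 0.
  rewrite (ler0_norm z0) mulrN opprK mulrC ler_wpM2r ?expR_ge0//.
  apply: (@le_trans _ _ 1); last by rewrite lerDl ltW.
  by rewrite -expR0 ler_expR oppr_le0 mulr_ge0 ?expR_ge0// ltW.
rewrite (gtr0_norm z0) -[X in X * _ <= _](_ : expR (2 * al * z) * expR (- (al * z)) = _).
  rewrite mulrAC ler_wpM2r ?expR_ge0//.
  rewrite expRN ler_pdivrMr ?expR_gt0//.
  apply: (@le_trans _ _ (expR (N%:R * z))); first by rewrite ler_expR ler_wpM2r// ltW.
  rewrite expRM_natl.
  have bz : 0 <= be * expR z by rewrite mulr_ge0 ?expR_ge0// ltW.
  have := expR_ge1Dxn N.-1 bz; rewrite /N prednK// -/N => H.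
  apply: (@le_trans _ _ (N`!%:R / be ^+ N * ((be * expR z) ^+ N / N`!%:R))).
    rewrite exprMn le_eqVlt; apply/orP; left; apply/eqP; field.
    by rewrite expf_neq0 ?gt_eqF//= gt_eqF// ltr0n fact_gt0.
  apply: ler_pM => //.
  - exact: ltW.
  - by rewrite divr_ge0// exprn_ge0.
  - by rewrite lerDr.
  - by apply: le_trans H; rewrite lerDr.
by rewrite -expRD; congr expR; ring.
Qed.

Lemma measurable_expR_lin (c : R) : measurable_fun setT (fun z : R => expR (c * z)).
Proof. by apply: measurableT_comp => //; exact: measurable_funM. Qed.

Lemma measurable_expR_exp (c : R) : measurable_fun setT (fun z : R => expR (- (c * expR z))).
Proof.
apply: measurableT_comp => //; apply: measurableT_comp => //.
by apply: measurable_funM => //; exact: measurable_expR.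
Qed.

Lemma integrable_expR_exp (al be : R) : 0 < al -> 0 < be ->
  mu.-integrable setT (EFin \o (fun z : R => expR (al * z) * expR (- (be * expR z)))).
Proof.
move=> al0 be0; have [C [C0 HC]] := expR_exp_bound al0 be0.
apply: (@integrable_dom _ _ _ mu _ (fun z => C * expR (- (al * `|z|)))).
- by apply: measurable_funM; [exact: measurable_expR_lin|exact: measurable_expR_exp].
- by move=> z; rewrite ger0_norm ?mulr_ge0 ?expR_ge0.
- exact/integrable_scale/integrable_expR_absr.
Qed.

(** Normalizing constants are integrals; this shows that they can be divided by. *)
Lemma Rintegral_gt0 (f : R -> R) (c : R) : 0 < c -> (forall x, 0 <= f x) ->
  mu.-integrable setT (EFin \o f) -> (forall x, 0 <= x <= 1 -> c <= f x) ->
  0 < (\int[mu]_x f x)%R.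
Proof.
move=> c0 f0 fi fc; rewrite -lte_fin -integralE_Rintegral//.
apply: (@lt_le_trans _ _ (\int[mu]_x (c * \1_(`[0, 1]%classic : set R) x)%:E)%E).
  rewrite integralZl_indic//; last by move=> c1; have := lt_trans c0 c1; rewrite ltxx.
  rewrite integral_indic//= setIT lebesgue_measure_itv/= lte_fin ltr01 oppr0 adde0 mule1.
  by rewrite lte_fin.
apply: ge0_le_integral => //.
- by move=> x _; rewrite lee_fin mulr_ge0 ?(ltW c0).
- by apply/measurable_EFinP; apply: measurable_funM => //; exact: measurable_indic.
- by have /integrableP[] := fi.
- move=> x _; rewrite lee_fin indicE.
  have [|_] := boolP (x \in _); last by rewrite mulr0.
  by rewrite inE/= in_itv/= mulr1; exact: fc.
Qed.

Section bernstein_power.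
Variable de : R.
Hypotheses (de0 : 0 < de) (de1 : de <= 2^-1).

(** From 1 - exp(- x) <= min(1, x).  The first bound is used for s >= 0; for
    s < 0 the second one leaves e^((1 - de) s), and 1 - de >= de. *)
Lemma one_sub_expR_le (s la : R) : 0 <= la ->
  0 <= expR (- (de * s)) * (1 - expR (- (expR s * la))) <=
  expR (- (de * `|s|)) * (1 + la).
Proof.
move=> la0.
have sl : 0 <= expR s * la by rewrite mulr_ge0 ?expR_ge0.
have u1 : 1 - expR (- (expR s * la)) <= 1 by rewrite lerBlDr lerDl expR_ge0.
have u2 : 1 - expR (- (expR s * la)) <= expR s * la.
  by have := expR_ge1Dx (- (expR s * la)); lra.
apply/andP; split.
  by rewrite mulr_ge0 ?expR_ge0// subr_ge0 -expR0 ler_expR oppr_le0.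
have [s0|s0] := leP 0 s.
  rewrite (ger0_norm s0) ler_wpM2l ?expR_ge0// (le_trans u1)//.
  by rewrite lerDl.
rewrite (ltr0_norm s0).
apply: (@le_trans _ _ (expR (- (de * s)) * (expR s * la))).
  by rewrite ler_wpM2l ?expR_ge0.
rewrite mulrA -expRD ler_pM ?expR_ge0//; last by rewrite lerDr.
rewrite ler_expR.
have : 0 <= - s * (2^-1 - de) by rewrite mulr_ge0// ?oppr_ge0 ?subr_ge0// ltW.
lra.
Qed.

Let meas (la : R) : measurable_fun setT
  (fun s : R => expR (- (de * s)) * (1 - expR (- (expR s * la)))).
Proof.
apply: measurable_funM.
  by under eq_fun do rewrite -mulNr; exact: measurable_expR_lin.
apply: measurable_funB => //.
by under eq_fun do rewrite mulrC; exact: measurable_expR_exp.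
Qed.

Lemma integrable_bernstein (la : R) : 0 <= la -> mu.-integrable setT
  (EFin \o (fun s : R => expR (- (de * s)) * (1 - expR (- (expR s * la))))).
Proof.
move=> la0.
apply: (@integrable_dom _ _ _ mu _ (fun s => (1 + la) * expR (- (de * `|s|)))).
- exact: meas.
- move=> s; have /andP[h1 h2] := one_sub_expR_le s la0.
  by rewrite ger0_norm// [leRHS]mulrC.
- exact/integrable_scale/integrable_expR_absr.
Qed.

(** The power x^(2 de) of the frequency is a superposition of the functions
    1 - exp(- e^s x^2): translating s by ln (x^2) pulls the power out and leaves
    a constant. *)
Lemma bernstein_power : exists A : R, 0 < A /\ forall x : R, 0 <= x ->
  (\int[mu]_s (expR (- (de * s)) * (1 - expR (- (expR s * x ^+ 2))))%:E =
   (A * x `^ (2 * de))%:E)%E.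
Proof.
pose A := (\int[mu]_s (expR (- (de * s)) * (1 - expR (- (expR s * 1)))))%R.
exists A; split.
  apply: (@Rintegral_gt0 _ (expR (- de) * (1 - expR (- 1)))).
  - by rewrite mulr_gt0 ?expR_gt0// subr_gt0 -expR0 ltr_expR.
  - by move=> s; have /andP[] := one_sub_expR_le s ler01.
  - exact: integrable_bernstein ler01.
  - move=> s /andP[s0 s1]; apply: ler_pM; rewrite ?expR_ge0//.
    + rewrite ler_expR lerN2 ler_piMr//; exact: ltW.
    + rewrite lerD2l lerN2 ler_expR lerN2 mulr1.
      by rewrite (le_trans _ (expR_ge1Dx _))// lerDl.
move=> x; rewrite le_eqVlt => /predU1P[<-|x0].
  under eq_integral do rewrite expr0n/= mulr0 oppr0 expR0 subrr mulr0.
  by rewrite integral0 powR0 ?mulr0// mulf_neq0// gt_eqF.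
pose l := ln (x ^+ 2).
have el : expR l = x ^+ 2 by rewrite lnK// posrE exprn_gt0.
rewrite -(@integral_shift _ _ (- l)); last exact/measurable_EFinP.
under eq_integral => s _.
  rewrite (_ : _ * _ = expR (de * l) * (expR (- (de * s)) * (1 - expR (- (expR s * 1))))); last first.
    rewrite mulrA -expRD; congr (expR _ * (1 - expR (- _))); first by ring.
    by rewrite expRD expRN el; field; rewrite gt_eqF.
  over.
rewrite integralZl_EFin; last exact: integrable_bernstein ler01.
rewrite integralE_Rintegral; last exact: integrable_bernstein ler01.
rewrite -/A -EFinM; congr EFin; rewrite mulrC; congr (_ * _).
rewrite /powR gt_eqF//; congr expR; rewrite /l lnXn// mulr_natl; ring.
Qed.

End bernstein_power.

End log_scale.

(** * The function e^-r / r^n as a mixture of heat kernels *)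

Section heat_profile.
Context {R : realType}.

(** The heat kernel in dimension n at time t, as a function of the squared
    distance D to the origin. *)
Definition heat_profile (n : nat) (t D : R) : R :=
  (Num.sqrt (4 * pi * t))^-1 ^+ n * expR (- ((4 * t)^-1 * D)).

Lemma measurable_inv_ge0 d (T : measurableType d) (f : T -> R) :
  measurable_fun setT f -> (forall x, 0 <= f x) ->
  measurable_fun setT (fun x => (f x)^-1).
Proof.
move=> mf f0; rewrite (_ : (fun x => _) = (fun x => f x `^ (-1))); last first.
  by apply/funext => x; rewrite powR_inv1.
exact: (measurableT_comp (@measurable_powR R (-1)) mf).
Qed.

Lemma heat_profile_ge0 n t D : 0 <= heat_profile n t D.
Proof. by rewrite mulr_ge0 ?expR_ge0// exprn_ge0// invr_ge0. Qed.

Lemma measurable_sqrtr : measurable_fun setT (@Num.sqrt R).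
Proof. exact: continuous_measurable_fun (@sqrt_continuous R). Qed.

Lemma measurable_heat_profile d (T : measurableType d) n (t D : T -> R) :
  measurable_fun setT t -> measurable_fun setT D -> (forall x, 0 <= t x) ->
  measurable_fun setT (fun x => heat_profile n (t x) (D x)).
Proof.
move=> mt mD t0; apply: measurable_funM.
  apply: measurable_funX; apply: measurable_inv_ge0 => //.
  by apply: (measurableT_comp measurable_sqrtr); exact: measurable_funM.
apply: measurableT_comp => //; apply: measurableT_comp => //.
apply: measurable_funM => //; apply: measurable_inv_ge0.
  exact: measurable_funM.
by move=> x; rewrite mulr_ge0.
Qed.

End heat_profile.

Section gaussian_mixture.
Context {R : realType}.
Notation mu := (@lebesgue_measure R).
Variable n : nat.
Hypothesis n0 : (0 < n)%N.

(** The density in (s, v) that represents e^-r / r^n.  First r^-n is, up to a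
    constant, the integral over v of e^(n v) exp(- r e^v), so that e^-r / r^n is
    an average of exp(- r (1 + e^v)); each of these exponentials is subordinated
    to Gaussians with [integral_expR_cosh].  The last factor removes the
    normalization of the heat kernel. *)
Definition mix2 (s v : R) : R :=
  expR (n%:R * v) * (1 + expR v) * expR (s / 2) *
  expR (- (expR s * (1 + expR v) ^+ 2)) * Num.sqrt (4 * pi * expR s) ^+ n.

Definition mix (s : R) : R := (\int[mu]_v mix2 s v)%R.

Lemma mix2_ge0 s v : 0 <= mix2 s v.
Proof.
by rewrite !mulr_ge0 ?expR_ge0 ?exprn_ge0 ?addr_ge0 ?expR_ge0.
Qed.

Lemma measurable_mix2 : measurable_fun setT (fun p : R * R => mix2 p.1 p.2).
Proof.
have me1 : measurable_fun setT (fun p : R * R => expR p.1).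
  by apply: measurableT_comp => //; exact: measurable_fst.
have me2 : measurable_fun setT (fun p : R * R => 1 + expR p.2).
  by apply: measurable_funD => //; apply: measurableT_comp => //; exact: measurable_snd.
apply: measurable_funM; last first.
  by apply: measurable_funX; apply: (measurableT_comp measurable_sqrtr); exact: measurable_funM.
apply: measurable_funM; last first.
  apply: measurableT_comp => //; apply: measurableT_comp => //.
  by apply: measurable_funM => //; exact: measurable_funX.
apply: measurable_funM; last first.
  by apply: measurableT_comp => //; apply: measurable_funM.
by apply: measurable_funM => //; apply: measurableT_comp => //; exact: measurable_funM.
Qed.

Lemma sqrt_expR (s : R) : Num.sqrt (expR s) = expR (s / 2).
Proof.
rewrite [in LHS](_ : expR s = expR (s / 2) ^+ 2).
  by rewrite sqrtr_sqr ger0_norm ?expR_ge0.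
by rewrite -expRM_natl; congr expR; field.
Qed.

Let g (z : R) := expR 1 * (expR (n%:R * z) * expR (- (2 * expR z)) +
  expR (n.+1%:R * z) * expR (- (2 * expR z))).

Let ig : mu.-integrable setT (EFin \o g).
Proof.
apply: integrable_scale; apply: integrable_add.
  by apply: integrable_expR_exp => //; rewrite ltr0n.
by apply: integrable_expR_exp => //; rewrite ltr0n.
Qed.

Let g0 z : 0 <= g z.
Proof. by rewrite mulr_ge0 ?addr_ge0 ?mulr_ge0 ?expR_ge0. Qed.

(** With z = v + s / 2 the exponent of mix2 is
   e^s (1 + e^v)^2 >= e^s + e^(2 z) >= e^s + 2 e^z - 1, so the variables separate. *)
Let mix2_le s v : mix2 s v <=
  Num.sqrt (4 * pi) ^+ n * expR (- (expR s / 2)) * g (v + s / 2).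
Proof.
set z := v + s / 2.
have e1 : expR s = expR (s / 2) ^+ 2 by rewrite -expRM_natl; congr expR; field.
have e2 : expR z = expR v * expR (s / 2) by rewrite -expRD.
rewrite /mix2 sqrtrM ?mulr_ge0 ?pi_ge0// sqrt_expR exprMn.
rewrite [leLHS](_ : _ = Num.sqrt (4 * pi) ^+ n *
   ((expR (n%:R * v) * expR (s / 2) ^+ n) * (expR (s / 2) + expR z) *
     expR (- (expR s * (1 + expR v) ^+ 2)))); last by rewrite e2; ring.
rewrite -[leRHS]mulrA ler_wpM2l ?exprn_ge0//.
have -> : expR (n%:R * v) * expR (s / 2) ^+ n = expR (n%:R * z).
  by rewrite -expRM_natl -expRD; congr expR; rewrite /z; ring.
have -> : expR (- (expR s / 2)) * g z = expR (n%:R * z) *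
    (expR (- (expR s / 2)) * (1 + expR z)) * (expR 1 * expR (- (2 * expR z))).
  rewrite /g (_ : expR (n.+1%:R * z) = expR (n%:R * z) * expR z); first by ring.
  by rewrite -expRD -natr1; congr expR; ring.
rewrite -!mulrA ler_wpM2l ?expR_ge0//.
have h1 : expR (- (expR s * (1 + expR v) ^+ 2)) <=
    expR (- expR s) * (expR 1 * expR (- (2 * expR z))).
  rewrite -!expRD ler_expR.
  rewrite (_ : expR s * (1 + expR v) ^+ 2 = expR s + 2 * expR s * expR v + expR z ^+ 2); last first.
    by rewrite e2 e1; ring.
  have : 0 <= 2 * expR s * expR v by rewrite !mulr_ge0 ?expR_ge0.
  by have := sqr_ge0 (expR z - 1); nra.
apply: (@le_trans _ _ ((expR (s / 2) + expR z) * (expR (- expR s) * (expR 1 * expR (- (2 * expR z)))))).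
  by rewrite ler_wpM2l// addr_ge0// expR_ge0.
rewrite !mulrA ler_wpM2r ?expR_ge0// ler_wpM2r ?expR_ge0//.
rewrite (_ : expR (- expR s) = expR (- (expR s / 2)) * expR (- (expR s / 2))); last first.
  by rewrite -expRD; congr expR; field.
rewrite mulrA [(_ + _) * expR (- (expR s / 2))]mulrC -mulrA ler_wpM2l ?expR_ge0//.
have h2 : expR (s / 2) * expR (- (expR s / 2)) <= 1.
  by rewrite -expRD expR_le1; have := expR_ge1Dx s; move: (expR s) => e; lra.
have h3 : expR z * expR (- (expR s / 2)) <= expR z.
  by rewrite ler_piMr ?expR_ge0// expR_le1 oppr_le0 divr_ge0 ?expR_ge0.
lra.
Qed.

Lemma integrable_mix2 s : mu.-integrable setT (EFin \o mix2 s).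
Proof.
apply: (@integrable_dom _ _ _ mu _ (fun v =>
  Num.sqrt (4 * pi) ^+ n * expR (- (expR s / 2)) * g (v + s / 2))).
- exact: (measurable_section1 measurable_mix2).
- by move=> v; rewrite ger0_norm ?mix2_ge0.
- exact/integrable_scale/(integrable_shift _ ig).
Qed.

Lemma mix_ge0 s : 0 <= mix s.
Proof. by apply: Rintegral_ge0 => v _; exact: mix2_ge0. Qed.

Lemma measurable_mix : measurable_fun setT mix.
Proof. exact: (measurable_Rintegral2 mu measurable_mix2). Qed.

(** The bound on mix2 is a function of s times a function of v + s / 2, whose
    integral over v does not depend on s. *)
Lemma mix_le : exists C : R, 0 < C /\ forall s, mix s <= C * expR (- (expR s / 2)).
Proof.
exists (1 + Num.sqrt (4 * pi) ^+ n * (\int[mu]_v g v)%R); split.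
  rewrite ltr_pwDl// mulr_ge0 ?exprn_ge0//.
  by apply: Rintegral_ge0 => v _.
move=> s; rewrite -lee_fin /mix -integralE_Rintegral; last exact: integrable_mix2.
apply: (@le_trans _ _ (\int[mu]_v (Num.sqrt (4 * pi) ^+ n * expR (- (expR s / 2)) * g (v + s / 2))%:E)%E).
  have isg := integrable_scale (Num.sqrt (4 * pi) ^+ n * expR (- (expR s / 2))) (integrable_shift (s / 2) ig).
  apply: ge0_le_integral => //.
  - by move=> v _; rewrite lee_fin mix2_ge0.
  - by have /integrableP[] := integrable_mix2 s.
  - by have /integrableP[] := isg.
  - by move=> v _; rewrite lee_fin mix2_le.
rewrite integralZl_EFin; last exact: (integrable_shift _ ig).
rewrite (@integral_shift _ (fun v => (g v)%:E)); last by have /integrableP[] := ig.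
rewrite (integralE_Rintegral ig) -EFinM lee_fin mulrAC ler_wpM2r ?expR_ge0//.
by rewrite lerDr.
Qed.

(** The translation of s by ln (r / (2 u)) balances the two terms of the exponent
   u^2 e^s + r^2 / (4 e^s), which becomes u r cosh z. *)
Let inner (r v : R) : 0 < r ->
  (\int[mu]_s (mix2 s v * heat_profile n (expR s) (r ^+ 2))%:E =
   (Num.sqrt pi * (expR (n%:R * v) * expR (- (r * (1 + expR v)))))%:E)%E.
Proof.
move=> r0; set u := 1 + expR v.
have u0 : 0 < u by rewrite ltr_pwDl// expR_ge0.
have s0 s : 0 < 4 * pi * expR s :> R by rewrite !mulr_gt0 ?pi_gt0 ?expR_gt0.
pose h (s : R) := expR (n%:R * v) * u * (expR (s / 2) *
  expR (- (expR s * u ^+ 2 + expR (- s) * (r ^+ 2 / 4)))).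
have -> : (fun s => (mix2 s v * heat_profile n (expR s) (r ^+ 2))%:E) = (fun s => (h s)%:E).
  apply/funext => s; congr EFin; rewrite /mix2 /heat_profile /h -/u.
  rewrite exprVn opprD expRD.
  rewrite (_ : expR (- s) * (r ^+ 2 / 4) = (4 * expR s)^-1 * r ^+ 2); last first.
    by rewrite expRN; field; rewrite gt_eqF// expR_gt0.
  have x0 : Num.sqrt (4 * pi * expR s) ^+ n != 0.
    by rewrite expf_neq0// gt_eqF// sqrtr_gt0.
  set X := _ ^+ n; rewrite -/X in x0; set E1 := expR (- _); set E2 := expR (- _).
  by field.
pose l := ln (r / (2 * u)).
have ru : 0 < r / (2 * u) by rewrite divr_gt0// mulr_gt0.
have el : expR l = r / (2 * u) by rewrite lnK// posrE.
have mh : measurable_fun setT (fun s => (h s)%:E).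
  apply/measurable_EFinP; apply: measurable_funM => //; apply: measurable_funM.
    by apply: measurableT_comp => //; exact: measurable_funM.
  apply: measurableT_comp => //; apply: measurableT_comp => //.
  apply: measurable_funD; apply: measurable_funM => //.
  by apply: measurableT_comp => //; exact: measurable_funN.
rewrite -(@integral_shift _ (fun s => (h s)%:E) l)//.
have ur : 0 < u * r by rewrite mulr_gt0.
under eq_integral => z _.
  rewrite (_ : h _ = (expR (n%:R * v) * u * expR (l / 2)) *
     (expR (z / 2) * expR (- (u * r * ((expR z + expR (- z)) / 2))))); last first.
    rewrite /h -!mulrA; congr (_ * (_ * _)); rewrite !mulrA -!expRD; congr expR.
    rewrite [- (z + l)]opprD !expRD !expRN el; field.
    by rewrite !gt_eqF ?expR_gt0.
  over.
have mk : measurable_fun setT (fun z : R => (expR (z / 2) * expR (- (u * r * ((expR z + expR (- z)) / 2))))%:E).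
  apply/measurable_EFinP; apply: measurable_funM.
    by apply: measurableT_comp => //; exact: measurable_funM.
  apply: measurableT_comp => //; apply: measurableT_comp => //.
  apply: measurable_funM => //; apply: measurable_funM => //; apply: measurable_funD => //.
  by apply: measurableT_comp => //; exact: measurable_funN.
under eq_integral do rewrite EFinM.
rewrite ge0_integralZl; [|exact: measurableT|exact: mk
  |by move=> z _; rewrite lee_fin mulr_ge0 ?expR_ge0
  |by rewrite lee_fin !mulr_ge0 ?expR_ge0// ltW].
rewrite integral_expR_cosh// -EFinM; congr EFin.
have -> : expR (l / 2) = Num.sqrt (r / (2 * u)) by rewrite -sqrt_expR el.
have e : Num.sqrt (r / (2 * u)) * Num.sqrt (2 * pi / (u * r)) = Num.sqrt pi / u.
  rewrite -sqrtrM ?(ltW ru)//.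
  rewrite (_ : r / (2 * u) * (2 * pi / (u * r)) = pi * (u^-1) ^+ 2); last first.
    have u00 : u != 0 by rewrite gt_eqF.
    have r00 : r != 0 by rewrite gt_eqF.
    by clearbody u; field; apply/andP.
  by rewrite sqrtrM ?pi_ge0// sqrtr_sqr ger0_norm// invr_ge0 ltW.
rewrite [LHS](_ : _ = expR (n%:R * v) * u * expR (- (u * r)) *
   (Num.sqrt (r / (2 * u)) * Num.sqrt (2 * pi / (u * r)))); last by ring.
by rewrite e [u * r]mulrC; field; rewrite gt_eqF.
Qed.

(** Against the heat kernel, the s-integral of the joint density leaves e^(n v) exp(- r (1 + e^v)); in the
    v-integral the translation by ln r produces r^-n. *)
Lemma mix_heat : exists c : R, 0 < c /\ forall r : R, 0 < r ->
  (\int[mu]_s (mix s * heat_profile n (expR s) (r ^+ 2))%:E =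
   (c * (expR (- r) / r ^+ n))%:E)%E.
Proof.
have n0' : 0 < n%:R :> R by rewrite ltr0n.
have iG := integrable_expR_exp n0' (@ltr01 R).
pose G := (\int[mu]_v (expR (n%:R * v) * expR (- (1 * expR v))))%R.
exists (Num.sqrt pi * G); split.
  rewrite mulr_gt0 ?sqrtr_gt0 ?pi_gt0//.
  apply: (@Rintegral_gt0 _ _ (expR (- expR 1))); rewrite ?expR_gt0//.
  move=> v /andP[v0 v1]; rewrite -expRD ler_expR mul1r.
  have : 0 <= n%:R * v by rewrite mulr_ge0.
  have : expR v <= expR 1 by rewrite ler_expR.
  lra.
move=> r r0.
have mF : measurable_fun setT (fun p : R * R => mix2 p.1 p.2 * heat_profile n (expR p.1) (r ^+ 2)).
  apply: measurable_funM; first exact: measurable_mix2.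
  apply: measurable_heat_profile => //.
  by apply: measurableT_comp => //; exact: measurable_fst.
have -> : (\int[mu]_s (mix s * heat_profile n (expR s) (r ^+ 2))%:E =
    \int[mu]_s \int[mu]_v (mix2 s v * heat_profile n (expR s) (r ^+ 2))%:E)%E.
  apply: eq_integral => s _; rewrite mulrC EFinM -integralE_Rintegral; last exact: integrable_mix2.
  rewrite -integralZl_EFin; last exact: integrable_mix2.
  by apply: eq_integral => v _; rewrite mulrC.
rewrite (@fubini_tonelli _ _ _ _ _ mu mu (fun p => (mix2 p.1 p.2 * heat_profile n (expR p.1) (r ^+ 2))%:E)); first last.
- by move=> p; rewrite lee_fin mulr_ge0 ?mix2_ge0 ?heat_profile_ge0.
- exact/measurable_EFinP.
under eq_integral do rewrite inner//.
pose k (v : R) := expR (n%:R * v) * expR (- (1 * expR v)).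
under eq_integral => v _.
  rewrite (_ : _ * _ = Num.sqrt pi * (expR (- r) / r ^+ n) * k (v + ln r)); last first.
    rewrite /k -mulrA; congr (_ * _).
    rewrite [n%:R * (v + ln r)]mulrDr !expRD [expR (n%:R * ln r)]expRM_natl lnK ?posrE//.
    rewrite mulrDr mulr1 opprD expRD mul1r [expR v * r]mulrC.
    by field; rewrite expf_neq0// gt_eqF.
  over.
rewrite integralZl_EFin; last exact: (integrable_shift _ iG).
rewrite (@integral_shift _ (fun v => (k v)%:E)); last by have /integrableP[] := iG.
rewrite (integralE_Rintegral iG) -/G -EFinM; congr EFin; ring.
Qed.

End gaussian_mixture.

(** * Second time-differences of the heat kernel *)

Section pointwise.
Context {R : realType}.
Variables (n : nat) (D : R).
Hypothesis D0 : 0 <= D.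

(** A majorant of the heat kernel at time e^s.  The constant 16, in place of 4,
    leaves room for the differences below: a kernel at time e^s + a <= 2 e^s has
    the constant 8, and the other half of the exponent absorbs a factor D / e^s. *)
Definition heat_major (s : R) : R :=
  expR (- (n%:R / 2 * s)) * expR (- (expR (- s) * (D / 16))).

Lemma heat_major_ge0 s : 0 <= heat_major s.
Proof. by rewrite mulr_ge0 ?expR_ge0. Qed.

Let pref_le s : (Num.sqrt (4 * pi * expR s))^-1 ^+ n <= expR (- (n%:R / 2 * s)) :> R.
Proof.
have -> : expR (- (n%:R / 2 * s)) = (expR (s / 2))^-1 ^+ n :> R.
  by rewrite -expRN -expRM_natl; congr expR; field.
rewrite lerXn2r ?nnegrE ?invr_ge0 ?expR_ge0//.
rewrite lef_pV2 ?posrE ?expR_gt0 ?sqrtr_gt0 ?mulr_gt0 ?pi_gt0 ?expR_gt0//.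
rewrite -sqrt_expR ler_sqrt ?mulr_ge0 ?pi_ge0 ?expR_ge0//.
rewrite ler_peMl ?expR_ge0//; have := @pi_ge2 R; lra.
Qed.

Lemma heat_profile_le s : heat_profile n (expR s) D <= heat_major s.
Proof.
apply: ler_pM => //; rewrite ?exprn_ge0 ?invr_ge0 ?expR_ge0//.
rewrite ler_expR lerN2 expRN mulrA [_ / 16]mulrC mulrA.
rewrite ler_wpM2r// invfM ler_wpM2r ?invr_ge0 ?expR_ge0//.
by rewrite lef_pV2 ?posrE//; lra.
Qed.

Lemma one_sub_exprn_le (x : R) : 0 <= x <= 1 -> 1 - x ^+ n <= n%:R * (1 - x).
Proof.
move=> /andP[x0 x1]; elim: n => [|m IH]; first by rewrite expr0 mul0r subrr.
rewrite exprS -natr1 mulrDl mul1r.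
rewrite (_ : 1 - x * x ^+ m = x * (1 - x ^+ m) + (1 - x)); last by ring.
rewrite lerD2r; apply: le_trans IH.
by rewrite ler_piMl// subr_ge0 exprn_ile1.
Qed.

(** A change of time from b to a + b <= 2 b changes the kernel by a relative
    amount a / b.  The normalization and the exponential are treated separately;
    rho is the ratio of the square roots of the two times. *)
Lemma heat_profile_diff_le (a s : R) : 0 < a -> a <= expR s ->
  `|heat_profile n (expR s) D - heat_profile n (a + expR s) D| <=
  (n%:R + 4) * (a / expR s) * heat_major s.
Proof.
move=> a0; set b := expR s => ab.
have b0 : 0 < b by exact: expR_gt0.
have ab0 : 0 < a + b by rewrite addr_gt0.
have pb0 : 0 < 4 * pi * b :> R by rewrite !mulr_gt0 ?pi_gt0.
pose rho := Num.sqrt (b / (a + b)).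
have rho01 : 0 <= rho <= 1.
  rewrite sqrtr_ge0/= -sqrtr1 ler_sqrt// ler_pdivrMr// mul1r lerDr; exact: ltW.
have rho2 : rho ^+ 2 = b / (a + b) by rewrite sqr_sqrtr// divr_ge0// ltW.
pose c := (Num.sqrt (4 * pi * b))^-1 ^+ n.
have c0 : 0 <= c by rewrite exprn_ge0 ?invr_ge0.
have cab : (Num.sqrt (4 * pi * (a + b)))^-1 ^+ n = c * rho ^+ n.
  rewrite /c -exprMn; congr (_ ^+ n).
  have pab0 : 0 < 4 * pi * (a + b) :> R by rewrite !mulr_gt0 ?pi_gt0.
  rewrite /rho -(sqrtrV (ltW pab0)) -(sqrtrV (ltW pb0)).
  rewrite -sqrtrM ?invr_ge0 ?(ltW pb0)//; congr Num.sqrt.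
  move: (@pi_gt0 R); generalize (pi : R) => p p0; field.
  by rewrite !gt_eqF.
set X := (4 * (a + b))^-1 * D; set Y := (4 * b)^-1 * D.
have q0 : 0 <= a / b by rewrite divr_ge0// ltW.
pose E := expR (- (expR (- s) * (D / 16))).
pose z := D / (16 * b).
have Ez : E = expR (- z) by rewrite /E [expR (- s)]expRN -/b /z; congr expR; field; rewrite gt_eqF.
have z0 : 0 <= z by rewrite divr_ge0// mulr_ge0// ltW.
have X2 : 2 * z <= X.
  rewrite (_ : 2 * z = (8 * b)^-1 * D); last by rewrite /z; field; rewrite gt_eqF.
  by rewrite ler_wpM2r// lef_pV2 ?posrE ?mulr_gt0//; lra.
have XY : X <= Y.
  by rewrite ler_wpM2r// lef_pV2 ?posrE ?mulr_gt0//; lra.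
have YX : Y - X <= (a / b) * (4 * z).
  rewrite (_ : Y - X = (a / (a + b)) * (4 * z)); last first.
    by rewrite /Y /X /z; field; rewrite !gt_eqF.
  apply: ler_wpM2r; first by rewrite mulr_ge0.
  apply: ler_wpM2l; first exact: ltW.
  by rewrite lef_pV2 ?posrE// lerDr ltW.
have eX : expR (- X) <= expR (- (2 * z)) by rewrite ler_expR lerN2.
have eX1 : expR (- X) <= E.
  by rewrite Ez (le_trans eX)// ler_expR; lra.
have eYX : expR (- X) - expR (- Y) <= (a / b) * (4 * E).
  have -> : expR (- X) - expR (- Y) = expR (- X) * (1 - expR (- (Y - X))).
    by rewrite mulrBr mulr1 -expRD; congr (_ - expR _); ring.
  apply: (@le_trans _ _ (expR (- (2 * z)) * ((a / b) * (4 * z)))).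
    apply: ler_pM; rewrite ?expR_ge0//.
      by rewrite subr_ge0 expR_le1 oppr_le0 subr_ge0.
    by apply: le_trans YX; have := expR_ge1Dx (- (Y - X)); lra.
  rewrite mulrCA ler_wpM2l// mulrCA ler_wpM2l// Ez.
  rewrite (_ : - (2 * z) = - z - z); last by ring.
  rewrite expRD -mulrA ler_piMr ?expR_ge0// expRN mulrC ler_pdivrMr ?expR_gt0// mul1r.
  by have := expR_ge1Dx z; lra.
have eYX0 : expR (- Y) <= expR (- X) by rewrite ler_expR lerN2.
have cc : c - c * rho ^+ n <= c * (n%:R * (a / b)).
  rewrite -{1}[c]mulr1 -mulrBr ler_wpM2l//.
  apply: (le_trans (one_sub_exprn_le rho01)); rewrite ler_wpM2l//.
  case/andP: rho01 => r0 r1.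
  apply: (@le_trans _ _ (1 - rho ^+ 2)).
    by rewrite lerD2l lerN2 expr2 ler_piMl.
  rewrite rho2 (_ : 1 - _ = a / (a + b)); last by field; rewrite gt_eqF.
  by rewrite ler_wpM2l ?(ltW a0)// lef_pV2 ?posrE// lerDr ltW.
have cc0 : c * rho ^+ n <= c.
  by rewrite ler_piMr// exprn_ile1//; case/andP: rho01.
rewrite /heat_profile -/c cab -/X -/Y.
have -> : c * expR (- Y) - c * rho ^+ n * expR (- X) =
   (c - c * rho ^+ n) * expR (- X) - c * (expR (- X) - expR (- Y)) by ring.
have cm : c <= expR (- (n%:R / 2 * s)) by exact: pref_le.
apply: (le_trans (ler_normB _ _)).
rewrite !ger0_norm ?mulr_ge0 ?subr_ge0 ?expR_ge0//.
apply: (@le_trans _ _ (c * ((n%:R + 4) * (a / b) * E))).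
  rewrite [leRHS](_ : _ = c * (n%:R * (a / b)) * E + c * (a / b * (4 * E))); last by ring.
  by apply: lerD; [apply: ler_pM; rewrite ?subr_ge0 ?expR_ge0|rewrite ler_wpM2l].
rewrite /heat_major -/E [leLHS]mulrCA.
apply: ler_wpM2l; first by rewrite mulr_ge0 ?addr_ge0.
by rewrite ler_wpM2r ?expR_ge0.
Qed.

Definition heat_diff2 s t := heat_profile n (expR s) D + heat_profile n (expR t) D
  - heat_profile n (expR s + expR t) D.

(** The kernel at the smaller time is kept, the other two are paired. *)
Lemma heat_profile_diff2_lt (s t : R) : s <= t ->
  `|heat_diff2 s t| <= heat_major s + (n%:R + 4) * expR (- (t - s)) * heat_major t.
Proof.
move=> st; rewrite /heat_diff2 -addrA (le_trans (ler_normD _ _))// lerD//.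
  by rewrite ger0_norm ?heat_profile_ge0 ?heat_profile_le.
apply: le_trans (heat_profile_diff_le (expR_gt0 s) _) _; first by rewrite ler_expR.
by rewrite opprB expRD expRN.
Qed.

Lemma heat_profile_diff2_gt (s t : R) : t <= s ->
  `|heat_diff2 s t| <= heat_major t + (n%:R + 4) * expR (- (s - t)) * heat_major s.
Proof.
move=> st.
have -> : heat_diff2 s t = heat_profile n (expR t) D +
    (heat_profile n (expR s) D - heat_profile n (expR t + expR s) D).
  by rewrite /heat_diff2 [expR s + _]addrC; ring.
rewrite (le_trans (ler_normD _ _))// lerD//.
  by rewrite ger0_norm ?heat_profile_ge0 ?heat_profile_le.
apply: le_trans (heat_profile_diff_le (expR_gt0 t) _) _; first by rewrite ler_expR.
by rewrite opprB expRD expRN.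
Qed.

End pointwise.

Section kernel.
Context {R : realType}.
Notation mu := (@lebesgue_measure R).
Variables (n : nat) (de : R).
Hypotheses (de0 : 0 < de) (de1 : de <= 2^-1).

Let ka := n%:R / 2 + de.
Let ka0 : 0 < ka. Proof. by rewrite ltr_wpDl// divr_ge0. Qed.

(** The last factor accounts for the times t in ]s, 0]: neither mix t nor the term
   at time e^s decays there. *)
Let major (r s : R) := expR (- (de * s)) * heat_major n (r ^+ 2) s * (1 + Num.max 0 (- s)).

(** This is where the logarithm of the statement comes from. *)
Let ln_ge (r : R) : 0 < r -> 1 + Num.max 0 (- (2 * ln r)) <= 3 * ln (expR 1 + r^-1).
Proof.
move=> r0.
have rV : 0 < r^-1 by rewrite invr_gt0.
have L1 : 1 <= ln (expR 1 + r^-1).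
  by rewrite -{1}(expRK (1 : R)) ler_ln ?posrE ?addr_gt0 ?expR_gt0// lerDl ltW.
have L2 : - ln r <= ln (expR 1 + r^-1).
  by rewrite -lnV ?posrE// ler_ln ?posrE ?addr_gt0 ?expR_gt0// lerDr expR_ge0.
have [h|h] := leP 0 (- (2 * ln r)); lra.
Qed.

Let major_measurable r : measurable_fun setT (major r).
Proof.
have mo : measurable_fun setT (fun s : R => - s) by exact: measurable_funN.
apply: measurable_funM; last first.
  apply: measurable_funD => //.
  exact: (@measurable_maxr _ _ R setT (fun=> 0)
    (fun s : measurableTypeR R => - s) (measurable_cst _) mo).
apply: measurable_funM.
  by under eq_fun do rewrite -mulNr; exact: measurable_expR_lin.
apply: measurable_funM.
  by under eq_fun do rewrite -mulNr; exact: measurable_expR_lin.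
apply: measurableT_comp => //; apply: measurableT_comp => //.
by apply: measurable_funM => //; exact: measurableT_comp.
Qed.

Let major_ge0 r s : 0 <= major r s.
Proof.
by rewrite /major !mulr_ge0 ?expR_ge0// addr_ge0// le_max lexx.
Qed.

(** After the translation by 2 ln r, that is at the natural time e^s of order r^2,
    the power of r factors out, and max(0, - (s + 2 ln r)) is at most the
    logarithm times 1 + |s|, which the exponential decay in |s| absorbs. *)
Lemma integral_major_le : exists C : R, 0 < C /\ forall r : R, 0 < r ->
  (\int[mu]_s (major r s)%:E <=
   (C * (ln (expR 1 + r^-1) / r `^ (n%:R + 2 * de)))%:E)%E.
Proof.
have b16 : 0 < 16^-1 :> R by rewrite invr_gt0.
have [C1 [C10 HC1]] := expR_exp_bound ka0 b16.
have ka20 : 0 < ka / 2 by rewrite divr_gt0.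
pose E := (\int[mu]_s expR (- (ka / 2 * `|s|)))%R.
pose C2 := 1 + 2 / ka.
have C20 : 0 < C2 by rewrite ltr_pwDl// divr_ge0// ltW.
exists (1 + 3 * (C1 * C2 * E)).
have E0 : 0 <= E by apply: Rintegral_ge0 => s _; exact: expR_ge0.
split; first by rewrite ltr_pwDl// !mulr_ge0// ltW.
move=> r r0.
have L0 := ln_ge r0; set L := ln (expR 1 + _) in L0 *.
set rk := r `^ _.
have rk0 : 0 < rk by rewrite powR_gt0.
have rkE : expR (- (ka * (2 * ln r))) = rk^-1.
  rewrite expRN /rk /powR gt_eqF//; congr (expR _)^-1; rewrite /ka.
  by field.
have e2 : expR (- (2 * ln r)) * r ^+ 2 = 1.
  by rewrite expRN expRM_natl lnK ?posrE// mulVf// expf_neq0// gt_eqF.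
have key s : major r (s + 2 * ln r) <= 3 * L / rk * (C1 * C2) * expR (- (ka / 2 * `|s|)).
  have -> : major r (s + 2 * ln r) = rk^-1 *
      (expR (ka * - s) * expR (- (16^-1 * expR (- s)))) * (1 + Num.max 0 (- (s + 2 * ln r))).
    rewrite /major /heat_major; congr (_ * _).
    rewrite mulrA -expRD (_ : - (de * _) + _ = - (ka * (2 * ln r)) + ka * - s); last first.
      by rewrite /ka; ring.
    rewrite expRD rkE -mulrA; congr (_ * (_ * expR (- _))).
    rewrite opprD expRD -[LHS](_ : expR (- s) * (expR (- (2 * ln r)) * r ^+ 2) / 16 = _).
      by rewrite e2; ring.
    by ring.
  have h1 : 1 + Num.max 0 (- (s + 2 * ln r)) <= (1 + `|s|) * (3 * L).
    apply: le_trans (ler_wpM2l _ L0); last by rewrite addr_ge0.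
    have := ler_norm (- s); rewrite normrN => hs.
    have := normr_ge0 s => hs0.
    by have [h|h] := leP 0 (- (s + 2 * ln r)); have [h'|h'] := leP 0 (- (2 * ln r)); nra.
  have h2 := HC1 (- s); rewrite normrN in h2.
  have h3 : (1 + `|s|) * expR (- (ka * `|s|)) <= C2 * expR (- (ka / 2 * `|s|)).
    rewrite (_ : - (ka * `|s|) = - (ka / 2 * `|s|) - ka / 2 * `|s|); last by field.
    rewrite expRD mulrCA mulrC ler_wpM2r ?expR_ge0//.
    rewrite expRN ler_pdivrMr ?expR_gt0//.
    apply: (@le_trans _ _ (C2 * (1 + ka / 2 * `|s|))).
      rewrite (_ : C2 * _ = 1 + `|s| + (2 / ka + ka / 2 * `|s|)); last first.
        by rewrite /C2; field; rewrite gt_eqF.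
      rewrite lerDl; apply: addr_ge0; first by rewrite divr_ge0// ltW.
      by rewrite mulr_ge0// ltW.
    by rewrite ler_wpM2l ?expR_ge1Dx// ltW.
  apply: (@le_trans _ _ (rk^-1 * (C1 * expR (- (ka * `|s|))) * ((1 + `|s|) * (3 * L)))).
    apply: ler_pM => //.
    - by rewrite !mulr_ge0 ?expR_ge0// invr_ge0 ltW.
    - by rewrite addr_ge0// le_max lexx.
    - by rewrite ler_wpM2l// invr_ge0 ltW.
  rewrite [leLHS](_ : _ = 3 * L / rk * C1 * ((1 + `|s|) * expR (- (ka * `|s|)))); last by ring.
  rewrite [leRHS](_ : _ = 3 * L / rk * C1 * (C2 * expR (- (ka / 2 * `|s|)))); last by ring.
  apply: ler_wpM2l => //; rewrite mulr_ge0// ?(ltW C10)// divr_ge0 ?(ltW rk0)//.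
  by apply: le_trans L0; rewrite addr_ge0// le_max lexx.
have mm : measurable_fun setT (fun s => (major r s)%:E) by exact/measurable_EFinP.
rewrite -(@integral_shift _ (fun s => (major r s)%:E) (2 * ln r))//.
have ie := integrable_expR_absr ka20.
apply: (@le_trans _ _ (\int[mu]_s (3 * L / rk * (C1 * C2) * expR (- (ka / 2 * `|s|)))%:E)%E).
  apply: ge0_le_integral => //.
  - by move=> s _; rewrite lee_fin.
  - have ms : measurable_fun [set: measurableTypeR R]
      ((fun x : R => x + 2 * ln r) : measurableTypeR R -> measurableTypeR R).
      exact: measurable_funD.
    exact: (measurableT_comp mm ms).
  - by have /integrableP[] := integrable_scale (3 * L / rk * (C1 * C2)) ie.
  - by move=> s _; rewrite lee_fin.
rewrite integralZl_EFin// (integralE_Rintegral ie) -EFinM lee_fin -/E.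
rewrite [leLHS](_ : _ = 3 * (C1 * C2 * E) * (L / rk)); last by ring.
rewrite ler_wpM2r ?lerDr// divr_ge0 ?(ltW rk0)//.
have : 0 <= 3 * L; last by rewrite pmulr_rge0.
by apply: le_trans L0; rewrite addr_ge0// le_max lexx.
Qed.

Hypothesis n0 : (0 < n)%N.

Let a (r s : R) := expR (- (de * s)) * heat_major n (r ^+ 2) s.

Let a_ge0 r s : 0 <= a r s.
Proof. by rewrite mulr_ge0 ?expR_ge0 ?heat_major_ge0. Qed.

Let a_le r s : a r s <= major r s.
Proof. by rewrite ler_peMr// lerDl le_max lexx. Qed.

Let ma r : measurable_fun setT (a r).
Proof.
apply: measurable_funM.
  by under eq_fun do rewrite -mulNr; exact: measurable_expR_lin.
apply: measurable_funM.
  by under eq_fun do rewrite -mulNr; exact: measurable_expR_lin.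
apply: measurableT_comp => //; apply: measurableT_comp => //.
by apply: measurable_funM => //; exact: measurableT_comp.
Qed.

Let ind (t s : R) : R := if (s < t) && (t <= 0) then 1 else 0.

Let ind_ge0 t s : 0 <= ind t s.
Proof. by rewrite /ind; case: ifP. Qed.

Let integral_ind s : (\int[mu]_t (ind t s)%:E = (Num.max 0 (- s))%:E)%E.
Proof.
have -> : (fun t => (ind t s)%:E) = (fun t => (\1_(`]s, 0]%classic : set R) t)%:E).
  apply/funext => t; rewrite /ind indicE; congr EFin.
  have -> : (t \in (`]s, 0]%classic : set R)) = (s < t) && (t <= 0).
    by apply/idP/idP; rewrite inE/= in_itv.
  by case: ifP.
rewrite integral_indic//= setIT lebesgue_measure_itv/= lte_fin.
have [s0|s0] := ltP s 0; last by rewrite max_l// oppr_le0.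
by rewrite -EFinB sub0r max_r// oppr_ge0 ltW.
Qed.

Let b (t : R) := expR (- (de * `|t|)).

(** The integrand is dominated by three terms.  T1 is the kernel at time e^s for
    s < t, weighted by mix t; mix is bounded by the indicator of t <= 0 plus an
    integrable function, so the integral over t costs 1 + max(0, - s).  T2 and T3
    carry an exponential decay in |t - s|, and integrating the variable that
    occurs only there costs a constant.  What is left is the integral of major. *)
Lemma kernel_le : exists C : R, 0 < C /\ forall r : R, 0 < r ->
  (\int[mu]_t \int[mu]_s
     (mix n t * (expR (- (de * s)) * `|heat_diff2 n (r ^+ 2) s t|))%:E <=
   (C * (ln (expR 1 + r^-1) / r `^ (n%:R + 2 * de)))%:E)%E.
Proof.
have [C0 [C00 HC0]] := integral_major_le.
have [Cm [Cm0 HCm]] := @mix_le R n n0.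
have ib := integrable_expR_absr de0.
have i1 := integrable_expR_absr (@ltr01 R).
pose E1 := (\int[mu]_s expR (- (1 * `|s|)))%R.
pose Ed := (\int[mu]_s b s)%R.
have E10 : 0 <= E1 by apply: Rintegral_ge0 => s _; exact: expR_ge0.
have Ed0 : 0 <= Ed by apply: Rintegral_ge0 => s _; exact: expR_ge0.
pose N : R := n%:R + 4.
have N0 : 0 <= N by rewrite addr_ge0.
have N1 : 1 <= N by rewrite -[1]add0r lerD// ?ler1n.
exists (Cm * (1 + 2 * E1 + 2 * N * Ed) * C0).
have cst0 : 0 < 1 + 2 * E1 + 2 * N * Ed.
  rewrite -addrA ltr_pwDl// addr_ge0//; first by rewrite mulr_ge0.
  by rewrite !mulr_ge0.
split; first by rewrite !mulr_gt0.
move=> r r0.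
have D0 : 0 <= r ^+ 2 by rewrite sqr_ge0.
pose T1 (p : R * R) := a r p.2 * (ind p.1 p.2 + 2 * expR (- (1 * `|p.1|))).
pose T2 (p : R * R) := N * (a r p.1 * b (p.2 - p.1)).
pose T3 (p : R * R) := N * (a r p.2 * b (p.1 - p.2)).
pose F (p : R * R) := mix n p.1 * (expR (- (de * p.2)) * `|heat_diff2 n (r ^+ 2) p.2 p.1|).
have mfst := @measurable_fst _ _ R R; have msnd := @measurable_snd _ _ R R.
have mabs c : measurable_fun setT (fun t : R => expR (- (c * `|t|))).
  apply: measurableT_comp => //; apply: measurableT_comp => //.
  by apply: measurable_funM => //; exact: measurableT_comp.
have mT1 : measurable_fun setT T1.
  apply: measurable_funM; first exact: (measurableT_comp (ma r) msnd).
  apply: measurable_funD.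
    apply: measurable_fun_ifT => //; apply: measurable_and.
      exact: measurable_fun_ltr.
    exact: measurable_fun_ler.
  by apply: measurable_funM => //; exact: (measurableT_comp (mabs 1) mfst).
have mT2 : measurable_fun setT T2.
  apply: measurable_funM => //; apply: measurable_funM; first exact: (measurableT_comp (ma r) mfst).
  by apply: (measurableT_comp (mabs de)); exact: measurable_funB.
have mT3 : measurable_fun setT T3.
  apply: measurable_funM => //; apply: measurable_funM; first exact: (measurableT_comp (ma r) msnd).
  by apply: (measurableT_comp (mabs de)); exact: measurable_funB.
have mF : measurable_fun setT F.
  apply: measurable_funM; first exact: (measurableT_comp (@measurable_mix R n) mfst).
  apply: measurable_funM.
    by apply: measurableT_comp => //; apply: measurableT_comp => //; exact: measurable_funM.
  apply: measurableT_comp => //; apply: measurable_funB; first apply: measurable_funD.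
  - by apply: measurable_heat_profile => //; apply: measurableT_comp.
  - by apply: measurable_heat_profile => //; apply: measurableT_comp.
  - apply: measurable_heat_profile => //.
      by apply: measurable_funD; apply: measurableT_comp.
have T10 p : 0 <= T1 p.
  by rewrite mulr_ge0// addr_ge0// mulr_ge0// expR_ge0.
have T20 p : 0 <= T2 p by rewrite !mulr_ge0// expR_ge0.
have T30 p : 0 <= T3 p by rewrite !mulr_ge0// expR_ge0.
have F0 p : 0 <= F p by rewrite !mulr_ge0 ?mix_ge0 ?expR_ge0.
have key p : F p <= Cm * (T1 p + T2 p + T3 p).
  case: p => t s; rewrite /F /T1 /T2 /T3 /=.
  have m1 : mix n t <= Cm.
    apply: (le_trans (HCm t)); by rewrite ler_piMr ?(ltW Cm0)//.
  have mx0 : 0 <= mix n t by exact: mix_ge0.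
  have q0 u : 0 <= heat_major n (r ^+ 2) u by exact: heat_major_ge0.
  have es : 0 <= expR (- (de * s)) by exact: expR_ge0.
  have [st|ts] := ltP s t.
    have h := heat_profile_diff2_lt n D0 (ltW st).
    have m2 : mix n t <= Cm * (ind t s + 2 * expR (- (1 * `|t|))).
      apply: (le_trans (HCm t)); rewrite ler_wpM2l ?(ltW Cm0)// /ind st/=.
      have [t0|t0] := leP t 0.
        apply: (@le_trans _ _ 1); first by rewrite expR_le1 oppr_le0 divr_ge0 ?expR_ge0.
        by rewrite lerDl mulr_ge0 ?expR_ge0.
      rewrite add0r (gtr0_norm t0) mul1r !expRN ler_pdivlMr ?expR_gt0//.
      rewrite mulrC ler_pdivrMr ?expR_gt0//.
      by have := expR_ge1Dx (expR t / 2); lra.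
    have e3 : expR (- (de * s)) * expR (- (t - s)) <= expR (- (de * t)) * b (s - t).
      rewrite /b distrC gtr0_norm ?subr_gt0// -!expRD ler_expR.
      have : 0 <= (t - s) * (2^-1 - de) by rewrite mulr_ge0 ?subr_ge0// ltW.
      lra.
    apply: (@le_trans _ _ (mix n t * (expR (- (de * s)) * (heat_major n (r ^+ 2) s +
        N * expR (- (t - s)) * heat_major n (r ^+ 2) t)))).
      by rewrite !ler_wpM2l.
    rewrite [leLHS](_ : _ = mix n t * a r s + mix n t *
       (N * heat_major n (r ^+ 2) t * (expR (- (de * s)) * expR (- (t - s))))); last first.
      by rewrite /a; ring.
    rewrite [leRHS](_ : _ = Cm * (ind t s + 2 * expR (- (1 * `|t|))) * a r s +
      Cm * (N * heat_major n (r ^+ 2) t * (expR (- (de * t)) * b (s - t))) +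
      Cm * (N * (a r s * b (t - s)))); last by rewrite /a; ring.
    apply: ler_wpDr; first by rewrite !mulr_ge0 ?(ltW Cm0) ?expR_ge0.
    apply: lerD; first by rewrite ler_wpM2r.
    apply: ler_pM => //; first by rewrite !mulr_ge0 ?expR_ge0.
    by rewrite ler_wpM2l// mulr_ge0.
  have h := heat_profile_diff2_gt n D0 ts.
  have e1 : expR (- (de * s)) <= expR (- (de * t)) * b (s - t).
    rewrite /b ger0_norm ?subr_ge0// -!expRD ler_expR; lra.
  have e2 : expR (- (s - t)) <= b (t - s).
    rewrite /b distrC ger0_norm ?subr_ge0// ler_expR.
    have : 0 <= (s - t) * (2^-1 - de) by rewrite mulr_ge0 ?subr_ge0.
    have : 0 <= s - t by rewrite subr_ge0.
    lra.
  apply: (@le_trans _ _ (mix n t * (expR (- (de * s)) * (heat_major n (r ^+ 2) t +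
      N * expR (- (s - t)) * heat_major n (r ^+ 2) s)))).
    by rewrite !ler_wpM2l.
  rewrite [leLHS](_ : _ = mix n t * (1 * heat_major n (r ^+ 2) t * expR (- (de * s)) +
     N * a r s * expR (- (s - t)))); last first.
    by rewrite /a; ring.
  rewrite [leRHS](_ : _ = Cm * (N * heat_major n (r ^+ 2) t * (expR (- (de * t)) * b (s - t))
      + N * a r s * b (t - s) +
      a r s * (ind t s + 2 * expR (- (1 * `|t|))))); last by rewrite /a; ring.
  apply: ler_pM => //.
    by rewrite addr_ge0// !mulr_ge0 ?expR_ge0.
  apply: ler_wpDr; first by rewrite mulr_ge0// addr_ge0// mulr_ge0// expR_ge0.
  apply: lerD; last by rewrite ler_wpM2l// mulr_ge0.
  apply: ler_pM => //; first by rewrite mul1r.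
  by rewrite ler_wpM2r.
have muE (G : R * R -> R) : measurable_fun setT G -> (forall p, 0 <= G p) ->
    (\int[(mu \x mu)%E]_p (G p)%:E = \int[mu]_t \int[mu]_s (G (t, s))%:E)%E.
  by move=> mG G0; rewrite fubini_tonelli1//; exact/measurable_EFinP.
have muE2 (G : R * R -> R) : measurable_fun setT G -> (forall p, 0 <= G p) ->
    (\int[(mu \x mu)%E]_p (G p)%:E = \int[mu]_s \int[mu]_t (G (t, s))%:E)%E.
  by move=> mG G0; rewrite fubini_tonelli2//; exact/measurable_EFinP.
rewrite -(muE _ mF F0).
apply: (@le_trans _ _ (\int[(mu \x mu)%E]_p (Cm * (T1 p + T2 p + T3 p))%:E)%E).
  apply: ge0_le_integral => //.
  - by move=> p _; rewrite lee_fin.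
  - exact/measurable_EFinP.
  - apply/measurable_EFinP; apply: measurable_funM => //.
    by apply: measurable_funD => //; exact: measurable_funD.
  - by move=> p _; rewrite lee_fin.
pose M := (\int[mu]_s (major r s)%:E)%E.
have M0 : (0 <= M)%E by apply: integral_ge0 => s _; rewrite lee_fin.
have Ma : (\int[mu]_s (a r s)%:E <= M)%E.
  apply: ge0_le_integral => //.
  - by move=> s _; rewrite lee_fin.
  - by apply/measurable_EFinP; exact: ma.
  - by apply/measurable_EFinP; exact: major_measurable.
  - by move=> s _; rewrite lee_fin.
have int_b u : (\int[mu]_s (b (s - u)%R)%:E = Ed%:E)%E.
  rewrite (@integral_shift _ (fun s => (b s)%:E) (- u)).
    exact: (integralE_Rintegral ib).
  by apply/measurable_EFinP; exact: mabs.
have mb u : measurable_fun setT (fun s : R => b (s - u)).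
  by apply: (measurableT_comp (mabs de)); exact: measurable_funB.
have HT3 : (\int[(mu \x mu)%E]_p (T3 p)%:E <= (N * Ed)%:E * M)%E.
  rewrite (muE2 _ mT3 T30).
  under eq_integral => s _.
    under eq_integral => t _ do rewrite /T3 /= mulrA EFinM.
    rewrite ge0_integralZl; [|exact: measurableT|by apply/measurable_EFinP; exact: mb
      |by move=> t _; rewrite lee_fin expR_ge0|by rewrite lee_fin mulr_ge0].
    rewrite int_b -EFinM (_ : N * a r s * Ed = (N * Ed) * a r s); last by ring.
    rewrite EFinM.
    over.
  rewrite ge0_integralZl; [|exact: measurableT|by apply/measurable_EFinP; exact: ma
      |by move=> t _; rewrite lee_fin|by rewrite lee_fin mulr_ge0].
  by rewrite lee_wpmul2l// lee_fin mulr_ge0.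
have HT2 : (\int[(mu \x mu)%E]_p (T2 p)%:E <= (N * Ed)%:E * M)%E.
  rewrite (muE _ mT2 T20).
  under eq_integral => s _.
    under eq_integral => t _ do rewrite /T2 /= mulrA EFinM.
    rewrite ge0_integralZl; [|exact: measurableT|by apply/measurable_EFinP; exact: mb
      |by move=> t _; rewrite lee_fin expR_ge0|by rewrite lee_fin mulr_ge0].
    rewrite int_b -EFinM (_ : N * a r s * Ed = (N * Ed) * a r s); last by ring.
    rewrite EFinM.
    over.
  rewrite ge0_integralZl; [|exact: measurableT|by apply/measurable_EFinP; exact: ma
      |by move=> t _; rewrite lee_fin|by rewrite lee_fin mulr_ge0].
  by rewrite lee_wpmul2l// lee_fin mulr_ge0.
have HT1 : (\int[(mu \x mu)%E]_p (T1 p)%:E <= (1 + 2 * E1)%:E * M)%E.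
  have mi s : measurable_fun setT (fun t : R => ind t s).
    apply: measurable_fun_ifT => //; apply: measurable_and.
      exact: measurable_fun_ltr.
    exact: measurable_fun_ler.
  rewrite (muE2 _ mT1 T10) -ge0_integralZl; [|exact: measurableT|by apply/measurable_EFinP; exact: major_measurable
      |by move=> t _; rewrite lee_fin|by rewrite lee_fin addr_ge0// mulr_ge0].
  apply: ge0_le_integral => //.
  - by move=> s _; apply: integral_ge0 => t _; rewrite lee_fin.
  - apply: (@measurable_fun_fubini_tonelli_G _ _ _ _ _ mu (EFin \o T1)).
      exact/measurable_EFinP.
    by move=> p; rewrite lee_fin.
  - apply/measurable_EFinP; apply: measurable_funM => //; exact: major_measurable.
  move=> s _.
  under eq_integral => t _ do rewrite /T1 /= EFinM.
  rewrite ge0_integralZl; [|exact: measurableT| |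
    by move=> t _; rewrite lee_fin addr_ge0// mulr_ge0// expR_ge0|by rewrite lee_fin]; last first.
    apply/measurable_EFinP; apply: measurable_funD; first exact: mi.
    by apply: measurable_funM => //; exact: mabs.
  under eq_integral => t _ do rewrite EFinD.
  rewrite ge0_integralD; [|exact: measurableT|by move=> t _; rewrite lee_fin
    |by apply/measurable_EFinP; exact: mi|by move=> t _; rewrite lee_fin mulr_ge0// expR_ge0|]; last first.
    by apply/measurable_EFinP; apply: measurable_funM => //; exact: mabs.
  have I2 : (\int[mu]_t (2 * expR (- (1 * `|t|)))%:E = (2 * E1)%:E)%E.
    by rewrite (integralZl_EFin _ i1) (integralE_Rintegral i1) -EFinM.
  rewrite integral_ind I2 -EFinD -!EFinM.
  rewrite lee_fin /major -/(a r s) mulrCA ler_wpM2l//.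
  have : 0 <= Num.max 0 (- s) by rewrite le_max lexx.
  by nra.
have mD : measurable_fun setT (fun p => T1 p + T2 p) by exact: measurable_funD.
have D1 : (\int[(mu \x mu)%E]_p (Cm * (T1 p + T2 p + T3 p))%:E =
   Cm%:E * (\int[(mu \x mu)%E]_p (T1 p)%:E + \int[(mu \x mu)%E]_p (T2 p)%:E
     + \int[(mu \x mu)%E]_p (T3 p)%:E))%E.
  under eq_integral do rewrite EFinM.
  rewrite ge0_integralZl; [|exact: measurableT| |
    by move=> t _; rewrite lee_fin !addr_ge0|by rewrite lee_fin ltW]; last first.
    by apply/measurable_EFinP; exact: measurable_funD.
  congr (_ * _)%E.
  under eq_integral do rewrite EFinD.
  rewrite ge0_integralD; [|exact: measurableT|by move=> t _; rewrite lee_fin addr_ge0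
    |exact/measurable_EFinP|by move=> t _; rewrite lee_fin|exact/measurable_EFinP].
  congr (_ + _)%E.
  under eq_integral do rewrite EFinD.
  by rewrite ge0_integralD; [|exact: measurableT|by move=> t _; rewrite lee_fin
    |exact/measurable_EFinP|by move=> t _; rewrite lee_fin|exact/measurable_EFinP].
rewrite D1.
apply: (@le_trans _ _ (Cm%:E * (((1 + 2 * E1)%:E * M + (N * Ed)%:E * M) + (N * Ed)%:E * M))%E).
  rewrite lee_wpmul2l ?lee_fin ?(ltW Cm0)//.
  by apply: leeD => //; exact: leeD.
rewrite -!ge0_muleDl ?adde_ge0 ?lee_fin ?addr_ge0 ?mulr_ge0//.
rewrite muleA.
apply: (@le_trans _ _ (Cm%:E * ((1 + 2 * E1)%:E + (N * Ed)%:E + (N * Ed)%:E) *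
   (C0 * (ln (expR 1 + r^-1) / r `^ (n%:R + 2 * de)))%:E)%E).
  rewrite lee_wpmul2l ?HC0// mule_ge0 ?lee_fin ?(ltW Cm0)//.
  have := mulr_ge0 N0 Ed0; lra.
by rewrite -!EFinD -!EFinM lee_fin le_eqVlt; apply/orP; left; apply/eqP; ring.
Qed.

End kernel.

(** * Decay of the Fourier transform of a Schwartz function *)

Section schwartz_decay.
Context {R : realType} {n : nat}.
Implicit Types (f g : 'rV[R]_n -> R) (x y v xi : 'rV[R]_n).
Notation mu := (lebesgue_rV n : {measure set 'rV[R]_n -> \bar R}).

(** Each factor 1 + x_j^2 only raises the exponent of a monomial; hence the
    induction over a list of coordinates with all monomials at once. *)
Lemma monomial_japan_bound g (r : seq 'I_n) :
  (forall a : 'I_n -> nat, exists M : R, forall x,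
     `|(\prod_(i < n) x ord0 i ^+ a i) * g x| <= M) ->
  forall a : 'I_n -> nat, exists M : R, forall x,
     `|(\prod_(i < n) x ord0 i ^+ a i) * (\prod_(i <- r) (1 + x ord0 i ^+ 2) * g x)| <= M.
Proof.
move=> H; elim: r => [|j r IH] a.
  by have [M HM] := H a; exists M => x; rewrite big_nil mul1r.
have [M1 H1] := IH a.
have [M2 H2] := IH (fun i => (a i + (i == j).*2)%N).
exists (M1 + M2) => x.
apply: le_trans (lerD (H1 x) (H2 x)); apply: le_trans (ler_normD _ _).
rewrite le_eqVlt; apply/orP; left; apply/eqP; congr `| _ |.
have -> : \prod_(i < n) x ord0 i ^+ (a i + (i == j).*2) =
    \prod_(i < n) x ord0 i ^+ a i * x ord0 j ^+ 2.
  under eq_bigr do rewrite exprD.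
  rewrite big_split/=; congr (_ * _).
  rewrite (bigD1 j)//= eqxx big1 ?mulr1// => i /negbTE ->.
  by rewrite expr0.
by rewrite big_cons; ring.
Qed.

(** Multiplication by the inverse of the weight is multiplication by a
    polynomial, which preserves boundedness. *)
Lemma schwartz_japan f (s : seq 'I_n) : schwartz f ->
  exists M : R, 0 <= M /\ forall x, `|partials s f x| <= M * japan x.
Proof.
move=> [_ dec].
have [M HM] := @monomial_japan_bound (partials s f) (index_enum 'I_n)
  (fun a => dec a s) (fun=> 0%N).
exists M; split; first exact: le_trans (normr_ge0 _) (HM 0).
move=> x; have := HM x.
rewrite big1 => [|i _]; last by rewrite expr0.
have p0 : 0 < \prod_(i < n) (1 + x ord0 i ^+ 2).
  by apply: prodr_gt0 => i _; rewrite ltr_pwDl// sqr_ge0.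
rewrite mul1r normrM (gtr0_norm p0) /japan.
under [\prod_(i < n) (_ + _)^-1]eq_bigr do rewrite -[_^-1]mul1r.
by rewrite prodf_div big1_eq mul1r ler_pdivlMr// mulrC.
Qed.

(** The weight varies by at most a factor 2 per coordinate on distances up to
    1 / 2. *)
Lemma japan_shift (j : 'I_n) (t : R) x : `|t| <= 2^-1 ->
  japan (x + t *: delta_mx ord0 j) <= 2 ^+ n * japan x.
Proof.
move=> t1.
have -> : 2 ^+ n = \prod_(i < n) (2 : R) by rewrite prodr_const card_ord.
rewrite /japan -big_split/=; apply: ler_prod => i _.
have h0 (z : R) : 0 < 1 + z ^+ 2 by rewrite ltr_pwDl// sqr_ge0.
rewrite invr_ge0 ltW//= ler_pdivlMr// mulrC ler_pdivrMr//.
rewrite !mxE eqxx/=; move: (x ord0 i : R) => z.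
have t2 : t ^+ 2 <= (2^-1) ^+ 2.
  by rewrite -(real_normK (num_real t)) lerXn2r ?nnegrE.
case: (i == j) => /=; last by rewrite mulr0 addr0; have := h0 z; lra.
by rewrite mulr1; have := sqr_ge0 (z + 2 * t); move: t2; rewrite exprVn; nra.
Qed.

Lemma smooth_continuous g : smooth g -> continuous g.
Proof. by move=> sg x; exact: differentiable_continuous (sg [::] x). Qed.

Lemma smooth_measurable g : smooth g -> measurable_fun setT g.
Proof. by move=> /smooth_continuous/continuous_measurable_rV. Qed.

Lemma smooth_partial g (i : 'I_n) : smooth g -> smooth (partial i g).
Proof.
move=> sg s x; have := sg (rcons s i) x.
by rewrite /partials foldr_rcons.
Qed.

(** With c the inverse of a step and v that step along a coordinate this is a
    difference quotient; for general c it is linear in g and commutes with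
    derivatives. *)
Definition diffq (v : 'rV[R]_n) (c : R) g x := c * (g (x + v) - g x).

Lemma partial_diffq i v c g : (forall x, differentiable g x) ->
  partial i (diffq v c g) = diffq v c (partial i g).
Proof.
move=> dg; apply/funext => x; rewrite /partial.
have ds (y : 'rV[R]_n) : derivable g y (delta_mx ord0 i) by exact: diff_derivable.
have e : (fun h : R => h^-1 *: (((fun y => g (y + v)) \o shift x) (h *: delta_mx ord0 i) - g (x + v)))
   = (fun h : R => h^-1 *: ((g \o shift (x + v)) (h *: delta_mx ord0 i) - g (x + v))).
  by apply/funext => h /=; rewrite addrA.
have d1 : derivable (fun y => g (y + v)) x (delta_mx ord0 i).
  by rewrite /derivable e; exact: ds.
have e1 : 'D_(delta_mx ord0 i) (fun y => g (y + v)) x = 'D_(delta_mx ord0 i) g (x + v).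
  by rewrite /derive e.
have -> : diffq v c g = c *: ((fun y => g (y + v)) - g) by [].
rewrite deriveZ; last exact: derivableB.
by rewrite deriveB// e1.
Qed.

Lemma partials_diffq s v c g : smooth g ->
  partials s (diffq v c g) = diffq v c (partials s g).
Proof.
move=> sg; elim: s => [//|i s IH] /=.
by rewrite IH partial_diffq//; exact: sg s.
Qed.

Lemma smooth_diffq v c g : smooth g -> smooth (diffq v c g).
Proof.
move=> sg s x; rewrite partials_diffq//.
have -> : diffq v c (partials s g) = c *: ((partials s g \o shift v) - partials s g) by [].
apply: differentiableZ; apply: differentiableB; last exact: sg.
apply: differentiable_comp; last exact: sg.
by apply: differentiableD => //; exact: differentiable_cst.
Qed.

(** Mean value theorem along the j-th coordinate. *)
Lemma diffq_le (j : 'I_n) (h : R) g (M : R) : smooth g -> h != 0 -> `|h| <= 2^-1 ->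
  (forall x, `|partial j g x| <= M * japan x) ->
  forall x, `|diffq (h *: delta_mx ord0 j) h^-1 g x| <= M * 2 ^+ n * japan x.
Proof.
move=> sg h0 h1 HM x.
have M0 : 0 <= M.
  by have := le_trans (normr_ge0 _) (HM 0); rewrite pmulr_lge0// japan_gt0.
pose e : 'rV[R]_n := delta_mx ord0 j.
pose p (t : R) := g (x + t *: e).
have dp t : is_derive t (1 : R) p (partial j g (x + t *: e)).
  have E : (fun k : R => k^-1 *: ((p \o shift t) (k *: 1) - p t)) =
      (fun k : R => k^-1 *: ((g \o shift (x + t *: e)) (k *: e) - g (x + t *: e))).
    apply/funext => k; rewrite /p /=; congr (_ *: (g _ - _)).
    by rewrite [k *: 1]mulr1 scalerDl addrCA.
  have dg : derivable g (x + t *: e) e by apply: diff_derivable; exact: sg [::] _.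
  apply: DeriveDef; first by rewrite /derivable E.
  by rewrite /partial /derive E.
have [c /andP[c1 c2] pc] : exists2 c, - `|h| <= c <= `|h| & p h - p 0 = partial j g (x + c *: e) * h.
  have cp : continuous p.
    by move=> t; apply/differentiable_continuous/derivable1_diffP; case: (dp t).
  have [hp|hn] := ltP 0 h.
    have [c ci pc] := @MVT_segment _ p (fun t => partial j g (x + t *: e)) 0 h
      (ltW hp) (fun t _ => dp t) (continuous_subspaceT cp).
    exists c; last by rewrite pc subr0.
    by move: ci; rewrite in_itv/= (gtr0_norm hp) => /andP[? ->]; rewrite andbT; lra.
  have [c ci pc] := @MVT_segment _ p (fun t => partial j g (x + t *: e)) h 0
    hn (fun t _ => dp t) (continuous_subspaceT cp).
  exists c; last by rewrite -opprB pc sub0r mulrN opprK.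
  by move: ci; rewrite in_itv/= (ler0_norm hn) opprK => /andP[-> ?]/=; lra.
rewrite /diffq -/e.
have -> : g (x + h *: e) - g x = p h - p 0 by rewrite /p scale0r addr0.
rewrite pc mulrC mulfK//.
apply: (le_trans (HM _)); rewrite -mulrA ler_wpM2l// japan_shift//.
by rewrite (le_trans _ h1)// ler_norml c1.
Qed.

(** The Fourier transform in real form: the phases th = 0 and th = pi / 2 give its
    real and its imaginary part. *)
Definition osc g (th : R) xi : R := (\int[mu]_x (g x * cos (2 * pi * dotp x xi + th)))%R.

Lemma measurable_cos_dotp d (T : measurableType d) (f1 f2 : T -> 'rV[R]_n) (th : T -> R) :
  measurable_fun setT f1 -> measurable_fun setT f2 -> measurable_fun setT th ->
  measurable_fun setT (fun z => cos (2 * pi * dotp (f1 z) (f2 z) + th z)).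
Proof.
move=> m1 m2 mth.
apply: measurableT_comp; first exact: continuous_measurable_fun (@continuous_cos R).
by apply: measurable_funD => //; apply: measurable_funM => //; exact: measurable_dotp.
Qed.

Lemma integrable_osc g (M th : R) xi : measurable_fun setT g ->
  (forall x, `|g x| <= M * japan x) ->
  mu.-integrable setT (EFin \o (fun x => g x * cos (2 * pi * dotp x xi + th))).
Proof.
move=> mg gM.
apply: (@integrable_dom _ _ _ mu _ (fun x => M * japan x)).
- by apply: measurable_funM => //; apply: (@measurable_cos_dotp _ _ id (fun=> xi)).
- move=> x; rewrite normrM; apply: le_trans (gM x).
  by rewrite ler_piMr// normr_cos_le1.
- exact/integrable_scale/integrable_japan.
Qed.

(** The step h is half a period in the j-th coordinate: the translate of the
    phase is its opposite.  A difference quotient in space is therefore a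
    multiplication by the frequency, as a derivative would be. *)
Lemma osc_shift g (M th h : R) (j : 'I_n) xi : smooth g ->
  (forall x, `|g x| <= M * japan x) ->
  xi ord0 j != 0 -> h = (2 * xi ord0 j)^-1 ->
  `|h| <= 2^-1 ->
  osc (diffq (h *: delta_mx ord0 j) h^-1 g) th xi = - (4 * xi ord0 j) * osc g th xi.
Proof.
move=> sg gM xi0 hE h1; set v := h *: _.
have mg := smooth_measurable sg.
have ig := integrable_osc th xi mg gM.
have mgc : measurable_fun setT (fun x => g x * cos (2 * pi * dotp x xi + th)).
  by have /integrableP[/measurable_EFinP] := ig.
have dv x : dotp (x + v) xi = dotp x xi + 2^-1.
  rewrite /dotp; under eq_bigr do rewrite mxE mulrDl.
  rewrite big_split/=; congr (_ + _).
  rewrite (bigD1 j)//= big1 => [|i ij]; last by rewrite !mxE (negbTE ij) andbF mulr0 mul0r.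
  by rewrite !mxE !eqxx/= mulr1 addr0 hE; field.
have e x : g (x + v) * cos (2 * pi * dotp x xi + th) =
    - (g (x + v) * cos (2 * pi * dotp (x + v) xi + th)).
  rewrite dv -mulrN; congr (_ * _).
  rewrite (_ : 2 * pi * (_ + 2^-1) + th = 2 * pi * dotp x xi + th + pi); last by field.
  by rewrite cosDpi opprK.
have ms := measurable_addr v.
have igs : mu.-integrable setT (EFin \o (fun x => g (x + v) * cos (2 * pi * dotp (x + v) xi + th))).
  apply: integrable_ltyP; first exact: (measurableT_comp mgc ms).
  rewrite (@integral_rV_shift _ _ v (fun x => `|g x * cos (2 * pi * dotp x xi + th)|%:E)).
    exact: integrable_lty ig.
  by apply/measurable_EFinP; exact: measurableT_comp.
have i2 : (\int[mu]_x (g (x + v) * cos (2 * pi * dotp (x + v) xi + th)) = osc g th xi)%R.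
  rewrite /osc /Rintegral; congr fine.
  rewrite (@integral_rV_shift _ _ v (fun x => (g x * cos (2 * pi * dotp x xi + th))%:E))//.
  exact/measurable_EFinP.
rewrite /osc /diffq.
under eq_Rintegral => x _.
  rewrite (_ : _ * _ = (- h^-1) * (g (x + v) * cos (2 * pi * dotp (x + v) xi + th) +
     g x * cos (2 * pi * dotp x xi + th))); last first.
    rewrite [LHS](_ : _ = h^-1 * (g (x + v) * cos (2 * pi * dotp x xi + th) -
      g x * cos (2 * pi * dotp x xi + th))); last by ring.
    by rewrite e; ring.
  over.
rewrite RintegralZl//; last exact: integrable_add.
rewrite RintegralD// i2 -/(osc g th xi) hE invrK; ring.
Qed.

(** One power of the frequency per member of the list.  The constant depends on
    g only through bounds for its derivatives, so the induction hypothesis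
    applies to the difference quotients of g, whose derivatives obey the same
    bounds up to a factor 2^n. *)
Lemma osc_decay_seq (r : seq 'I_n) (M : seq 'I_n -> R) :
  exists C : R, forall g, smooth g ->
    (forall s x, `|partials s g x| <= M s * japan x) ->
    forall th xi, \prod_(i <- r) Num.max 1 `|xi ord0 i| * `|osc g th xi| <= C.
Proof.
elim: r M => [|j r IH] M.
  exists (\int[mu]_x (M [::] * japan x))%R => g sg gM th xi.
  have mg := smooth_measurable sg.
  have ig := integrable_osc th xi mg (gM [::]).
  have iJ := integrable_scale (M [::]) (@integrable_japan R n).
  rewrite big_nil mul1r (le_trans (le_normr_Rintegral _ _))//.
  apply: le_Rintegral => //.
  - exact: (integrable_norm ig).
  - move=> x _; rewrite normrM; apply: le_trans (gM [::] x).
    by rewrite ler_piMr// normr_cos_le1.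
have [C1 H1] := IH M.
have [C2 H2] := IH (fun s => M (j :: s) * 2 ^+ n).
exists (Num.max C1 C2) => g sg gM th xi.
rewrite big_cons le_max.
have [x1|x1] := leP `|xi ord0 j| 1.
  by rewrite mul1r H1.
apply/orP; right.
have xi0 : xi ord0 j != 0 by rewrite -normr_gt0 (lt_trans _ x1).
pose h := (2 * xi ord0 j)^-1.
have h0 : h != 0 by rewrite invr_eq0 mulf_neq0.
have h1 : `|h| <= 2^-1.
  rewrite normfV normrM normr_nat lef_pV2 ?posrE ?mulr_gt0 ?normr_gt0//.
  by rewrite ler_peMr// ltW.
have sd := smooth_diffq (h *: delta_mx ord0 j) h^-1 sg.
have := H2 _ sd _ th xi.
rewrite (osc_shift th sg (gM [::]) xi0 erefl h1) => H.
apply: le_trans (H _); last first.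
  move=> s x; rewrite partials_diffq//; apply: diffq_le => //.
    by elim: s {x} => [//|i s IHs]; exact: smooth_partial.
  by move=> y; exact: (gM (j :: s)).
rewrite mulrAC [leLHS]mulrC; apply: ler_wpM2l.
  by apply: prodr_ge0 => i _; rewrite le_max ler01.
rewrite normrM normrN normrM normr_nat; apply: ler_wpM2r => //.
by rewrite ler_peMl// ler1n.
Qed.

Lemma sum_le_prod (y : 'I_n -> R) : (forall i, 0 <= y i) ->
  1 + \sum_(i < n) y i <= \prod_(i < n) (1 + y i).
Proof.
move=> y0; elim: (index_enum 'I_n) => [|i r IH]; first by rewrite !big_nil addr0.
rewrite !big_cons; have yi := y0 i.
have s0 : 0 <= \sum_(k <- r) y k by apply: sumr_ge0.
by nra.
Qed.

(** Two powers per coordinate make up the weight and two more dominate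
    1 + |xi|^2, whence each coordinate occurs four times in the list. *)
Lemma osc_decay f : schwartz f -> exists C : R, 0 <= C /\
  forall th xi, `|osc f th xi| * (1 + dotp xi xi) <= C * japan xi.
Proof.
move=> sf.
have /choice[M HM] := fun s => schwartz_japan s sf.
pose r := index_enum 'I_n.
have [C HC] := osc_decay_seq (r ++ r ++ r ++ r) M.
have H := HC f sf.1 (fun s => (HM s).2).
exists (4 ^+ n * C); split.
  rewrite mulr_ge0 ?exprn_ge0//; apply: le_trans (H 0 0); rewrite mulr_ge0//.
  by apply: prodr_ge0 => i _; rewrite le_max ler01.
move=> th xi; have := H th xi; rewrite !big_cat/= -!big_split/=.
set P := \prod_(i <- r) _ => HP.
have Q : (1 + dotp xi xi) / japan xi <= 4 ^+ n * P.
  have y0 (i : 'I_n) : 0 <= xi ord0 i ^+ 2 by rewrite sqr_ge0.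
  have d : 1 + dotp xi xi <= \prod_(i < n) (1 + xi ord0 i ^+ 2).
    by rewrite /dotp; under eq_bigr do rewrite -expr2; exact: sum_le_prod.
  have -> : (japan xi)^-1 = \prod_(i < n) (1 + xi ord0 i ^+ 2).
    by rewrite /japan -prodfV; apply: eq_bigr => i _; rewrite invrK.
  have p0 : 0 <= \prod_(i < n) (1 + xi ord0 i ^+ 2).
    by apply: prodr_ge0 => i _; rewrite addr_ge0.
  apply: (le_trans (ler_wpM2r p0 d)).
  have -> : 4 ^+ n = \prod_(i < n) (4 : R) by rewrite prodr_const card_ord.
  rewrite -!big_split/=; apply: ler_prod => i _.
  rewrite mulr_ge0 ?addr_ge0//=.
  rewrite -(real_normK (num_real (xi ord0 i))).
  have := normr_ge0 (xi ord0 i); move: `|xi ord0 i| => z z0.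
  set m := Num.max 1 z.
  have w : 1 + z ^+ 2 <= 2 * m ^+ 2.
    by rewrite /m; have [z1|z1] := leP z 1; nra.
  rewrite [leRHS](_ : _ = (2 * m ^+ 2) * (2 * m ^+ 2)); last by ring.
  by apply: ler_pM => //; rewrite addr_ge0// sqr_ge0.
have J0 := japan_gt0 xi.
rewrite -ler_pdivrMr// -mulrA mulrC.
apply: (le_trans (ler_wpM2r (normr_ge0 _) Q)).
by rewrite -mulrA ler_wpM2l ?exprn_ge0.
Qed.

End schwartz_decay.

(** * The heat kernel *)

Section heat_kernel.
Context {R : realType} {n : nat}.
Implicit Types (x y xi : 'rV[R]_n).
Notation mu := (lebesgue_rV n : {sigma_finite_measure set 'rV[R]_n -> \bar R}).

Definition heat (t : R) x : R := heat_profile n t (dotp x x).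

(** The Fourier symbol of minus the laplacian. *)
Definition symb xi : R := (2 * pi) ^+ 2 * dotp xi xi.

Lemma dotpC x y : dotp x y = dotp y x.
Proof. by rewrite /dotp; apply: eq_bigr => i _; rewrite mulrC. Qed.

Lemma dotpZr (c : R) x y : dotp x (c *: y) = c * dotp x y.
Proof. by rewrite /dotp mulr_sumr; apply: eq_bigr => i _; rewrite mxE mulrCA. Qed.

Lemma heat_ge0 t x : 0 <= heat t x. Proof. exact: heat_profile_ge0. Qed.

Lemma symb_ge0 xi : 0 <= symb xi.
Proof. by rewrite mulr_ge0 ?sqr_ge0 ?dotp_ge0. Qed.

Lemma measurable_dotp2 : measurable_fun setT (fun x => dotp x x).
Proof. exact: (@measurable_dotp R _ _ n id id). Qed.

Lemma measurable_heat t : 0 <= t -> measurable_fun setT (heat t).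
Proof. by move=> t0; apply: measurable_heat_profile => //; exact: measurable_dotp2. Qed.

Lemma measurable_symb : measurable_fun setT symb.
Proof. by apply: measurable_funM => //; exact: measurable_dotp2. Qed.

Lemma heatE t x : heat t x =
  (Num.sqrt (4 * pi * t))^-1 ^+ n * expR (- ((4 * t)^-1 * dotp x x)).
Proof. by []. Qed.

Lemma integrable_heat t : 0 < t -> mu.-integrable setT (EFin \o heat t).
Proof.
by move=> t0; apply/integrable_scale/integrable_gauss; rewrite invr_gt0 mulr_gt0.
Qed.

Lemma fourier_heat t th xi : 0 < t ->
  (\int[mu]_x (heat t x * cos (2 * pi * dotp x xi + th))%:E =
   (expR (- (t * symb xi)) * cos th)%:E)%E.
Proof.
move=> t0; have a0 : 0 < (4 * t)^-1 by rewrite invr_gt0 mulr_gt0.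
under eq_integral do rewrite heatE -[_ * _ * cos _]mulrA -(dotpZr (2 * pi)).
rewrite (integralZl_EFin _ (integrable_gauss_cos _ _ a0)) fourier_gauss//.
rewrite -EFinM; congr EFin; rewrite !mulrA -exprMn invrK.
rewrite (_ : pi * (4 * t) = 4 * pi * t); last by ring.
rewrite mulVf ?expr1n ?mul1r; last by rewrite gt_eqF// sqrtr_gt0 !mulr_gt0 ?pi_gt0.
congr (expR (- _) * _); rewrite dotpZr dotpC dotpZr /symb.
by move: (pi : R) => p; field; rewrite gt_eqF.
Qed.

Lemma integral_heat t : 0 < t -> (\int[mu]_x (heat t x)%:E = 1%E)%E.
Proof.
move=> t0; have := fourier_heat 0 0 t0.
rewrite cos0 mulr1 /symb (_ : dotp _ _ = 0); last first.
  by rewrite /dotp big1// => i _; rewrite mxE mulr0.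
rewrite !mulr0 oppr0 expR0 => <-; apply: eq_integral => x _.
rewrite (_ : dotp _ _ = 0) ?mulr0 ?addr0 ?cos0 ?mulr1//.
by rewrite /dotp big1// => i _; rewrite mxE mulr0.
Qed.

Lemma expR_symb t xi : expR (- (t * symb xi)) = expR (- ((2 * pi) ^+ 2 * t * dotp xi xi)).
Proof. by congr (expR (- _)); rewrite /symb; ring. Qed.

(** The heat kernel is its own inverse transform because Gaussians are
    transformed into Gaussians; this is inversion for the heat kernel. *)
Lemma fourier_expR_symb t y : 0 < t ->
  (\int[mu]_xi (expR (- (t * symb xi)) * cos (2 * pi * dotp y xi))%:E = (heat t y)%:E)%E.
Proof.
move=> t0.
have a0 : 0 < (2 * pi) ^+ 2 * t :> R by rewrite mulr_gt0// exprn_gt0// mulr_gt0// pi_gt0.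
under eq_integral do rewrite expR_symb [dotp y _]dotpC -(dotpZr (2 * pi)) -[dotp _ (_ *: _)]addr0.
rewrite fourier_gauss// cos0 mulr1; congr EFin; rewrite heatE; congr (_ * _).
  rewrite exprVn -exprVn -sqrtrV ?mulr_ge0 ?pi_ge0 ?(ltW t0)//; congr (Num.sqrt _ ^+ n).
  move: (@pi_gt0 R); move: (pi : R) => p p0; field.
  by rewrite !gt_eqF.
congr expR; rewrite dotpZr dotpC dotpZr.
move: (@pi_gt0 R); move: (pi : R) => p p0; field.
by rewrite !gt_eqF.
Qed.

(** Doubling the time of the kernel frees a Gaussian factor, which the two moment
    bounds below spend on |x|^2 and |x|. *)
Lemma heat_double t x : 0 < t ->
  heat t x = Num.sqrt 2 ^+ n * heat (2 * t) x * expR (- (dotp x x / (8 * t))).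
Proof.
move=> t0; rewrite !heatE.
rewrite (_ : 4 * pi * (2 * t) = 2 * (4 * pi * t)); last by ring.
rewrite [Num.sqrt (2 * _)]sqrtrM// [(Num.sqrt 2 * _)^-1]invfM exprMn.
rewrite [RHS](_ : _ = (Num.sqrt 2 ^+ n * (Num.sqrt 2)^-1 ^+ n) * (Num.sqrt (4 * pi * t))^-1 ^+ n *
  (expR (- ((4 * (2 * t))^-1 * dotp x x)) * expR (- (dotp x x / (8 * t))))); last by ring.
rewrite -exprMn mulfV ?expr1n ?mul1r ?gt_eqF ?sqrtr_gt0// -expRD; congr (_ * expR _).
by field; rewrite gt_eqF.
Qed.

Lemma dotp_heat_le t x : 0 < t ->
  dotp x x * heat t x <= 8 * t * Num.sqrt 2 ^+ n * heat (2 * t) x.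
Proof.
move=> t0; have t8 : 0 < 8 * t by rewrite mulr_gt0.
rewrite heat_double// mulrA mulrAC ; rewrite [leRHS]mulrAC.
set X := dotp x x.
rewrite [leRHS](_ : _ = Num.sqrt 2 ^+ n * heat (2 * t) x * (8 * t)); last by ring.
rewrite [leLHS](_ : _ = Num.sqrt 2 ^+ n * heat (2 * t) x * (X * expR (- (X / (8 * t))))); last by ring.
apply: ler_wpM2l; first by rewrite mulr_ge0 ?heat_ge0 ?exprn_ge0.
rewrite expRN ler_pdivrMr ?expR_gt0// mulrC -ler_pdivrMr//.
by have := expR_ge1Dx (X / (8 * t)); lra.
Qed.

Lemma enorm_ge0 x : 0 <= enorm x. Proof. exact: sqrtr_ge0. Qed.

Lemma enorm2 x : enorm x ^+ 2 = dotp x x.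
Proof. by rewrite sqr_sqrtr ?dotp_ge0. Qed.

Lemma enorm_heat_le t x : 0 < t ->
  enorm x * heat t x <= Num.sqrt (8 * t) * Num.sqrt 2 ^+ n * heat (2 * t) x.
Proof.
move=> t0; have t8 : 0 < 8 * t by rewrite mulr_gt0.
rewrite heat_double//.
rewrite [leRHS](_ : _ = Num.sqrt 2 ^+ n * heat (2 * t) x * Num.sqrt (8 * t)); last by ring.
rewrite [leLHS](_ : _ = Num.sqrt 2 ^+ n * heat (2 * t) x * (enorm x * expR (- (dotp x x / (8 * t))))); last by ring.
apply: ler_wpM2l; first by rewrite mulr_ge0 ?heat_ge0 ?exprn_ge0.
rewrite expRN ler_pdivrMr ?expR_gt0// mulrC -ler_pdivrMr ?sqrtr_gt0//.
have e : dotp x x / (8 * t) = (enorm x / Num.sqrt (8 * t)) ^+ 2.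
  by rewrite exprMn enorm2 exprVn sqr_sqrtr// ltW.
rewrite e; set z := _ / _.
by have := expR_ge1Dx (z ^+ 2); have := sqr_ge0 (z - 1); nra.
Qed.

End heat_kernel.

(** * Fourier inversion through the heat kernel *)

Section inversion.
Context {R : realType} {n : nat}.
Notation mu := (lebesgue_rV n : {sigma_finite_measure set 'rV[R]_n -> \bar R}).
Variable f : 'rV[R]_n -> R.
Hypothesis sf : schwartz f.
Implicit Types (x y xi : 'rV[R]_n).

Lemma measurable_osc g th : measurable_fun setT g ->
  measurable_fun setT (@osc R n g th).
Proof.
move=> mg.
apply: (@measurable_Rintegral2 _ _ _ _ _ mu (fun xi x => g x * cos (2 * pi * dotp x xi + th))).
apply: measurable_funM; first exact: (measurableT_comp mg measurable_snd).
by apply: (@measurable_cos_dotp R n _ _ snd fst (fun=> th)).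
Qed.

Let mf : measurable_fun setT f. Proof. exact: smooth_measurable sf.1. Qed.

Lemma japan_le1 x : japan x <= 1.
Proof.
have -> : 1 = \prod_(i < n) (1 : R) by rewrite big1_eq.
apply: ler_prod => i _.
by rewrite invr_ge0 addr_ge0 ?sqr_ge0//= invf_le1 ?ltr_pwDl ?sqr_ge0// lerDl sqr_ge0.
Qed.

(** Continuity at 0 near the origin and boundedness away from it.  In this form
    the convergence of heat averages follows from the second moment alone. *)
Lemma schwartz_quadratic (e : R) : 0 < e -> exists K : R, 0 <= K /\
  forall y, `|f y - f 0| <= e + K * dotp y y.
Proof.
move=> e0.
have [M [M0 HM]] := schwartz_japan [::] sf.
have fM x : `|f x| <= M.
  by apply: (le_trans (HM x)); rewrite ler_piMr ?japan_le1.
have cf : {for 0, continuous f} by exact: smooth_continuous sf.1 0.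
have /cvgrPdist_le/(_ _ e0)/nbhs_ballP[d /= d0 Hd] := cf.
have K0 : 0 <= 2 * M / d ^+ 2.
  by apply: divr_ge0; [exact: mulr_ge0|apply: exprn_ge0; exact: ltW].
exists (2 * M / d ^+ 2); split => // y.
have [yd|/existsNP[i /negP]] := pselect (forall i, `|y ord0 i| < d).
  apply: (@le_trans _ _ e); last by rewrite lerDl mulr_ge0 ?dotp_ge0.
  rewrite distrC; apply: Hd; split => // i j; rewrite ord1 /ball/= mxE sub0r normrN.
  exact: yd.
rewrite -leNgt => dy.
apply: (@le_trans _ _ (2 * M)).
  by rewrite (le_trans (ler_normB _ _))// (_ : 2 * M = M + M) ?lerD//; ring.
apply: (@le_trans _ _ (2 * M / d ^+ 2 * dotp y y)); last by rewrite lerDr ltW.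
rewrite mulrAC ler_pdivlMr ?exprn_gt0// ler_wpM2l ?mulr_ge0//.
rewrite /dotp (bigD1 i)//=.
apply: (@le_trans _ _ (y ord0 i * y ord0 i)).
  by rewrite -expr2 -[leRHS](real_normK (num_real _)) lerXn2r ?nnegrE// ltW.
by rewrite lerDl sumr_ge0// => k _; rewrite -expr2 sqr_ge0.
Qed.

Lemma osc_le : exists C : R, 0 <= C /\ forall th xi,
  `|osc f th xi| <= C * japan xi /\ `|osc f th xi| * dotp xi xi <= C * japan xi.
Proof.
have [C [C0 HC]] := osc_decay sf; exists C; split => // th xi.
have := HC th xi; rewrite mulrDr mulr1.
have h1 := normr_ge0 (osc f th xi).
have h2 := mulr_ge0 h1 (dotp_ge0 xi).
by move=> h; split; lra.
Qed.

Lemma integrable_osc_xi th : mu.-integrable setT (EFin \o osc f th).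
Proof.
have [C [C0 HC]] := osc_le.
apply: (@integrable_dom _ _ _ mu _ (fun x => C * japan x)).
- exact: measurable_osc.
- by move=> x; have [] := HC th x.
- exact/integrable_scale/integrable_japan.
Qed.

Lemma integrable_osc_symb th : mu.-integrable setT
  (EFin \o (fun xi => `|osc f th xi| * symb xi)).
Proof.
have [C [C0 HC]] := osc_le.
apply: (@integrable_dom _ _ _ mu _ (fun x => (2 * pi) ^+ 2 * C * japan x)).
- apply: measurable_funM; last exact: measurable_symb.
  by apply: measurableT_comp => //; exact: measurable_osc.
- move=> x; have [_ h] := HC th x.
  have n0 : 0 <= `|osc f th x| * symb x by rewrite mulr_ge0 ?symb_ge0.
  rewrite (ger0_norm n0) /symb mulrCA -[leRHS]mulrA.
  by apply: ler_wpM2l => //; rewrite exprn_ge0 ?mulr_ge0 ?pi_ge0.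
- exact/integrable_scale/integrable_japan.
Qed.

Lemma integrable_osc_damped th t : 0 < t -> mu.-integrable setT
  (EFin \o (fun xi => osc f th xi * expR (- (t * symb xi)))).
Proof.
move=> t0; have iN := integrable_norm (integrable_osc_xi th).
apply: (@integrable_dom _ _ _ mu _ (fun xi => `|osc f th xi|)) => //.
- apply: measurable_funM; first exact: measurable_osc.
  apply: measurableT_comp => //; apply: measurableT_comp => //.
  by apply: measurable_funM => //; exact: measurable_symb.
- move=> xi; rewrite normrM (ger0_norm (expR_ge0 _)) ler_piMr//.
  by rewrite expR_le1 oppr_le0 mulr_ge0 ?symb_ge0// ltW.
Qed.

(** Fubini, and inversion for the heat kernel. *)
Lemma osc_heat t : 0 < t ->
  (\int[mu]_xi (osc f 0 xi * expR (- (t * symb xi)))%:E =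
   \int[mu]_y (f y * heat t y)%:E)%E.
Proof.
move=> t0.
have [M [M0 HM]] := schwartz_japan [::] sf.
pose F xi y := f y * cos (2 * pi * dotp y xi + 0) * expR (- (t * symb xi)).
have me : measurable_fun setT (fun xi : 'rV[R]_n => expR (- (t * symb xi))).
  apply: measurableT_comp => //; apply: measurableT_comp => //.
  by apply: measurable_funM => //; exact: measurable_symb.
have ie : mu.-integrable setT (EFin \o (fun xi : 'rV[R]_n => expR (- (t * symb xi)))).
  under eq_fun do rewrite expR_symb.
  by apply: integrable_gauss; rewrite mulr_gt0 ?exprn_gt0// mulr_gt0 ?pi_gt0.
have iJ := integrable_scale M (@integrable_japan R n).
have mF : measurable_fun setT (fun p : 'rV[R]_n * 'rV[R]_n => F p.1 p.2).
  apply: measurable_funM; last exact: (measurableT_comp me measurable_fst).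
  apply: measurable_funM; first exact: (measurableT_comp mf measurable_snd).
  by apply: (@measurable_cos_dotp R n _ _ snd fst (fun=> 0)).
transitivity (\int[mu]_xi \int[mu]_y (F xi y)%:E)%E.
  apply: eq_integral => xi _.
  have io := integrable_osc 0 xi mf HM.
  rewrite mulrC EFinM -(integralE_Rintegral io) -(integralZl_EFin _ io).
  by apply: eq_integral => y _; rewrite /F [in RHS]mulrC.
rewrite (fubini_dom mF ie iJ); last first.
  move=> xi y; rewrite /F normrM (ger0_norm (expR_ge0 _)) mulrC ler_wpM2l ?expR_ge0//.
  by rewrite normrM; apply: le_trans (HM y); rewrite ler_piMr// normr_cos_le1.
apply: eq_integral => y _.
under eq_integral => xi _.
  rewrite (_ : F xi y = f y * (expR (- (t * symb xi)) * cos (2 * pi * dotp y xi))); last first.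
    by rewrite /F addr0; ring.
  over.
rewrite integralZl_EFin; first by rewrite fourier_expR_symb.
apply: (@integrable_dom _ _ _ mu _ _ _ _ ie).
  apply: measurable_funM => //.
  under eq_fun do rewrite -[_ * dotp _ _]addr0.
  by apply: (@measurable_cos_dotp R n _ _ (fun=> y) id (fun=> 0)).
by move=> xi; rewrite normrM (ger0_norm (expR_ge0 _)) ler_piMr ?expR_ge0 ?normr_cos_le1.
Qed.

Lemma one_sub_expR_ge0_le (z : R) : 0 <= z -> 0 <= 1 - expR (- z) <= z.
Proof.
move=> z0; rewrite subr_ge0 expR_le1 oppr_le0 z0/=.
by have := expR_ge1Dx (- z); lra.
Qed.

Lemma integrable_f_heat t : 0 < t -> mu.-integrable setT (EFin \o (fun y => f y * heat t y)).
Proof.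
move=> t0.
have [M [M0 HM]] := schwartz_japan [::] sf.
apply: (@integrable_dom _ _ _ mu _ (fun y => M * heat t y)).
- by apply: measurable_funM => //; apply: measurable_heat; exact: ltW.
- move=> y; rewrite normrM (ger0_norm (heat_ge0 _ _)) ler_wpM2r ?heat_ge0//.
  by apply: (le_trans (HM y)); rewrite ler_piMr ?japan_le1.
- exact/integrable_scale/integrable_heat.
Qed.

(** Damping the transform by exp(- t L) costs at most t times the integral of
    |osc| L, and the damped integral is the heat average of f, which is within
    e + O(t) of f 0.  As t and then e tend to 0, the two limits agree. *)
Lemma osc_inversion : (\int[mu]_xi (osc f 0 xi)%:E = (f 0)%:E)%E.
Proof.
have io := integrable_osc_xi 0.
rewrite (integralE_Rintegral io); congr EFin.
set I := (\int[mu]_xi _)%R.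
have is_ := integrable_osc_symb 0.
pose S := (\int[mu]_xi (`|osc f 0 xi| * symb xi))%R.
have S0 : 0 <= S by apply: Rintegral_ge0 => xi _; rewrite mulr_ge0 ?symb_ge0.
have bound e : 0 < e -> exists K, 0 <= K /\ forall t, 0 < t -> `|I - f 0| <= e + K * t.
  move=> e0; have [K [K0 HK]] := schwartz_quadratic e0.
  exists (S + K * (8 * Num.sqrt 2 ^+ n)); split.
    by rewrite addr_ge0// !mulr_ge0// exprn_ge0.
  move=> t t0.
  have id_ := integrable_osc_damped 0 t0.
  have ifh := integrable_f_heat t0.
  have ih := integrable_heat t0 : mu.-integrable setT (EFin \o heat t).
  have t20 : 0 < 2 * t by rewrite mulr_gt0.
  have ih2 := integrable_heat t20 : mu.-integrable setT (EFin \o heat (2 * t)).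
  pose D := (\int[mu]_xi (osc f 0 xi * expR (- (t * symb xi))))%R.
  have ED : D = (\int[mu]_y (f y * heat t y))%R.
    by rewrite /D /Rintegral osc_heat.
  have d1 : `|I - D| <= S * t.
    rewrite -RintegralB//.
    apply: le_trans (le_normr_Rintegral _ _) _ => //; first exact: integrable_sub.
    rewrite -RintegralZr//; apply: le_Rintegral => //.
    - exact: (integrable_norm (integrable_sub io id_)).
    - by under eq_fun do rewrite mulrC; exact: integrable_scale.
    - move=> xi _.
      have tl : 0 <= t * symb xi by rewrite mulr_ge0 ?symb_ge0// ltW.
      have /andP[u0 u1] := one_sub_expR_ge0_le tl.
      rewrite -{1}[osc f 0 xi]mulr1 -mulrBr normrM (ger0_norm u0).
      by rewrite -mulrA ler_wpM2l// [symb xi * t]mulrC.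
  have f0E : f 0 = (\int[mu]_y (f 0 * heat t y))%R.
    rewrite RintegralZl// /Rintegral integral_heat//= mulr1//.
  have d2 : `|D - f 0| <= e + K * (8 * Num.sqrt 2 ^+ n) * t.
    rewrite ED {1}f0E -RintegralB//; last exact: integrable_scale.
    apply: le_trans (le_normr_Rintegral _ _) _ => //.
      by apply: integrable_sub => //; exact: integrable_scale.
    pose c := K * (8 * t * Num.sqrt 2 ^+ n).
    have -> : e + K * (8 * Num.sqrt 2 ^+ n) * t =
        (\int[mu]_y (e * heat t y + c * heat (2 * t) y))%R.
      rewrite RintegralD//; [|exact: integrable_scale|exact: integrable_scale].
      rewrite (RintegralZl e measurableT ih) (RintegralZl c measurableT ih2).
      by rewrite /Rintegral !integral_heat//= !mulr1 /c; ring.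
    apply: le_Rintegral => //.
    - by apply: integrable_norm; apply: integrable_sub => //; exact: integrable_scale.
    - by apply: integrable_add; exact: integrable_scale.
    - move=> y _; rewrite -mulrBl normrM (ger0_norm (heat_ge0 _ _)).
      apply: (le_trans (ler_wpM2r (heat_ge0 _ _) (HK y))).
      rewrite mulrDl lerD2l -mulrA /c -mulrA ler_wpM2l//.
      by rewrite dotp_heat_le.
  rewrite (_ : I - f 0 = (I - D) + (D - f 0)); last by ring.
  by apply: (le_trans (ler_normD _ _)); lra.
apply/eqP; rewrite -subr_eq0 -normr_le0; apply/ler_addgt0Pr => e e0.
rewrite add0r.
have e20 : 0 < e / 2 by rewrite divr_gt0.
have [K [K0 HK]] := bound _ e20.
have K1 : 0 < K + 1 by rewrite ltr_wpDl.
have t0 : 0 < e / 2 / (K + 1) by rewrite divr_gt0.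
apply: (le_trans (HK _ t0)); rewrite [leRHS](splitr e) lerD2l mulrA ler_pdivrMr//.
by rewrite mulrC ler_wpM2l ?(ltW e20)// lerDl.
Qed.

(** Inversion at the origin minus inversion for the heat average; both kernels
    have mass 1. *)
Lemma osc_one_sub_heat t : 0 < t ->
  (\int[mu]_xi (osc f 0 xi * (1 - expR (- (t * symb xi)))))%R =
  (\int[mu]_y (heat t y * (f 0 - f y)))%R.
Proof.
move=> t0.
have io := integrable_osc_xi 0; have id_ := integrable_osc_damped 0 t0.
have ifh := integrable_f_heat t0.
have ih := integrable_heat t0 : mu.-integrable setT (EFin \o heat t).
under eq_Rintegral do rewrite mulrBr mulr1.
rewrite RintegralB// {1}/Rintegral osc_inversion/=.
under [RHS]eq_Rintegral do rewrite mulrBr [_ * f 0]mulrC [_ * f _]mulrC.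
rewrite RintegralB//; last exact: integrable_scale.
rewrite RintegralZl//; congr (_ - _).
  by rewrite /Rintegral integral_heat//= mulr1.
by rewrite /Rintegral osc_heat.
Qed.

End inversion.

(** * The fractional laplacian tested against the heat kernel *)

Section trig_bounds.
Context {R : realType}.

Lemma normr_sin_le (x : R) : `|sin x| <= `|x|.
Proof.
wlog x0 : x / 0 <= x.
  move=> H; have [/H//|x0] := leP 0 x.
  by have := H (- x); rewrite sinN !normrN; apply; rewrite oppr_ge0 ltW.
have cs : continuous (@sin R) by exact: continuous_sin.
have [c _] := @MVT_segment R (@sin R) (@cos R) 0 x x0 (fun t _ => is_derive_sin t)
  (continuous_subspaceT cs).
rewrite sin0 !subr0 => ->.
by rewrite normrM ler_piMl// normr_cos_le1.
Qed.

Lemma normr_one_sub_cos_le (x : R) : `|1 - cos x| <= `|x|.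
Proof.
have -> : 1 - cos x = 2 * sin (x / 2) ^+ 2.
  rewrite {1}(_ : x = (x / 2) *+ 2); last by rewrite -mulr_natr; field.
  by rewrite cos_mulr2n cos2sin2 -mulr_natr; ring.
have s0 : 0 <= 2 * sin (x / 2) ^+ 2 by rewrite mulr_ge0 ?sqr_ge0.
rewrite (ger0_norm s0) -(real_normK (num_real (sin (x / 2)))).
have s1 : `|sin (x / 2)| <= 1 by rewrite ler_norml sin_geN1 sin_le1.
have s2 : `|sin (x / 2)| <= `|x| / 2.
  by apply: (le_trans (normr_sin_le _)); rewrite normrM (ger0_norm (x := 2^-1)).
have := normr_ge0 (sin (x / 2)).
by move: s1 s2; move: `|sin (x / 2)| `|x| => u v *; nra.
Qed.

Lemma Re_mulc (x y : R[i]) : complex.Re (x * y) =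
  complex.Re x * complex.Re y - complex.Im x * complex.Im y.
Proof. by case: x => a b; case: y. Qed.

Lemma Im_mulc (x y : R[i]) : complex.Im (x * y) =
  complex.Re x * complex.Im y + complex.Im x * complex.Re y.
Proof. by case: x => a b; case: y. Qed.

(** The multiplier of order gamma < 1 is controlled by one of order 1. *)
Lemma powR_le1D (z g : R) : 0 <= z -> 0 < g < 1 -> z `^ g <= 1 + z.
Proof.
move=> z0 /andP[g0 g1].
have [z1|z1] := leP z 1.
  apply: (@le_trans _ _ 1); last by rewrite lerDl.
  have -> : 1 = 1 `^ g :> R by rewrite powR1.
  by rewrite ge0_ler_powR ?nnegrE// ltW.
apply: (@le_trans _ _ z); last by rewrite lerDr.
by apply: ler1_powR; exact: ltW.
Qed.

End trig_bounds.

Section laplacian.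
Context {R : realType} {n : nat}.
Notation mu := (lebesgue_rV n : {sigma_finite_measure set 'rV[R]_n -> \bar R}).
Notation leb := (@lebesgue_measure R).
Variables (f : 'rV[R]_n -> R) (gamma : R).
Hypothesis sf : schwartz f.
Hypothesis hg : 0 < gamma < 1.
Implicit Types (x y xi : 'rV[R]_n).

Let mf : measurable_fun setT f. Proof. exact: smooth_measurable sf.1. Qed.

(** Multiplier, and real and imaginary parts of the transform of f. *)
Let m xi : R := (2 * pi * enorm xi) `^ gamma.
Let a := osc f 0.
Let b := osc f (pi / 2).

(** The integrand of Lambda^gamma f(0) - Lambda^gamma f(x) over the frequencies. *)
Let k x xi := m xi * (a xi * (1 - cos (2 * pi * dotp x xi)) +
   b xi * sin (2 * pi * dotp x xi)).

Let m_ge0 xi : 0 <= m xi. Proof. exact: powR_ge0. Qed.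

Let z xi := 2 * pi * enorm xi.
Let z_ge0 xi : 0 <= z xi. Proof. by rewrite !mulr_ge0 ?pi_ge0 ?enorm_ge0. Qed.
Let z2 xi : z xi ^+ 2 = symb xi.
Proof. by rewrite /z exprMn enorm2. Qed.

Let m_le xi : m xi <= 1 + z xi. Proof. exact: (powR_le1D (z_ge0 xi) hg). Qed.

Let ma : measurable_fun setT a. Proof. exact: measurable_osc. Qed.
Let mb : measurable_fun setT b. Proof. exact: measurable_osc. Qed.
Let mm : measurable_fun setT m.
Proof.
apply: (measurableT_comp (@measurable_powR R gamma)).
by apply: measurable_funM => //; exact: (@measurable_enorm R _ _ n id).
Qed.

(** An integrable weight that dominates the transform times the multiplier, also
   after multiplication by one more power of the frequency. *)
Let w xi := 2 * ((1 + symb xi) * (`|a xi| + `|b xi|)).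

Let iw : mu.-integrable setT (EFin \o w).
Proof.
apply: integrable_scale.
rewrite (_ : (fun x => _) = (fun x => (`|a x| + `|b x|) + (`|a x| * symb x + `|b x| * symb x))); last first.
  by apply/funext => x; ring.
apply: integrable_add; apply: integrable_add.
- exact: (integrable_norm (integrable_osc_xi sf 0)).
- exact: (integrable_norm (integrable_osc_xi sf (pi / 2))).
- exact: integrable_osc_symb.
- exact: integrable_osc_symb.
Qed.

Let mw xi : m xi * (`|a xi| + `|b xi|) <= w xi.
Proof.
rewrite /w mulrA; apply: ler_wpM2r; first by rewrite addr_ge0.
rewrite -z2; apply: (le_trans (m_le xi)).
by have := z_ge0 xi; have := sqr_ge0 (z xi - 1); nra.
Qed.

Let mzw xi : z xi * (m xi * (`|a xi| + `|b xi|)) <= w xi.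
Proof.
rewrite /w !mulrA; apply: ler_wpM2r; first by rewrite addr_ge0.
apply: (le_trans (ler_wpM2l (z_ge0 xi) (m_le xi))).
by rewrite -z2; have := z_ge0 xi; have := sqr_ge0 (z xi - 1); nra.
Qed.

Let k_le x xi : `|k x xi| <= 2 * w xi.
Proof.
rewrite /k normrM (ger0_norm (m_ge0 xi)).
apply: (@le_trans _ _ (2 * (m xi * (`|a xi| + `|b xi|)))); last by rewrite ler_wpM2l.
rewrite [leRHS]mulrCA; apply: ler_wpM2l => //.
apply: (le_trans (ler_normD _ _)); rewrite [leRHS]mulrDr; apply: lerD.
  rewrite normrM [leLHS]mulrC; apply: ler_wpM2r => //.
  apply: (le_trans (ler_normB _ _)); rewrite normr1 (_ : 2 = 1 + 1)// lerD2l.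
  exact: normr_cos_le1.
rewrite normrM [leLHS]mulrC; apply: ler_wpM2r => //.
by apply: (@le_trans _ _ 1); rewrite ?ler1n// ler_norml sin_geN1 sin_le1.
Qed.

Let dotp_le x xi : `|dotp x xi| <= n%:R * (enorm x * enorm xi).
Proof.
have c (v : 'rV[R]_n) i : `|v ord0 i| <= enorm v.
  rewrite -sqrtr_sqr /enorm ler_sqrt ?dotp_ge0// /dotp (bigD1 i)//= expr2 lerDl.
  by apply: sumr_ge0 => j _; rewrite -expr2 sqr_ge0.
rewrite /dotp (le_trans (ler_norm_sum _ _ _))//.
apply: (@le_trans _ _ (\sum_(i < n) enorm x * enorm xi)).
  by apply: ler_sum => i _; rewrite normrM ler_pM.
by rewrite sumr_const card_ord mulr_natl.
Qed.

(** The bound that gains a factor |x|; it uses the extra power of the frequency. *)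
Let k_lip x xi : `|k x xi| <= n%:R * enorm x * w xi.
Proof.
rewrite /k normrM (ger0_norm (m_ge0 xi)).
apply: (@le_trans _ _ (n%:R * enorm x * (z xi * (m xi * (`|a xi| + `|b xi|))))); last first.
  by rewrite ler_wpM2l// mulr_ge0 ?enorm_ge0.
rewrite [leRHS](_ : _ = m xi * ((n%:R * enorm x * z xi) * (`|a xi| + `|b xi|))); last by ring.
rewrite ler_wpM2l//.
have t : `|2 * pi * dotp x xi| <= n%:R * enorm x * z xi.
  rewrite normrM ger0_norm ?mulr_ge0 ?pi_ge0//.
  rewrite [leRHS](_ : _ = 2 * pi * (n%:R * (enorm x * enorm xi))); last by rewrite /z; ring.
  by rewrite ler_wpM2l ?mulr_ge0 ?pi_ge0.
apply: (le_trans (ler_normD _ _)); rewrite [leRHS]mulrDr; apply: lerD.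
  rewrite normrM [leLHS]mulrC; apply: ler_wpM2r => //.
  by apply: (le_trans _ t); exact: normr_one_sub_cos_le.
rewrite normrM [leLHS]mulrC; apply: ler_wpM2r => //.
by apply: (le_trans _ t); exact: normr_sin_le.
Qed.

Let mk : measurable_fun setT (fun p : 'rV[R]_n * 'rV[R]_n => k p.1 p.2).
Proof.
have mt : measurable_fun setT (fun p : 'rV[R]_n * 'rV[R]_n => 2 * pi * dotp p.1 p.2).
  by apply: measurable_funM => //; exact: measurable_dotp.
apply: measurable_funM; first exact: (measurableT_comp mm measurable_snd).
apply: measurable_funD; apply: measurable_funM.
- exact: (measurableT_comp ma measurable_snd).
- apply: measurable_funB => //.
  by apply: (measurableT_comp _ mt); exact: continuous_measurable_fun (@continuous_cos R).
- exact: (measurableT_comp mb measurable_snd).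
- by apply: (measurableT_comp _ mt); exact: continuous_measurable_fun (@continuous_sin R).
Qed.

Let ik x : mu.-integrable setT (EFin \o k x).
Proof.
apply: (@integrable_dom _ _ _ mu _ (fun xi => 2 * w xi)).
- exact: (measurable_section1 mk).
- exact: k_le.
- exact: integrable_scale.
Qed.

(** The symbol is real and even, so only the real part of the product remains. *)
Let frac_laplacianE x : frac_laplacian gamma f x =
  (\int[mu]_xi (m xi * (a xi * cos (2 * pi * dotp x xi) - b xi * sin (2 * pi * dotp x xi))))%R.
Proof.
have ReE (u v : R) : complex.Re (u +i* v)%C = u by [].
have ImE (u v : R) : complex.Im (u +i* v)%C = v by [].
rewrite /frac_laplacian /inv_fourier /cintegral ReE.
apply: eq_Rintegral => xi _.
rewrite Re_mulc Re_mulc Im_mulc /fourier /cintegral !ReE !ImE !mul0r subr0 addr0.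
have -> : (\int[lebesgue_rV n]_x0 complex.Re ((f x0)%:C%C * expi (- (2 * pi * dotp x0 xi))))%R = a xi.
  apply: eq_Rintegral => y _; rewrite Re_mulc !ReE !ImE mul0r subr0 cosN.
  by rewrite addr0.
have -> : (\int[lebesgue_rV n]_x0 complex.Im ((f x0)%:C%C * expi (- (2 * pi * dotp x0 xi))))%R = b xi.
  by apply: eq_Rintegral => y _; rewrite Im_mulc !ReE !ImE mul0r addr0 sinN cosDpihalf.
by rewrite -/(m xi); ring.
Qed.

Definition lap_diff x := frac_laplacian gamma f 0 - frac_laplacian gamma f x.

Let integrable_lap x : mu.-integrable setT (EFin \o (fun xi =>
  m xi * (a xi * cos (2 * pi * dotp x xi) - b xi * sin (2 * pi * dotp x xi)))).
Proof.
have mt : measurable_fun setT (fun xi : 'rV[R]_n => 2 * pi * dotp x xi).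
  by apply: measurable_funM => //; exact: (@measurable_dotp R _ _ n (fun=> x) id).
apply: (@integrable_dom _ _ _ mu _ w) => //.
- apply: measurable_funM => //; apply: measurable_funB; apply: measurable_funM => //.
    by apply: (measurableT_comp _ mt); exact: continuous_measurable_fun (@continuous_cos R).
  by apply: (measurableT_comp _ mt); exact: continuous_measurable_fun (@continuous_sin R).
- move=> xi; apply: le_trans (mw xi).
  rewrite normrM (ger0_norm (m_ge0 xi)) ler_wpM2l//.
  rewrite (le_trans (ler_normB _ _))// !normrM lerD// ler_piMr// ?normr_cos_le1//.
  by rewrite ler_norml sin_geN1 sin_le1.
Qed.

Let lap_diffE x : lap_diff x = (\int[mu]_xi k x xi)%R.
Proof.
rewrite /lap_diff !frac_laplacianE -RintegralB//.
apply: eq_Rintegral => xi _.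
rewrite (_ : dotp 0 xi = 0); last by rewrite /dotp big1// => i _; rewrite mxE mul0r.
by rewrite mulr0 cos0 sin0 /k; ring.
Qed.

(** The Schwartz decay of f makes its fractional laplacian Lipschitz at 0. *)
Lemma lap_diff_le : exists K : R, 0 <= K /\ forall x, `|lap_diff x| <= K * enorm x.
Proof.
exists (n%:R * (\int[mu]_xi w xi)%R); split.
  by rewrite mulr_ge0//; apply: Rintegral_ge0 => xi _; rewrite !mulr_ge0 ?addr_ge0 ?symb_ge0.
move=> x; rewrite lap_diffE (le_trans (le_normr_Rintegral _ _))//.
rewrite mulrAC -(RintegralZl _ measurableT iw).
apply: le_Rintegral => //.
- exact: (integrable_norm (ik x)).
- exact: integrable_scale.
Qed.

Lemma measurable_lap_diff : measurable_fun setT lap_diff.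
Proof.
rewrite (_ : lap_diff = fun x => \int[mu]_xi k x xi)%R; last exact/funext.
exact: (measurable_Rintegral2 mu mk).
Qed.

Lemma integrable_heat_cos t th xi : 0 < t ->
  mu.-integrable setT (EFin \o (fun x => heat t x * cos (2 * pi * dotp x xi + th))).
Proof.
move=> t0; apply: (@integrable_dom _ _ _ mu _ (heat t)).
- apply: measurable_funM; first exact: measurable_heat (ltW t0).
  by apply: (@measurable_cos_dotp R n _ _ id (fun=> xi) (fun=> th)).
- by move=> x; rewrite normrM (ger0_norm (heat_ge0 _ _)) ler_piMr ?heat_ge0 ?normr_cos_le1.
- exact: integrable_heat.
Qed.

(** Integrating the frequency representation against the heat kernel replaces
    cos by exp(- t L), and sin, being odd, by 0. *)
Lemma integral_heat_lap_diff t : 0 < t ->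
  (\int[mu]_x (heat t x * lap_diff x)%:E =
   \int[mu]_xi (m xi * (a xi * (1 - expR (- (t * symb xi)))))%:E)%E.
Proof.
move=> t0.
have ih := integrable_heat t0 : mu.-integrable setT (EFin \o heat t).
have mh := measurable_heat (ltW t0) : measurable_fun setT (heat t : 'rV[R]_n -> R).
transitivity (\int[mu]_x \int[mu]_xi (heat t x * k x xi)%:E)%E.
  apply: eq_integral => x _.
  by rewrite EFinM lap_diffE -(integralE_Rintegral (ik x)) -integralZl_EFin.
have mF : measurable_fun setT (fun p : 'rV[R]_n * 'rV[R]_n => heat t p.1 * k p.1 p.2).
  by apply: measurable_funM; [exact: (measurableT_comp mh measurable_fst)|exact: mk].
rewrite (fubini_dom mF ih (integrable_scale 2 iw)); last first.
  by move=> x xi; rewrite normrM (ger0_norm (heat_ge0 _ _)) ler_wpM2l ?heat_ge0 ?k_le.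
apply: eq_integral => xi _.
have i0 := integrable_heat_cos 0 xi t0.
have i1 := integrable_heat_cos (- (pi / 2)) xi t0.
under eq_integral => x _.
  rewrite (_ : _ * _ = m xi * a xi * heat t x +
    (- (m xi * a xi) * (heat t x * cos (2 * pi * dotp x xi + 0)) +
     m xi * b xi * (heat t x * cos (2 * pi * dotp x xi + - (pi / 2))))); last first.
    by rewrite cosBpihalf addr0 /k; ring.
  rewrite EFinD [X in (_ + X)%E]EFinD.
  over.
have j0 := integrable_scale (m xi * a xi) ih.
have j1 := integrable_scale (- (m xi * a xi)) i0.
have j2 := integrable_scale (m xi * b xi) i1.
rewrite (integralD measurableT j0 (integrableD measurableT j1 j2)).
rewrite (integralD measurableT j1 j2).
rewrite (integralZl_EFin _ ih) (integralZl_EFin _ i0) (integralZl_EFin _ i1).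
rewrite !fourier_heat// integral_heat// cosN cos_pihalf cos0 -!EFinM -!EFinD.
by congr EFin; ring.
Qed.

Let de := gamma / 2.
Let de0 : 0 < de. Proof. by case/andP: hg => ? _; rewrite divr_gt0. Qed.
Let de1 : de <= 2^-1.
Proof. by case/andP: hg => _ ?; rewrite ler_pdivrMr// mulVf// ltW. Qed.

(** The product is a combination of three factors 1 - exp(- u L), for the times
    u = e^s, e^t and e^s + e^t, to which [osc_one_sub_heat] applies. *)
Lemma osc_second_diff s t :
  (\int[mu]_xi (a xi * ((1 - expR (- (expR s * symb xi))) * (1 - expR (- (expR t * symb xi))))))%R =
  (\int[mu]_y (heat_diff2 n (dotp y y) s t * (f 0 - f y)))%R.
Proof.
have es := expR_gt0 s; have et := expR_gt0 t.
have est : 0 < expR s + expR t by rewrite addr_gt0.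
have io := integrable_osc_xi sf 0.
have i1 u : 0 < u -> mu.-integrable setT (EFin \o (fun xi => a xi * (1 - expR (- (u * symb xi))))).
  move=> u0; under eq_fun do rewrite mulrBr mulr1.
  by apply: integrable_sub => //; exact: integrable_osc_damped.
have i2 u : 0 < u -> mu.-integrable setT (EFin \o (fun y => heat u y * (f 0 - f y))).
  move=> u0; under eq_fun do rewrite mulrBr [_ * f 0]mulrC [_ * f _]mulrC.
  apply: integrable_sub; last exact: integrable_f_heat.
  by apply: integrable_scale; exact: integrable_heat.
under eq_Rintegral => xi _.
  rewrite (_ : _ * _ = a xi * (1 - expR (- (expR s * symb xi))) +
     a xi * (1 - expR (- (expR t * symb xi))) -
     a xi * (1 - expR (- ((expR s + expR t) * symb xi)))); last first.
    rewrite [(expR s + expR t) * _]mulrDl opprD expRD; ring.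
  over.
rewrite RintegralB//; [|exact: integrable_add (i1 _ es) (i1 _ et)|exact: i1].
rewrite RintegralD//; [|exact: i1|exact: i1].
rewrite /a !osc_one_sub_heat//.
rewrite -RintegralD//; [|exact: i2|exact: i2].
rewrite -RintegralB//; [|exact: integrable_add (i2 _ es) (i2 _ et)|exact: i2].
by apply: eq_Rintegral => y _; rewrite /heat_diff2 /heat; ring.
Qed.

(** The multiplier is written as a superposition of factors 1 - exp(- e^s L), each
    of which meets the factor 1 - exp(- e^t L) of [integral_heat_lap_diff]. *)
Lemma heat_lap_diff_second_diff (A t : R) : 0 < A ->
  (forall x : R, 0 <= x ->
   (\int[leb]_s (expR (- (de * s)) * (1 - expR (- (expR s * x ^+ 2))))%:E =
    (A * x `^ (2 * de))%:E)%E) ->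
  (\int[mu]_x (heat (expR t) x * lap_diff x)%:E =
   \int[leb]_s (A^-1 * (expR (- (de * s)) *
      (\int[mu]_y (heat_diff2 n (dotp y y) s t * (f 0 - f y)))%R))%:E)%E.
Proof.
move=> A0 HA; rewrite integral_heat_lap_diff ?expR_gt0//.
pose F xi s := A^-1 * (expR (- (de * s)) * (a xi * ((1 - expR (- (expR s * symb xi)))
   * (1 - expR (- (expR t * symb xi)))))).
have e2 : 2 * de = gamma by rewrite /de; field.
have u01 xi u : 0 <= 1 - expR (- (expR u * symb xi)) <= 1.
  by rewrite subr_ge0 expR_le1 oppr_le0 mulr_ge0 ?expR_ge0 ?symb_ge0//= lerBlDr lerDl expR_ge0.
transitivity (\int[mu]_xi \int[leb]_s (F xi s)%:E)%E.
  apply: eq_integral => xi _.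
  have -> : m xi = A^-1 * (A * z xi `^ (2 * de)) by rewrite mulKf ?gt_eqF// e2.
  have ib := integrable_bernstein de0 de1 (symb_ge0 xi).
  rewrite [X in X%:E](_ : _ = (A^-1 * (a xi * (1 - expR (- (expR t * symb xi))))) * (A * z xi `^ (2 * de))); last by ring.
  rewrite EFinM -(HA _ (z_ge0 xi)) z2 -(integralZl_EFin _ ib).
  by apply: eq_integral => s _; congr EFin; rewrite /F; ring.
have ie := integrable_scale A^-1 (integrable_expR_absr de0).
have iB : mu.-integrable setT (EFin \o (fun xi => `|a xi| + `|a xi| * symb xi)).
  apply: integrable_add; last exact: integrable_osc_symb.
  exact: (integrable_norm (integrable_osc_xi sf 0)).
have msy : measurable_fun setT (fun p : 'rV[R]_n * R => symb p.1).
  exact: (measurableT_comp measurable_symb measurable_fst).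
have mF : measurable_fun setT (fun p : 'rV[R]_n * R => F p.1 p.2).
  apply: measurable_funM => //; apply: measurable_funM.
    by apply: measurableT_comp => //; apply: measurableT_comp => //; exact: measurable_funM.
  apply: measurable_funM; first exact: (measurableT_comp ma measurable_fst).
  apply: measurable_funM; apply: measurable_funB => //; apply: measurableT_comp => //;
    apply: measurableT_comp => //; apply: measurable_funM => //.
  by apply: measurableT_comp => //; exact: measurable_snd.
rewrite (@fubini_dom _ _ _ _ _ mu leb F mF _ _ iB ie); last first.
  move=> xi s; rewrite /F.
  have /andP[b0 b1] := one_sub_expR_le de1 s (symb_ge0 xi).
  have /andP[c0 c1] := u01 xi t.
  rewrite [X in `|X|](_ : _ = A^-1 * (a xi * ((expR (- (de * s)) * (1 - expR (- (expR s * symb xi))))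
     * (1 - expR (- (expR t * symb xi)))))); last by ring.
  rewrite normrM (gtr0_norm (x := A^-1)) ?invr_gt0// [leRHS]mulrCA.
  apply: ler_wpM2l; first by rewrite invr_ge0 ltW.
  rewrite (_ : `|a xi| + `|a xi| * symb xi = `|a xi| * (1 + symb xi)); last by ring.
  rewrite normrM -[leRHS]mulrA; apply: ler_wpM2l => //.
  rewrite (ger0_norm (mulr_ge0 b0 c0)) [leRHS]mulrC.
  by apply: (le_trans _ b1); rewrite ler_piMr.
apply: eq_integral => s _.
have ii : mu.-integrable setT (EFin \o (fun xi => a xi * ((1 - expR (- (expR s * symb xi))) * (1 - expR (- (expR t * symb xi)))))).
  apply: (@integrable_dom _ _ _ mu _ (fun xi => `|a xi|)).
  - apply: measurable_funM => //.
    by apply: measurable_funM; apply: measurable_funB => //; apply: measurableT_comp => //;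
      apply: measurableT_comp => //; apply: measurable_funM => //; exact: measurable_symb.
  - move=> xi; rewrite normrM ler_piMr//.
    have /andP[b0 b1] := u01 xi s; have /andP[c0 c1] := u01 xi t.
    by rewrite ger0_norm ?mulr_ge0// mulr_ile1.
  - exact: (integrable_norm (integrable_osc_xi sf 0)).
rewrite -osc_second_diff mulrA EFinM -(integralE_Rintegral ii) -(integralZl_EFin _ ii).
by apply: eq_integral => xi _; congr EFin; rewrite /F; ring.
Qed.

End laplacian.

(** * The estimate of the functional *)

Section final.
Context {R : realType} {n : nat}.
Notation mu := (lebesgue_rV n : {sigma_finite_measure set 'rV[R]_n -> \bar R}).
Notation leb := (@lebesgue_measure R).
Variables (f : 'rV[R]_n -> R) (gamma : R).
Hypothesis sf : schwartz f.
Hypothesis hg : 0 < gamma < 1.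
Hypothesis n0 : (0 < n)%N.
Implicit Types (x y xi : 'rV[R]_n).

Let de := gamma / 2.
Let h := lap_diff f gamma.
Let mf : measurable_fun setT f. Proof. exact: smooth_measurable sf.1. Qed.
Let mh : measurable_fun setT h. Proof. exact: measurable_lap_diff. Qed.

Lemma enorm0_eq0 x : enorm x = 0 -> x = 0.
Proof.
move=> x0; have /eqP : dotp x x = 0 by rewrite -enorm2 x0 expr0n.
rewrite psumr_eq0 => [/allP H|i _]; last by rewrite -expr2 sqr_ge0.
apply/rowP => i; rewrite mxE; apply/eqP.
by have := H i (mem_index_enum _); rewrite -expr2 expf_eq0.
Qed.

(** The nonnegative kernel whose double integral is bounded in kernel_le. *)
Let Phi (t s : R) y : R :=
  mix n t * (expR (- (de * s)) * `|heat_diff2 n (dotp y y) s t|).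

Let Phi_ge0 t s y : 0 <= Phi t s y.
Proof. by rewrite !mulr_ge0 ?mix_ge0 ?expR_ge0. Qed.

Let mdiff d (T : measurableType d) (t s : T -> R) (y : T -> 'rV[R]_n) :
  measurable_fun setT t -> measurable_fun setT s -> measurable_fun setT y ->
  measurable_fun setT (fun z => heat_diff2 n (dotp (y z) (y z)) (s z) (t z)).
Proof.
move=> mt ms my; have md := measurable_dotp my my.
have me u : measurable_fun setT u -> measurable_fun setT (fun z : T => expR (u z)).
  by move=> mu_; exact: measurableT_comp.
apply: measurable_funB; first apply: measurable_funD.
- by apply: measurable_heat_profile => //; exact: me.
- by apply: measurable_heat_profile => //; exact: me.
- apply: measurable_heat_profile => //.
    by apply: measurable_funD; exact: me.
Qed.

Let mPhi d (T : measurableType d) (t s : T -> R) (y : T -> 'rV[R]_n) :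
  measurable_fun setT t -> measurable_fun setT s -> measurable_fun setT y ->
  measurable_fun setT (fun z => Phi (t z) (s z) (y z)).
Proof.
move=> mt ms my; apply: measurable_funM; first exact: (measurableT_comp (@measurable_mix R n) mt).
apply: measurable_funM.
  by apply: measurableT_comp => //; apply: measurableT_comp => //; exact: measurable_funM.
by apply: measurableT_comp => //; exact: mdiff.
Qed.

(** The integrand of the statement, decomposed over the times e^t. *)
Let G (c : R) x (t : R) := c^-1 * mix n t * (heat (expR t) x * h x).

Let h0 x : enorm x = 0 -> h x = 0.
Proof.
by move=> /enorm0_eq0 ->; rewrite /h /lap_diff subrr.
Qed.

Lemma lap_diff_mixture (c : R) x : 0 < c ->
  (forall r : R, 0 < r ->
  (\int[leb]_s (mix n s * heat_profile n (expR s) (r ^+ 2))%:E =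
   (c * (expR (- r) / r ^+ n))%:E)%E) ->
  ((h x / enorm x ^+ n * expR (- enorm x))%:E = \int[leb]_t (G c x t)%:E)%E.
Proof.
move=> c0 Hc.
have [x0|x0] := eqVneq (enorm x) 0.
  rewrite h0// !mul0r; under eq_integral do rewrite /G h0// !mulr0.
  by rewrite integral0.
have r0 : 0 < enorm x by rewrite lt_neqAle eq_sym x0 enorm_ge0.
have i1 : leb.-integrable setT (EFin \o (fun t => mix n t * heat_profile n (expR t) (enorm x ^+ 2))).
  apply: integrable_ltyP.
    apply: measurable_funM; first exact: measurable_mix.
    by apply: measurable_heat_profile => //; exact: measurable_expR.
  under eq_integral do rewrite ger0_norm ?mulr_ge0 ?mix_ge0 ?heat_profile_ge0//.
  by rewrite Hc// ltry.
under eq_integral => t _.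
  rewrite (_ : G c x t = c^-1 * h x * (mix n t * heat_profile n (expR t) (enorm x ^+ 2))); last first.
    by rewrite /G /heat enorm2; ring.
  over.
rewrite (integralZl_EFin _ i1) Hc// -EFinM; congr EFin.
by field; rewrite expf_neq0 ?gt_eqF.
Qed.

Let mG c : measurable_fun setT (fun p : 'rV[R]_n * R => G c p.1 p.2).
Proof.
apply: measurable_funM.
  by apply: measurable_funM => //; exact: (measurableT_comp (@measurable_mix R n) measurable_snd).
apply: measurable_funM; last exact: (measurableT_comp mh measurable_fst).
apply: measurable_heat_profile => //.
  by apply: measurableT_comp => //; exact: measurable_snd.
exact: (@measurable_dotp R _ _ n fst fst).
Qed.

Let Knorm : R := Num.sqrt 8 * Num.sqrt 2 ^+ n.

Let integral_heat_absh : exists K : R, 0 <= K /\ forall t : R,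
  (\int[mu]_x (heat (expR t) x * `|h x|)%:E <= (K * expR (t / 2))%:E)%E.
Proof.
have [K [K0 HK]] := lap_diff_le sf hg.
exists (K * Knorm); split; first by rewrite !mulr_ge0 ?exprn_ge0.
move=> t; have e0 := expR_gt0 t; have e20 : 0 < 2 * expR t by rewrite mulr_gt0.
have ih2 := integrable_heat e20 : mu.-integrable setT (EFin \o heat (2 * expR t)).
apply: (@le_trans _ _ (\int[mu]_x (K * Knorm * expR (t / 2) * heat (2 * expR t) x)%:E)%E).
  have i2 := integrable_scale (K * Knorm * expR (t / 2)) ih2.
  apply: ge0_le_integral => //.
  - by move=> x _; rewrite lee_fin mulr_ge0 ?heat_ge0.
  - apply/measurable_EFinP; apply: measurable_funM; first exact: measurable_heat (ltW e0).
    exact: measurableT_comp.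
  - by have /integrableP[] := i2.
  - move=> x _; rewrite lee_fin mulrC.
    apply: (le_trans (ler_wpM2r (heat_ge0 _ _) (HK x))).
    rewrite -!mulrA ler_wpM2l//; apply: (le_trans (enorm_heat_le x e0)).
    rewrite sqrtrM// sqrt_expR /Knorm le_eqVlt; apply/orP; left; apply/eqP; ring.
rewrite (integralZl_EFin _ ih2) integral_heat// mule1 lee_fin//.
Qed.

(** The density mix does not decay at - oo, which the factor |x| of lap_diff_le
   makes up for: the first moment of the heat kernel is of order e^(t / 2), which is integrable there. *)
Let iG c : 0 < c -> (mu \x leb)%E.-integrable setT (fun p : 'rV[R]_n * R => (G c p.1 p.2)%:E).
Proof.
move=> c0; have [K [K0 HK]] := integral_heat_absh.
have [Cm [Cm0 HCm]] := @mix_le R n n0.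
apply/integrable21ltyP; first by apply/measurable_EFinP; exact: mG.
have h2 : 0 < 2^-1 :> R by rewrite invr_gt0.
have ie := integrable_expR_exp h2 h2.
have ie2 := integrable_scale (c^-1 * Cm * K) ie.
apply: le_lt_trans (integrable_lty ie2).
apply: ge0_le_integral => //.
- by move=> t _; exact: integral_ge0.
- apply: (@measurable_fun_fubini_tonelli_G _ _ _ _ _ mu (abse \o (EFin \o (fun p : 'rV[R]_n * R => G c p.1 p.2)))).
    by apply: measurableT_comp => //; apply/measurable_EFinP; exact: mG.
  by move=> p; exact: abse_ge0.
- by apply/measurable_EFinP; apply: measurableT_comp => //; have /integrableP[/measurable_EFinP] := ie2.
move=> t _.
have cm : 0 <= c^-1 * mix n t by rewrite mulr_ge0 ?mix_ge0// invr_ge0 ltW.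
have mheat : measurable_fun setT (fun x => heat (expR t) x * `|h x|).
  by apply: measurable_funM; [exact: measurable_heat (expR_ge0 t)|exact: measurableT_comp].
have -> : (\int[mu]_x `|(G c (x, t).1 (x, t).2)%:E|)%E =
    ((c^-1 * mix n t)%:E * \int[mu]_x (heat (expR t) x * `|h x|)%:E)%E.
  rewrite -ge0_integralZl; [|exact: measurableT|exact/measurable_EFinP
    |by move=> x _; rewrite lee_fin mulr_ge0 ?heat_ge0|by rewrite lee_fin].
  apply: eq_integral => x _.
  by rewrite -EFinM /= /G normrM (ger0_norm cm) normrM (ger0_norm (heat_ge0 _ _)).
apply: (le_trans (lee_wpmul2l _ (HK t))); first by rewrite lee_fin.
rewrite -EFinM lee_fin ger0_norm; last first.
  by rewrite !mulr_ge0 ?expR_ge0 ?invr_ge0 ?(ltW c0) ?(ltW Cm0).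
rewrite [leRHS](_ : _ = c^-1 * (Cm * expR (- (expR t / 2))) * (K * expR (t / 2))); last first.
  by rewrite [expR t / 2]mulrC [t / 2]mulrC; ring.
apply: ler_wpM2r; first by rewrite mulr_ge0 ?expR_ge0.
by apply: ler_wpM2l; [rewrite invr_ge0 ltW|exact: HCm].
Qed.

Let de0 : 0 < de. Proof. by case/andP: hg => ? _; rewrite divr_gt0. Qed.

Let if0 u : 0 < u -> mu.-integrable setT (EFin \o (fun y => heat u y * (f 0 - f y))).
Proof.
move=> u0; under eq_fun do rewrite mulrBr [_ * f 0]mulrC [_ * f _]mulrC.
apply: integrable_sub; last exact: integrable_f_heat.
by apply: integrable_scale; exact: integrable_heat.
Qed.

Let idiff s t : mu.-integrable setT
  (EFin \o (fun y => heat_diff2 n (dotp y y) s t * (f 0 - f y))).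
Proof.
have es := expR_gt0 s; have et := expR_gt0 t.
have est : 0 < expR s + expR t by rewrite addr_gt0.
rewrite (_ : (fun y => _) = (fun y => heat (expR s) y * (f 0 - f y) +
  heat (expR t) y * (f 0 - f y) - heat (expR s + expR t) y * (f 0 - f y))); last first.
  by apply/funext => y; rewrite /heat_diff2 /heat; ring.
by apply: integrable_sub; [apply: integrable_add|]; exact: if0.
Qed.

Let ihh t : mu.-integrable setT (EFin \o (fun x => heat (expR t) x * h x)).
Proof.
have [K [K0 HK]] := integral_heat_absh.
apply: integrable_ltyP.
  by apply: measurable_funM => //; exact: measurable_heat (expR_ge0 t).
under eq_integral do rewrite normrM (ger0_norm (heat_ge0 _ _)).
by apply: le_lt_trans (HK t) _; rewrite ltry.
Qed.

(** The fractional laplacian leaves the estimate here: only the values of f and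
    the second difference of the heat kernel remain. *)
Lemma inner_bound (A c t : R) : 0 < A -> 0 < c ->
  (forall x : R, 0 <= x ->
   (\int[leb]_s (expR (- (de * s)) * (1 - expR (- (expR s * x ^+ 2))))%:E =
    (A * x `^ (2 * de))%:E)%E) ->
  (`| \int[mu]_x (G c x t)%:E | <=
   \int[leb]_s \int[mu]_y ((c * A)^-1 * (`|f 0 - f y| * Phi t s y))%:E)%E.
Proof.
move=> A0 c0 HA.
have cm : 0 <= c^-1 * mix n t by rewrite mulr_ge0 ?mix_ge0// invr_ge0 ltW.
rewrite (integralZl_EFin _ (ihh t)) (heat_lap_diff_second_diff sf hg t A0 HA).
rewrite abseM gee0_abs ?lee_fin//.
pose B (s : R) y := expR (- (de * s)) * (heat_diff2 n (dotp y y) s t * (f 0 - f y)).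
have mB : measurable_fun setT (fun p : R * 'rV[R]_n => heat_diff2 n (dotp p.2 p.2) p.1 t * (f 0 - f p.2)).
  apply: measurable_funM.
    by apply: (mdiff (t := fun=> t)).
  by apply: measurable_funB => //; exact: (measurableT_comp mf measurable_snd).
have mI : measurable_fun setT (fun s => \int[mu]_y (heat_diff2 n (dotp y y) s t * (f 0 - f y)))%R.
  exact: (@measurable_Rintegral2 _ _ _ _ _ mu (fun (s : R) y => heat_diff2 n (dotp y y) s t * (f 0 - f y))).
have mJ : measurable_fun setT (fun s => A^-1 * (expR (- (de * s)) *
   (\int[mu]_y (heat_diff2 n (dotp y y) s t * (f 0 - f y)))%R)).
  apply: measurable_funM => //; apply: measurable_funM => //.
  by apply: measurableT_comp => //; apply: measurableT_comp => //; exact: measurable_funM.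
apply: (@le_trans _ _ ((c^-1 * mix n t)%:E * \int[leb]_s `|(A^-1 * (expR (- (de * s)) *
   (\int[mu]_y (heat_diff2 n (dotp y y) s t * (f 0 - f y)))%R))%:E|)%E).
  apply: lee_wpmul2l; first by rewrite lee_fin.
  by apply: le_abse_integral => //; exact/measurable_EFinP.
rewrite -ge0_integralZl; [|exact: measurableT| |by move=> s _; exact: abse_ge0|by rewrite lee_fin]; last first.
  by apply: measurableT_comp => //; exact/measurable_EFinP.
have mPhi2 : measurable_fun setT (fun p : R * 'rV[R]_n => (c * A)^-1 * (`|f 0 - f p.2| * Phi t p.1 p.2)).
  apply: measurable_funM => //; apply: measurable_funM.
    apply: measurableT_comp => //; apply: measurable_funB => //.
    exact: (measurableT_comp mf measurable_snd).
  by apply: (mPhi (t := fun=> t)).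
have cA : 0 <= (c * A)^-1 by rewrite invr_ge0 mulr_ge0// ltW.
have P0 p1 p2 : 0 <= (c * A)^-1 * (`|f 0 - f p2| * Phi t p1 p2).
  by apply: mulr_ge0 => //; apply: mulr_ge0 => //; exact: Phi_ge0.
apply: ge0_le_integral => //.
- by move=> s _; apply: mule_ge0; [rewrite lee_fin|exact: abse_ge0].
- apply: measurable_funeM; apply: measurableT_comp => //; exact/measurable_EFinP.
- apply: (@measurable_fun_fubini_tonelli_F _ _ _ _ _ mu (EFin \o (fun p : R * 'rV[R]_n => (c * A)^-1 * (`|f 0 - f p.2| * Phi t p.1 p.2)))).
    exact/measurable_EFinP.
  by move=> p; rewrite lee_fin.
move=> s _.
rewrite (EFinM A^-1) abseM (gee0_abs (x := A^-1%:E)) ?lee_fin ?invr_ge0 ?(ltW A0)//.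
rewrite (EFinM (expR _)) abseM (gee0_abs (x := (expR _)%:E)) ?lee_fin ?expR_ge0//.
rewrite -(integralE_Rintegral (idiff s t)).
apply: (@le_trans _ _ ((c^-1 * mix n t)%:E * (A^-1%:E * ((expR (- (de * s)))%:E *
   \int[mu]_y `|heat_diff2 n (dotp y y) s t * (f 0 - f y)|%:E)))%E).
  rewrite !lee_wpmul2l ?lee_fin ?invr_ge0 ?expR_ge0 ?(ltW A0)//.
  by apply: le_abse_integral => //; have /integrableP[] := idiff s t.
rewrite !muleA -!EFinM -ge0_integralZl; [|exact: measurableT| | |]; last 3 first.
- apply: measurableT_comp => //; have /integrableP[/measurable_EFinP m1 _] := idiff s t.
  exact: measurableT_comp.
- by move=> y _; rewrite lee_fin.
- by rewrite lee_fin !mulr_ge0 ?expR_ge0 ?invr_ge0 ?mix_ge0 ?(ltW c0) ?(ltW A0).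
rewrite le_eqVlt; apply/orP; left; apply/eqP; apply: eq_integral => y _.
by rewrite -EFinM normrM /Phi invfM; congr EFin; ring.
Qed.

(** Everything is nonnegative, so the integral in space can be moved outside. *)
Lemma tonelli3 (c A : R) : 0 < c -> 0 < A ->
  (\int[leb]_t \int[leb]_s \int[mu]_y ((c * A)^-1 * (`|f 0 - f y| * Phi t s y))%:E =
   \int[mu]_y (((c * A)^-1 * `|f 0 - f y|)%:E * \int[leb]_t \int[leb]_s (Phi t s y)%:E))%E.
Proof.
move=> c0 A0.
have cA : 0 <= (c * A)^-1 by rewrite invr_ge0 mulr_ge0// ltW.
pose F t s y := (c * A)^-1 * (`|f 0 - f y| * Phi t s y).
have F0 t s y : 0 <= F t s y.
  by apply: mulr_ge0 => //; apply: mulr_ge0 => //; exact: Phi_ge0.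
have mF d (T : measurableType d) (t s : T -> R) (y : T -> 'rV[R]_n) :
    measurable_fun setT t -> measurable_fun setT s -> measurable_fun setT y ->
    measurable_fun setT (fun z => F (t z) (s z) (y z)).
  move=> mt ms my; apply: measurable_funM => //; apply: measurable_funM; last exact: mPhi.
  by apply: measurableT_comp => //; apply: measurable_funB => //; exact: measurableT_comp.
have c1 (a : R) : measurable_fun setT (fun _ : 'rV[R]_n => a) by exact: measurable_cst.
transitivity (\int[leb]_t \int[mu]_y \int[leb]_s (F t s y)%:E)%E.
  apply: eq_integral => t _.
  rewrite (@fubini_tonelli _ _ _ _ _ leb mu (EFin \o (fun p : R * 'rV[R]_n => F t p.1 p.2)))//.
  - apply/measurable_EFinP; by apply: (mF _ _ (fun=> t)).
  - by move=> p; rewrite lee_fin.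
have mF3 : measurable_fun setT (fun q : (R * 'rV[R]_n) * R => F q.1.1 q.2 q.1.2).
  apply: mF; [exact: (measurableT_comp measurable_fst measurable_fst)|exact: measurable_snd|
    exact: (measurableT_comp measurable_snd measurable_fst)].
rewrite (@fubini_tonelli _ _ _ _ _ leb mu (fun p : R * 'rV[R]_n => \int[leb]_s (F p.1 s p.2)%:E)%E); first last.
- by move=> p; apply: integral_ge0 => s _; rewrite lee_fin.
- apply: (@measurable_fun_fubini_tonelli_F _ _ _ _ _ leb (EFin \o (fun q : (R * 'rV[R]_n) * R => F q.1.1 q.2 q.1.2))).
    exact/measurable_EFinP.
  by move=> q; rewrite lee_fin.
apply: eq_integral => y _ /=.
have k0 : 0 <= (c * A)^-1 * `|f 0 - f y| by rewrite mulr_ge0.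
have mP : measurable_fun setT (fun p : R * R => Phi p.1 p.2 y).
  by apply: (mPhi (y := fun=> y)).
rewrite -ge0_integralZl; [|exact: measurableT| |
  by move=> t _; apply: integral_ge0 => s _; rewrite lee_fin|by rewrite lee_fin]; last first.
  apply: (@measurable_fun_fubini_tonelli_F _ _ _ _ _ leb (EFin \o (fun p : R * R => Phi p.1 p.2 y))).
    exact/measurable_EFinP.
  by move=> p; rewrite lee_fin.
apply: eq_integral => t _.
rewrite -ge0_integralZl; [|exact: measurableT| |
  by move=> s _; rewrite lee_fin|by rewrite lee_fin]; last first.
  by apply/measurable_EFinP; apply: (mPhi (t := fun=> t) (y := fun=> y)).
by apply: eq_integral => s _; rewrite -EFinM /F mulrA.
Qed.

(** The three hypotheses on A, c and K are the conclusions of [bernstein_power],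
    [mix_heat] and [kernel_le]; stated this way the constants visibly do not
    depend on f. *)
Lemma functional_bound (A c K : R) : 0 < A -> 0 < c -> 0 < K ->
  (forall x : R, 0 <= x ->
   (\int[leb]_s (expR (- (de * s)) * (1 - expR (- (expR s * x ^+ 2))))%:E =
    (A * x `^ (2 * de))%:E)%E) ->
  (forall r : R, 0 < r ->
  (\int[leb]_s (mix n s * heat_profile n (expR s) (r ^+ 2))%:E =
   (c * (expR (- r) / r ^+ n))%:E)%E) ->
  (forall r : R, 0 < r ->
  (\int[leb]_t \int[leb]_s
     (mix n t * (expR (- (de * s)) * `|heat_diff2 n (r ^+ 2) s t|))%:E <=
   (K * (ln (expR 1 + r^-1) / r `^ (n%:R + 2 * de)))%:E)%E) ->
  (`| \int[mu]_x (h x / enorm x ^+ n * expR (- enorm x))%:E | <=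
   ((c * A)^-1 * K)%:E * \int[mu]_x (`|f 0 - f x| / enorm x `^ (n%:R + gamma)
             * ln (expR 1 + (enorm x)^-1))%:E)%E.
Proof.
move=> A0 c0 K0 HA Hc HK.
have cA : 0 <= (c * A)^-1 by rewrite invr_ge0 mulr_ge0// ltW.
have e2 : 2 * de = gamma by rewrite /de; field.
under eq_integral do rewrite (lap_diff_mixture _ c0 Hc).
rewrite (Fubini (iG c0)).
have mGG : measurable_fun setT (fun t : R => \int[mu]_x (G c x t)%:E)%E.
  exact: (measurable_fubini_G (iG c0)).
apply: (le_trans (le_abse_integral leb measurableT (measurable_fubini_G (iG c0)))).
pose F t s y := (c * A)^-1 * (`|f 0 - f y| * Phi t s y).
have F0 t s y : 0 <= F t s y.
  by apply: mulr_ge0 => //; apply: mulr_ge0 => //; exact: Phi_ge0.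
have mF3 : measurable_fun setT (fun q : (R * R) * 'rV[R]_n => F q.1.1 q.1.2 q.2).
  apply: measurable_funM => //; apply: measurable_funM.
    apply: measurableT_comp => //; apply: measurable_funB => //.
    exact: (measurableT_comp mf measurable_snd).
  apply: mPhi; [exact: (measurableT_comp measurable_fst measurable_fst)|
    exact: (measurableT_comp measurable_snd measurable_fst)|exact: measurable_snd].
apply: (@le_trans _ _ (\int[leb]_t \int[leb]_s \int[mu]_y (F t s y)%:E)%E).
  apply: ge0_le_integral => //.
  - exact: measurableT_comp.
  - apply: (@measurable_fun_fubini_tonelli_F _ _ _ _ _ leb (fun p : R * R => \int[mu]_y (F p.1 p.2 y)%:E)%E).
      apply: (@measurable_fun_fubini_tonelli_F _ _ _ _ _ mu (EFin \o (fun q : (R * R) * 'rV[R]_n => F q.1.1 q.1.2 q.2))).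
        exact/measurable_EFinP.
      by move=> q; rewrite lee_fin.
    by move=> p; apply: integral_ge0 => y _; rewrite lee_fin.
  - by move=> t _; exact: inner_bound.
rewrite tonelli3//.
have mabs : measurable_fun setT (fun y => `|f 0 - f y|).
  by apply: measurableT_comp => //; exact: measurable_funB.
have men : measurable_fun setT (@enorm R n) by exact: (@measurable_enorm R _ _ n id).
have minv : measurable_fun setT (fun x : 'rV[R]_n => (enorm x)^-1).
  by apply: measurable_inv_ge0 => // x; exact: enorm_ge0.
have mW : measurable_fun setT (fun x => `|f 0 - f x| / enorm x `^ (n%:R + gamma)
             * ln (expR 1 + (enorm x)^-1)).
  apply: measurable_funM; first apply: measurable_funM => //.
    apply: measurable_inv_ge0; last by move=> x; exact: powR_ge0.
    exact: (measurableT_comp (@measurable_powR R (n%:R + gamma)) men).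
  by apply: (measurableT_comp (@measurable_ln R)); exact: measurable_funD.
have W0 x : 0 <= `|f 0 - f x| / enorm x `^ (n%:R + gamma) * ln (expR 1 + (enorm x)^-1).
  rewrite mulr_ge0// ?divr_ge0 ?powR_ge0//; apply: ln_ge0.
  have : 1 <= expR 1 :> R by rewrite -{1}(@expR0 R) ler_expR.
  have : 0 <= (enorm x)^-1 by rewrite invr_ge0 enorm_ge0.
  lra.
rewrite -ge0_integralZl; [|exact: measurableT|exact/measurable_EFinP
  |by move=> x _; rewrite lee_fin|by rewrite lee_fin mulr_ge0// ltW].
have mP3 : measurable_fun setT (fun q : ('rV[R]_n * R) * R => Phi q.1.2 q.2 q.1.1).
  apply: mPhi; [exact: (measurableT_comp measurable_snd measurable_fst)|exact: measurable_snd|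
    exact: (measurableT_comp measurable_fst measurable_fst)].
apply: ge0_le_integral => //.
- move=> y _; apply: mule_ge0; first by rewrite lee_fin mulr_ge0.
  by apply: integral_ge0 => t _; apply: integral_ge0 => s _; rewrite lee_fin.
- apply: emeasurable_funM; first by apply/measurable_EFinP; exact: measurable_funM.
  apply: (@measurable_fun_fubini_tonelli_F _ _ _ _ _ leb (fun p : 'rV[R]_n * R => \int[leb]_s (Phi p.2 s p.1)%:E)%E).
    apply: (@measurable_fun_fubini_tonelli_F _ _ _ _ _ leb (EFin \o (fun q : ('rV[R]_n * R) * R => Phi q.1.2 q.2 q.1.1))).
      exact/measurable_EFinP.
    by move=> q; rewrite lee_fin.
  by move=> p; apply: integral_ge0 => s _; rewrite lee_fin.
- by apply: measurable_funeM; exact/measurable_EFinP.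
move=> y _.
have [y0|y0] := eqVneq (enorm y) 0.
  by rewrite (enorm0_eq0 y0) subrr normr0 !mul0r mulr0 mul0e mule0.
have r0 : 0 < enorm y by rewrite lt_neqAle eq_sym y0 enorm_ge0.
have := HK _ r0; rewrite enorm2 => HKy.
apply: (@le_trans _ _ (((c * A)^-1 * `|f 0 - f y|)%:E *
  (K * (ln (expR 1 + (enorm y)^-1) / enorm y `^ (n%:R + 2 * de)))%:E)%E).
  by apply: lee_wpmul2l => //; rewrite lee_fin mulr_ge0.
by rewrite e2 -!EFinM lee_fin le_eqVlt; apply/orP; left; apply/eqP; ring.
Qed.

End final.

Theorem lemma6p2 (R : realType) (n : nat) (gamma : R)
    (hn : (2 <= n)%N) (hgamma : 0 < gamma < 1) :
  exists C : R, forall f : 'rV[R]_n -> R, schwartz f ->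
    (`| \int[lebesgue_rV n]_x
          ((frac_laplacian gamma f 0 - frac_laplacian gamma f x)
             / enorm x ^+ n * expR (- enorm x))%:E |
     <= C%:E *
        \int[lebesgue_rV n]_x
          (`|f 0 - f x| / enorm x `^ (n%:R + gamma)
             * ln (expR 1 + (enorm x)^-1))%:E)%E.
Proof.
have n0 : (0 < n)%N by exact: ltnW.
have /andP[g0 g1] := hgamma.
have de0 : 0 < gamma / 2 by rewrite divr_gt0.
have de1 : gamma / 2 <= 2^-1 by rewrite ler_pdivrMr// mulVf// ltW.
have [A [A0 HA]] := bernstein_power de0 de1.
have [c [c0 Hc]] := @mix_heat R n n0.
have [K [K0 HK]] := @kernel_le R n (gamma / 2) de0 de1 n0.
exists ((c * A)^-1 * K) => f sf.
exact: (functional_bound sf hgamma n0 A0 c0 K0 HA Hc HK).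
Qed.
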